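(* In the one-dimensional setting of the context, let $u(t,x,y)=\mathbb E[f(X_T^{t,x,y},Y_T^{t,y})]$ and let $(u^h_n)_{n=0,\dots,N}$ be the hybrid scheme with $\Pi^h_{\Delta x}(y)=(A^h_{\Delta x}(y))^{-1}B^h_{\Delta x}(y)$, where $A^h_{\Delta x}(y)$ is the implicit centered finite difference operator and $B^h_{\Delta x}(y)$ the explicit quadrature operator defined in the context. Assume that - $\frac{\nu'}{\nu},\frac{\nu''}{\nu}\in L^2(\mathbb R,d\nu)$; - the Markov chain $(\hat Y^h_n)_{n=0,\dots,N}$ satisfies Assumptions $\mathcal H_1$ and $\mathcal H_2$ (stated in the context); - $u\in C^{2,6}_{\mathrm{pol},T}(\mathbb R,\mathcal D)$. Then there exist $\bar h,C>0$ such that for every $h<\bar h$ and $\Delta x<1$ $$\big|u(0,\cdot,Y_0)-u^h_0(\cdot,Y_0)\big|_2\le C\,T\,(h+\Delta x^2).$$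
   Context: Setting. $\mathcal D\subseteq\mathbb R$ is a convex domain or the closure of one; $T>0$; $f:\mathbb R\times\mathcal D\to\mathbb R$; $dX_t=\mu_X(Y_t)dt+\sigma_X(Y_t)dB_t+\gamma_X(Y_t)dH_t$, $X_0\in\mathbb R$; $dY_t=\mu_Y(Y_t)dt+\sigma_Y(Y_t)dW_t$, $Y_0\in\mathcal D$, with $B,W$ independent one-dimensional Brownian motions and $H$ a real compound Poisson process independent of $(B,W)$, with intensity $\lambda$ and i.i.d. jumps having a density $p_{J_1}$; $\nu(x)=\lambda p_{J_1}(x)$ is the Lévy density; $d\nu=\nu(x)dx$. $(X^{t,x,y},Y^{t,y})$ is the solution starting from $(x,y)$ at time $t$. Standing assumptions: there is a unique weak solution, living in $\mathbb R\times\mathcal D$ a.s.; $u$ solves $\partial_tu+\mathcal Lu=0$ on $[0,T)\times\mathbb R\times\mathcal D$, $u(T,x,y)=f(x,y)$ on $\mathbb R\times\mathcal D$, where $\mathcal Lg=\frac12\sigma_X^2(y)\partial_x^2g+\frac12\sigma_Y^2(y)\partial_y^2g+\mu_X(y)\partial_xg+\mu_Y(y)\partial_yg+\int(g(x+\gamma_X(y)\zeta,y)-g(x,y))\nu(\zeta)d\zeta$; $\mu_X,\mu_Y,\sigma_X$ have polynomial growth; either $\gamma_X\equiv0$ or $\inf_{y\in\mathcal D}|\gamma_X(y)|\ge\varepsilon$ for some $\varepsilon>0$. Set $\nu_y\equiv0$ if $\gamma_X\equiv0$ and $\nu_y(x)=\frac1{|\gamma_X(y)|}\nu\big(\frac{x}{\gamma_X(y)}\big)$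 otherwise. Function spaces. $C^{q}_{\mathrm{pol},T}(\mathbb R\times\mathcal D)$: functions $v\in C^{\lfloor q/2\rfloor,q}([0,T)\times\mathbb R\times\mathcal D)$ for which, for some $C,a>0$, $\sup_{t<T}|\partial_t^k\partial_x^{l'}\partial_y^lv(t,x,y)|\le C(1+|(x,y)|^a)$ whenever $2k+l'+l\le q$. $C^{p,q}_{\mathrm{pol},T}(\mathbb R,\mathcal D)$: those $v\in C^q_{\mathrm{pol},T}(\mathbb R\times\mathcal D)$ for which, for some $C,a>0$, $\sup_{t<T}|\partial_t^k\partial_x^{l'}\partial_y^lv(t,\cdot,y)|_{L^p(\mathbb R,dx)}\le C(1+|y|^a)$ for $y\in\mathcal D$, $2k+l'+l\le q$. Scheme. $h=T/N$, $N\in\mathbb N^*$, $\Delta x>0$, $\mathcal X=\{x_i=X_0+i\Delta x\}_{i\in\mathbb Z}$, functions on $\mathcal X$ being identified with sequences indexed by $\mathbb Z$. $|\varphi|_2=(\sum_{x\in\mathcal X}|\varphi(x)|^2\Delta x)^{1/2}$ is the norm of $l_2(\mathcal X)$ (for functions on $\mathbb R$: of the restriction to $\mathcal X$). With $\alpha=\frac{h}{2\Delta x}\mu_X(y)$, $\beta=\frac{h}{2\Delta x^2}\sigma_X^2(y)$, the infinite matrix $A^h_{\Delta x}(y)$ has entries $\alpha-\beta$ if $i=j+1$; $1+2\beta$ if $i=j$; $-\alpha-\beta$ if $i=j-1$; $0$ if $|i-j|>1$ (it is invertible on $l_2(\mathcal X)$). $B^h_{\Delta x}(y)$ has entries $h\nu_y((j-i)\Delta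 x)\Delta x$ if $j\ne i$ and $1+h\big(\nu_y(0)\Delta x-\sum_{l\in\mathbb Z}\nu_y(l\Delta x)\Delta x\big)$ if $i=j$. For each $h$, $(\hat Y^h_n)_{n=0,\dots,N}$ is a Markov chain with state space $\mathcal Y^h_n\subseteq\mathcal D$ at step $n$, $\hat Y^h_0=Y_0$, independent of $B$ and $H$. $u^h_N(x,y)=f(x,y)$ on $\mathcal X\times\mathcal Y_N^h$ and, for $n=N-1,\dots,0$, $u^h_n(x,y)=\mathbb E[\Pi^h_{\Delta x}(y)u^h_{n+1}(\cdot,\hat Y^h_{n+1})(x)\mid\hat Y^h_n=y]$ on $\mathcal X\times\mathcal Y^h_n$. Assumption $\mathcal H_1$: there is $\bar h>0$ such that for every $h<\bar h$ and $n=0,\dots,N-1$: $\mathbb E[\hat Y^h_{n+1}-\hat Y^h_n\mid\hat Y^h_n]=\mu_Y(\hat Y^h_n)h+f_h(\hat Y^h_n)$, $\mathbb E[(\hat Y^h_{n+1}-\hat Y^h_n)^2\mid\hat Y^h_n]=\sigma_Y^2(\hat Y^h_n)h+g_h(\hat Y^h_n)$, $\mathbb E[(\hat Y^h_{n+1}-\hat Y^h_n)^3\mid\hat Y^h_n]=j_h(\hat Y^h_n)$, where $f_h,g_h,j_h:\mathcal D\to\mathbb R$ and, for some $p>1$, $C>0$, $\|f_h(\hat Y^h_n)\|_p,\|g_h(\hat Y^h_n)\|_p,\|j_h(\hat Y^h_n)\|_p\le Ch^2$ for all $h<\bar h$, $n=0,\dots,N$ ($\|\cdot\|_p$ the norm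 of $L^p(\Omega)$). Assumption $\mathcal H_2$: there is $\bar h>0$ such that for every $p>1$ there is $C_p>0$ with $\|\hat Y^h_n\|_p\le C_p$ for $h<\bar h$, $0\le n\le N$, and $\|\hat Y^h_{n+1}-\hat Y^h_n\|_p\le C_p\sqrt h$ for $h<\bar h$, $0\le n\le N-1$.
   Formalization: The terminal condition is taken to include u(t,x,y) → f(x,y) as t → T- for every (x,y); with only u(T,·)=f the claim fails, e.g. for f the indicator of {x = X_0}, nondegenerate constant σ_X, no jumps and constant Y. *)

(* Defs.v *)
From HB Require Import structures.
From mathcomp Require Import all_boot all_order all_algebra.
From mathcomp Require Import all_classical all_reals all_analysis.

Set Implicit Arguments.
Unset Strict Implicit.
Unset Printing Implicit Defensive.

Import Order.TTheory GRing.Theory Num.Theory.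
Import numFieldNormedType.Exports.

Local Open Scope classical_set_scope.
Local Open Scope ring_scope.

(* Functions of y are total on R; only their values on [dom] matter. *)
Record jump_model (R : realType) := JumpModel {
  horizon : R;
  dom : set R;
  muX : R -> R; sigmaX : R -> R; gammaX : R -> R;
  muY : R -> R; sigmaY : R -> R;
  intensity : R;
  jump_density : R -> R }.

Definition levy_density (R : realType) (M : jump_model R) : R -> R :=
  fun x => intensity M * jump_density M x.

Definition convex_domain_or_closure (R : realType) (D : set R) : Prop :=
  exists U : set R, [/\ open U, is_interval U, U !=set0 &
    D = U \/ D = closure U].

Definition polynomial_growth (R : realType) (D : set R) (g : R -> R) : Prop :=
  exists C a : R, [/\ 0 < C, 0 < a &
    forall y, D y -> `|g y| <= C * (1 + `|y| `^ a)].

Definition gamma_vanishes (R : realType) (M : jump_model R) : Prop :=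
  forall y, dom M y -> gammaX M y = 0.

Record model_hypotheses (R : realType) (M : jump_model R) : Prop := {
  horizon_gt0 : 0 < horizon M;
  dom_convex : convex_domain_or_closure (dom M);
  coefficients_measurable : [/\ measurable_fun (dom M) (muX M),
    measurable_fun (dom M) (sigmaX M), measurable_fun (dom M) (gammaX M),
    measurable_fun (dom M) (muY M) & measurable_fun (dom M) (sigmaY M)];
  coefficients_growth : [/\ polynomial_growth (dom M) (muX M),
    polynomial_growth (dom M) (muY M) & polynomial_growth (dom M) (sigmaX M)];
  gamma_dichotomy : gamma_vanishes M \/
    exists2 eps : R, 0 < eps & forall y, dom M y -> eps <= `|gammaX M y|;
  intensity_gt0 : 0 < intensity M;
  jump_density_ge0 : forall x, 0 <= jump_density M x;
  jump_density_measurable : measurable_fun [set: R] (jump_density M);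
  jump_density_mass :
    (\int[lebesgue_measure]_x (jump_density M x)%:E = 1)%E }.

(* nu'/nu and nu''/nu belong to L^2(R, d nu); where nu vanishes the quotient
   is 0 by convention, but that set is d nu-negligible. *)
Definition levy_density_regular (R : realType) (nu : R -> R) : Prop :=
  [/\ forall x, derivable nu x 1,
      forall x, derivable (derive1 nu) x 1,
      (\int[lebesgue_measure]_x ((derive1 nu x / nu x) ^+ 2 * nu x)%:E < +oo)%E &
      (\int[lebesgue_measure]_x
         ((derive1n 2 nu x / nu x) ^+ 2 * nu x)%:E < +oo)%E].

Section sigma_fields.
Context {R : realType} {d : measure_display} {Omega : measurableType d}.
Variable P : probability Omega R.

Definition sigma_of {I : Type} {d'} {T : measurableType d'}
    (J : set I) (Z : I -> Omega -> T) : set (set Omega) :=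
  <<s [set E | exists t A, [/\ J t, measurable A & E = Z t @^-1` A]] >>.

Definition sigma_join (G1 G2 : set (set Omega)) : set (set Omega) :=
  <<s G1 `|` G2 >>.

Definition independent2 (G1 G2 : set (set Omega)) : Prop :=
  forall E1 E2, G1 E1 -> G2 E2 -> (P (E1 `&` E2) = P E1 * P E2)%E.

(* For families containing [setT] this is full mutual independence. *)
Definition independent3 (G1 G2 G3 : set (set Omega)) : Prop :=
  forall E1 E2 E3, G1 E1 -> G2 E2 -> G3 E3 ->
    (P (E1 `&` E2 `&` E3) = P E1 * P E2 * P E3)%E.

(* Z is a version of E[X | Y]; the third clause is sigma(Y)-measurability. *)
Definition is_cond_exp (X Y Z : Omega -> R) : Prop :=
  [/\ P.-integrable [set: Omega] (EFin \o X),
      P.-integrable [set: Omega] (EFin \o Z),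
      (forall A : set R, measurable A ->
         exists2 B : set R, measurable B & Z @^-1` A = Y @^-1` B) &
      forall B : set R, measurable B ->
        (\int[P]_(w in Y @^-1` B) (Z w)%:E =
         \int[P]_(w in Y @^-1` B) (X w)%:E)%E].

(* Stated with measurable envelopes A n, since [set w | eps <= V n w] is not
   known to be measurable for the V used below. *)
Definition cvg0_in_probability (V : nat -> Omega -> \bar R) : Prop :=
  forall eps : R, 0 < eps -> exists A : nat -> set Omega,
    [/\ forall n, measurable (A n),
        forall n, [set w | (eps%:E <= V n w)%E] `<=` A n &
        P (A n) @[n --> \oo] --> 0%E].

Definition filtration (F : R -> set (set Omega)) : Prop :=
  (forall t, 0 <= t -> sigma_algebra setT (F t) /\ F t `<=` measurable) /\
  (forall s t, 0 <= s -> s <= t -> F s `<=` F t).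

Definition adapted (F : R -> set (set Omega)) (J : set R)
    (Z : R -> Omega -> R) : Prop :=
  forall t (A : set R), J t -> measurable A -> F t (Z t @^-1` A).

End sigma_fields.

Section processes.
Context {R : realType} {d : measure_display} {Omega : measurableType d}.
Variable P : probability Omega R.

Definition brownian_motion (F : R -> set (set Omega)) (B : R -> Omega -> R) :
    Prop :=
  [/\ adapted F [set t | 0 <= t] B,
      {ae P, forall w, B 0 w = 0 /\
        {within [set t | 0 <= t], continuous (B ^~ w)}},
      (forall s t (A : set R), 0 <= s -> s < t -> measurable A ->
        P [set w | A (B t w - B s w)] = normal_prob 0 (Num.sqrt (t - s)) A) &
      forall s, 0 <= s -> independent2 P (F s)
        (sigma_of [set t | s <= t] (fun t w => B t w - B s w))].

Definition poisson_process (lambda : R) (N : R -> Omega -> nat) : Prop :=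
  [/\ forall t, 0 <= t -> measurable_fun [set: Omega] (N t),
      {ae P, forall w, [/\ N 0 w = 0%N,
        forall s t, 0 <= s -> s <= t -> (N s w <= N t w)%N &
        forall s, 0 <= s -> \forall t \near s^'+, N t w = N s w]},
      (forall s t k, 0 <= s -> s < t ->
        P [set w | (N t w - N s w)%N = k] =
          (poisson_pmf (lambda * (t - s)) k)%:E) &
      forall s, 0 <= s -> independent2 P
        (sigma_of [set r | 0 <= r <= s] N)
        (sigma_of [set t | s <= t] (fun t w => (N t w - N s w)%N))].

(* The joint law below says that the J_k are i.i.d. with density p. *)
Definition compound_poisson (lambda : R) (p : R -> R)
    (N : R -> Omega -> nat) (J : nat -> Omega -> R) : Prop :=
  [/\ poisson_process lambda N,
      forall k, measurable_fun [set: Omega] (J k),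
      (forall (m : nat) (A : nat -> set R), (forall k, measurable (A k)) ->
        P [set w | forall k, (k < m)%N -> A k (J k w)] =
        (\prod_(k < m) \int[lebesgue_measure]_(x in A k) (p x)%:E)%E) &
      independent2 P (sigma_of [set t | 0 <= t] N)
                     (sigma_of [set: nat] J)].

Definition compound_sum (N : R -> Omega -> nat) (J : nat -> Omega -> R)
    (t : R) (w : Omega) : R := \sum_(k < N t w) J k w.

Definition jump_time (N : R -> Omega -> nat) (k : nat) (w : Omega) : R :=
  inf [set t | 0 <= t /\ (k < N t w)%N].

(* Integral over ]s, t] of Z dH, where H = compound_sum N J; it agrees with the
   integral of Z_- since it is used for Z with continuous paths. *)
Definition jump_integral (N : R -> Omega -> nat) (J : nat -> Omega -> R)
    (Z : R -> Omega -> R) (s t : R) (w : Omega) : R :=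
  \sum_(N s w <= k < N t w) Z (jump_time N k w) w * J k w.

(* Bounded simple predictable integrands
   sum_(i < m) xi_i 1_]tau_i, tau_(i+1)] on [s, T]. *)
Definition simple_integrand (F : R -> set (set Omega)) (s T : R) (m : nat)
    (tau : nat -> R) (xi : nat -> Omega -> R) : Prop :=
  [/\ forall i, s <= tau i <= T,
      forall i, tau i <= tau i.+1,
      (forall i (A : set R), measurable A -> F (tau i) (xi i @^-1` A)) &
      exists C : R, forall i w, `|xi i w| <= C].

Definition simple_process (m : nat) (tau : nat -> R) (xi : nat -> Omega -> R)
    (r : R) (w : Omega) : R :=
  \sum_(i < m) xi i w * \1_(`]tau i, tau i.+1]%classic) r.

Definition simple_integral (W : R -> Omega -> R) (m : nat) (tau : nat -> R)
    (xi : nat -> Omega -> R) (t : R) (w : Omega) : R :=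
  \sum_(i < m) xi i w *
    (W (Num.min (tau i.+1) t) w - W (Num.min (tau i) t) w).

(* I is the Ito integral int_s^. Z dW on [s, T]: the continuous process which
   is the limit in probability of integrals of simple integrands Z^n with
   int_s^T |Z^n - Z|^2 dr -> 0 in probability. *)
Definition ito_integral (F : R -> set (set Omega)) (W : R -> Omega -> R)
    (s T : R) (Z I : R -> Omega -> R) : Prop :=
  {ae P, forall w, {within `[s, T], continuous (I ^~ w)}} /\
  exists (m : nat -> nat) (tau : nat -> nat -> R) (xi : nat -> nat -> Omega -> R),
    [/\ forall n, simple_integrand F s T (m n) (tau n) (xi n),
        cvg0_in_probability P (fun n w =>
          (\int[lebesgue_measure]_(r in `[s, T])
             ((simple_process (m n) (tau n) (xi n) r w - Z r w) ^+ 2)%:E)%E) &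
        forall t, s <= t <= T -> cvg0_in_probability P (fun n w =>
          `|simple_integral W (m n) (tau n) (xi n) t w - I t w|%:E)].

End processes.

Record sde_system (R : realType) := SdeSystem {
  sde_display : measure_display;
  sde_space : measurableType sde_display;
  sde_prob : probability sde_space R;
  sde_filtration : R -> set (set sde_space);
  sde_B : R -> sde_space -> R;
  sde_W : R -> sde_space -> R;
  sde_N : R -> sde_space -> nat;
  sde_J : nat -> sde_space -> R;
  sde_X : R -> sde_space -> R;
  sde_Y : R -> sde_space -> R }.

Arguments sde_filtration {R} S t E : rename.
Arguments sde_B {R} S t w : rename.
Arguments sde_W {R} S t w : rename.
Arguments sde_N {R} S t w : rename.
Arguments sde_J {R} S k w : rename.
Arguments sde_X {R} S t w : rename.
Arguments sde_Y {R} S t w : rename.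

Definition sde_H (R : realType) (S : sde_system R) : R -> sde_space S -> R :=
  compound_sum (sde_N S) (sde_J S).

Arguments sde_H {R} S t w.

Section weak_solutions.
Context {R : realType}.
Variable M : jump_model R.

Definition driving_noise (S : sde_system R) : Prop :=
  let P := sde_prob S in let F := sde_filtration S in
  let B := sde_B S in let W := sde_W S in let H := sde_H S in
  let nonneg := [set t : R | 0 <= t] in
  [/\ filtration F,
      brownian_motion P F B /\ brownian_motion P F W,
      compound_poisson P (intensity M) (jump_density M) (sde_N S) (sde_J S) /\
        adapted F nonneg H,
      independent3 P (sigma_of nonneg B) (sigma_of nonneg W)
                     (sigma_of nonneg H) &
      forall s, 0 <= s -> independent2 P (F s)
        (sigma_join
          (sigma_join
            (sigma_of [set t | s <= t] (fun t w => B t w - B s w))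
            (sigma_of [set t | s <= t] (fun t w => W t w - W s w)))
          (sigma_of [set t | s <= t] (fun t w => H t w - H s w)))].

(* Weak solution on [t0, T] started from (x0, y0) at time t0, with values in
   R x dom. *)
Definition weak_solution (t0 x0 y0 : R) (S : sde_system R) : Prop :=
  let T := horizon M in
  let P := sde_prob S in let F := sde_filtration S in
  let X := sde_X S in let Y := sde_Y S in
  [/\ driving_noise S,
      adapted F `[t0, T] X /\ adapted F `[t0, T] Y,
      {ae P, forall w, forall t, t0 <= t <= T -> dom M (Y t w)},
      {ae P, forall w,
        [/\ lebesgue_measure.-integrable `[t0, T]
              (fun r => (muX M (Y r w))%:E),
            lebesgue_measure.-integrable `[t0, T]
              (fun r => (muY M (Y r w))%:E),
            lebesgue_measure.-integrable `[t0, T]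
              (fun r => (sigmaX M (Y r w) ^+ 2)%:E) &
            lebesgue_measure.-integrable `[t0, T]
              (fun r => (sigmaY M (Y r w) ^+ 2)%:E)]} &
      exists IX IY : R -> sde_space S -> R,
        [/\ ito_integral P F (sde_B S) t0 T (fun r w => sigmaX M (Y r w)) IX,
            ito_integral P F (sde_W S) t0 T (fun r w => sigmaY M (Y r w)) IY,
            {ae P, forall w, forall t, t0 <= t <= T ->
              X t w = x0
                + \int[lebesgue_measure]_(r in `[t0, t]) muX M (Y r w)
                + IX t w
                + jump_integral (sde_N S) (sde_J S)
                    (fun r w => gammaX M (Y r w)) t0 t w} &
            {ae P, forall w, forall t, t0 <= t <= T ->
              Y t w = y0
                + \int[lebesgue_measure]_(r in `[t0, t]) muY M (Y r w)
                + IY t w}]].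

(* Equality in law of the processes (X, Y) on [t0, T], through their
   finite-dimensional distributions. *)
Definition same_law (t0 : R) (S S' : sde_system R) : Prop :=
  forall (m : nat) (t : nat -> R) (A A' : nat -> set R),
    (forall i, t0 <= t i <= horizon M) ->
    (forall i, measurable (A i)) -> (forall i, measurable (A' i)) ->
    sde_prob S [set w | forall i, (i < m)%N ->
                  A i (sde_X S (t i) w) /\ A' i (sde_Y S (t i) w)] =
    sde_prob S' [set w | forall i, (i < m)%N ->
                  A i (sde_X S' (t i) w) /\ A' i (sde_Y S' (t i) w)].

Definition weakly_well_posed : Prop :=
  forall t0 x0 y0, 0 <= t0 <= horizon M -> dom M y0 ->
    (exists S, weak_solution t0 x0 y0 S) /\
    (forall S S', weak_solution t0 x0 y0 S -> weak_solution t0 x0 y0 S' ->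
       same_law t0 S S').

Definition is_expected_payoff (f : R -> R -> R) (u : R -> R -> R -> R) : Prop :=
  forall t x y, 0 <= t <= horizon M -> dom M y ->
  forall S, weak_solution t x y S ->
    let payoff := fun w => f (sde_X S (horizon M) w) (sde_Y S (horizon M) w) in
    (sde_prob S).-integrable setT (EFin \o payoff) /\
    u t x y = \int[sde_prob S]_w payoff w.

End weak_solutions.

(* Derivative relative to A, hence one-sided at end points of an interval A. *)
Definition quotient_on (R : realType) (g : R -> R) (a s : R) : R :=
  (g s - g a) / (s - a).

Definition has_derive_on (R : realType) (A : set R) (g : R -> R) (a l : R) :
    Prop := quotient_on g a s @[s --> within A a^'] --> l.

Definition derive_on (R : realType) (A : set R) (g : R -> R) (a : R) : R :=
  lim (quotient_on g a s @[s --> within A a^']).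

Section pide.
Context {R : realType}.
Variable M : jump_model R.

Definition generator (g : R -> R -> R) (x y : R) : R :=
  2^-1 * sigmaX M y ^+ 2 * derive1n 2 (g ^~ y) x
  + 2^-1 * sigmaY M y ^+ 2 * derive_on (dom M) (derive_on (dom M) (g x)) y
  + muX M y * derive1 (g ^~ y) x
  + muY M y * derive_on (dom M) (g x) y
  + \int[lebesgue_measure]_z
      ((g (x + gammaX M y * z) y - g x y) * levy_density M z).

(* The last clause makes u a genuine solution of the terminal value problem:
   without it f = u(T, ., .) would be unrelated to u on [0, T). *)
Definition solves_pide (f : R -> R -> R) (u : R -> R -> R -> R) : Prop :=
  (forall t x y, 0 <= t -> t < horizon M -> dom M y ->
     derive_on `[0, horizon M[%classic (fun s => u s x y) t
       + generator (u t) x y = 0) /\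
  (forall x y, dom M y ->
     u (horizon M) x y = f x y /\
     u s x y @[s --> (horizon M)^'-] --> f x y).

(* V k m l = d_t^k d_x^m d_y^l v, continuous on [0,T) x R x dom, for
   2k + m + l <= q; the derivatives may be taken in any order. *)
Definition is_partials (q : nat) (v : R -> R -> R -> R)
    (V : nat -> nat -> nat -> R -> R -> R -> R) : Prop :=
  let I : set R := `[0, horizon M[%classic in let D := dom M in
  (forall t x y, I t -> D y -> V 0%N 0%N 0%N t x y = v t x y) /\
  (forall k m l, (2 * k + m + l <= q)%N ->
    [/\ {within [set z : R * R * R | I z.1.1 /\ D z.2],
          continuous (fun z => V k m l z.1.1 z.1.2 z.2)},
        (2 * k.+1 + m + l <= q)%N -> forall t x y, I t -> D y ->
          has_derive_on I (fun s => V k m l s x y) t (V k.+1 m l t x y),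
        (2 * k + m.+1 + l <= q)%N -> forall t (x y : R), I t -> D y ->
          is_derive x 1 (fun s => V k m l t s y) (V k m.+1 l t x y) &
        (2 * k + m + l.+1 <= q)%N -> forall t x y, I t -> D y ->
          has_derive_on D (fun s => V k m l t x s) y (V k m l.+1 t x y)]).

Definition pol_bounded (q : nat) (V : nat -> nat -> nat -> R -> R -> R -> R) :
    Prop :=
  exists C a : R, [/\ 0 < C, 0 < a &
    forall k m l, (2 * k + m + l <= q)%N -> forall t x y,
      0 <= t -> t < horizon M -> dom M y ->
      `|V k m l t x y| <= C * (1 + Num.sqrt (x ^+ 2 + y ^+ 2) `^ a)].

Definition pol_Lp_bounded (p : \bar R) (q : nat)
    (V : nat -> nat -> nat -> R -> R -> R -> R) : Prop :=
  exists C a : R, [/\ 0 < C, 0 < a &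
    forall k m l, (2 * k + m + l <= q)%N -> forall t y,
      0 <= t -> t < horizon M -> dom M y ->
      ('N[lebesgue_measure]_p[EFin \o (V k m l t ^~ y)]
         <= (C * (1 + `|y| `^ a))%:E)%E].

Definition Cpol (q : nat) (v : R -> R -> R -> R) : Prop :=
  exists V, is_partials q v V /\ pol_bounded q V.

(* The two V below agree on [0,T) x R x dom, where [is_partials] determines
   them. *)
Definition Cpol_Lp (p : \bar R) (q : nat) (v : R -> R -> R -> R) : Prop :=
  Cpol q v /\ exists V, is_partials q v V /\ pol_Lp_bounded p q V.

End pide.

Section chain.
Context {R : realType} {d : measure_display} {Omega : measurableType d}.
Variable P : probability Omega R.
Variables (M : jump_model R) (Y0 : R).

Definition step (N : nat) : R := horizon M / N%:R.

(* Markov chain with state space [St n] and transition kernel [K n] at step n;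
   E[phi(Y_{n+1}) | Y_n = y] is the integral of phi against [K n y]. *)
Definition markov_chain (N : nat) (St : nat -> set R)
    (K : nat -> R.-pker R ~> R) (Y : nat -> Omega -> R) : Prop :=
  [/\ (forall n, (n <= N)%N -> measurable (St n) /\ St n `<=` dom M),
      (forall n, (n <= N)%N ->
         measurable_fun [set: Omega] (Y n) /\ forall w, St n (Y n w)),
      (forall w, Y 0%N w = Y0),
      (forall n y, (n < N)%N -> St n y -> K n y (St n.+1) = 1%E) &
      forall n (E : set Omega) (A : set R), (n < N)%N ->
        sigma_of [set i | (i <= n)%N] Y E -> measurable A ->
        P (E `&` Y n.+1 @^-1` A) = (\int[P]_(w in E) K n (Y n w) A)%E].

Definition assumption_H1 (Y : nat -> nat -> Omega -> R) : Prop :=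
  exists hbar : R, 0 < hbar /\
  exists fh gh jh : nat -> R -> R,
    (forall N n, (0 < N)%N -> step N < hbar -> (n < N)%N ->
      let incr := fun w => Y N n.+1 w - Y N n w in
      [/\ is_cond_exp P incr (Y N n)
            (fun w => muY M (Y N n w) * step N + fh N (Y N n w)),
          is_cond_exp P (fun w => incr w ^+ 2) (Y N n)
            (fun w => sigmaY M (Y N n w) ^+ 2 * step N + gh N (Y N n w)) &
          is_cond_exp P (fun w => incr w ^+ 3) (Y N n)
            (fun w => jh N (Y N n w))]) /\
    exists p C : R, [/\ 1 < p, 0 < C &
      forall N n, (0 < N)%N -> step N < hbar -> (n <= N)%N ->
      [/\ ('N[P]_(p%:E)[EFin \o (fun w => fh N (Y N n w))]
             <= (C * step N ^+ 2)%:E)%E,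
          ('N[P]_(p%:E)[EFin \o (fun w => gh N (Y N n w))]
             <= (C * step N ^+ 2)%:E)%E &
          ('N[P]_(p%:E)[EFin \o (fun w => jh N (Y N n w))]
             <= (C * step N ^+ 2)%:E)%E]].

Definition assumption_H2 (Y : nat -> nat -> Omega -> R) : Prop :=
  exists hbar : R, 0 < hbar /\
  forall p : R, 1 < p -> exists Cp : R, 0 < Cp /\
    forall N, (0 < N)%N -> step N < hbar ->
      (forall n, (n <= N)%N ->
         ('N[P]_(p%:E)[EFin \o (fun w => Y N n w)] <= Cp%:E)%E) /\
      (forall n, (n < N)%N ->
         ('N[P]_(p%:E)[EFin \o (fun w => (Y N n.+1 w - Y N n w)%R)]
            <= (Cp * Num.sqrt (step N))%:E)%E).

End chain.

Section scheme.
Context {R : realType}.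
Variable M : jump_model R.

(* A function on the grid is given by its values phi i = phi(x_i), i : int. *)
Definition grid (X0 dx : R) (i : int) : R := X0 + i%:~R * dx.

(* Sum over Z as the sum of the two one-sided series; every sum it is applied
   to below is meant to be absolutely convergent. *)
Definition zsum (a : int -> R) : R :=
  limn (series (fun n : nat => a (Posz n))) +
  limn (series (fun n : nat => a (Negz n))).

Definition l2norm (dx : R) (phi : int -> R) : \bar R :=
  ((\esum_(i in [set: int]) (`|phi i| ^+ 2 * dx)%:E) `^ 2^-1)%E.

Definition in_l2 (dx : R) (phi : int -> R) : Prop := (l2norm dx phi < +oo)%E.

Definition mx_apply (A : int -> int -> R) (phi : int -> R) (i : int) : R :=
  zsum (fun j => A i j * phi j).

Definition nu_y (y x : R) : R :=
  if `[< gamma_vanishes M >] then 0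
  else `|gammaX M y|^-1 * levy_density M (x / gammaX M y).

Definition A_mx (h dx y : R) (i j : int) : R :=
  let alpha := h / (2 * dx) * muX M y in
  let beta := h / (2 * dx ^+ 2) * sigmaX M y ^+ 2 in
  if i == j + 1 then alpha - beta
  else if i == j then 1 + 2 * beta
  else if i == j - 1 then - alpha - beta
  else 0.

Definition B_mx (h dx y : R) (i j : int) : R :=
  if i == j then
    1 + h * (nu_y y 0 * dx - zsum (fun l => nu_y y (l%:~R * dx) * dx))
  else h * nu_y y ((j - i)%:~R * dx) * dx.

(* The operator A^-1 B of l_2: for v in l_2, Pi v is the w in l_2 such that
   A w = B v; off l_2 it is set to 0. *)
Definition Pi_op (h dx y : R) (v : int -> R) : int -> R :=
  xget (fun=> 0) [set w : int -> R | [/\ in_l2 dx v, in_l2 dx w &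
    forall i, mx_apply (A_mx h dx y) w i = mx_apply (B_mx h dx y) v i]].

(* [backward k] is u^h_{N-k}. *)
Fixpoint backward (X0 : R) (f : R -> R -> R) (N : nat) (dx : R)
    (St : nat -> set R) (K : nat -> R.-pker R ~> R) (k : nat)
    (i : int) (y : R) : R :=
  if k is k'.+1 then
    \int[K (N - k'.+1)%N y]_(z in St (N - k')%N)
      Pi_op (step M N) dx y (fun j => backward X0 f N dx St K k' j z) i
  else f (grid X0 dx i) y.

Definition hybrid_scheme (X0 : R) (f : R -> R -> R) (N : nat) (dx : R)
    (St : nat -> set R) (K : nat -> R.-pker R ~> R) (n : nat) :
    int -> R -> R :=
  backward X0 f N dx St K (N - n)%N.

End scheme.

(* Main.v *)
Require Import Defs.
From HB Require Import structures.
From mathcomp Require Import all_boot all_order all_algebra.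
From mathcomp Require Import all_classical all_reals all_analysis measurable_realfun.
From mathcomp Require Import ring lra zify.

(* The implicit matrix dominates the identity on l2 and the explicit operator
   has norm at most 1 + 2hL, so the error e_n of the scheme satisfies
     E |e_n(., Y_n)|_2 <= (1 + 2hL) E |e_{n+1}(., Y_{n+1})|_2 + E tau_n
   with tau_n the l2 norm of the one-step consistency error, and the theorem
   follows by a discrete Gronwall argument once E tau_n <= C h (h + dx^2).
   To estimate tau_n, pair with a finitely supported sequence c: the function
   sum_i c_i u(t, x_i + x, y) dx still solves the equation, and the Sobolev
   sampling inequality turns the L2(dx) bounds on the derivatives of u into
   bounds of its derivatives, uniform in x, by the l2 norm of c times a power
   of |y|. Its consistency error is then controlled pointwise by Taylor
   expansions, the moment assumptions on the chain, and a midpoint quadrature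
   estimate for the jump integral, which needs nu' and nu'' in L1; this follows
   from the assumptions on nu'/nu and nu''/nu by Cauchy-Schwarz. *)

Set Implicit Arguments.
Unset Strict Implicit.
Unset Printing Implicit Defensive.

Import Order.TTheory GRing.Theory Num.Theory.
Import numFieldNormedType.Exports.

Local Open Scope classical_set_scope.
Local Open Scope ring_scope.

(** * Two-sided series and l2 sequences *)

(** The derivatives of [u] are controlled in L2(dx), whereas a Taylor remainder sits at an
    intermediate point depending on x, so it has no direct l2 bound. Duality removes this: an l2
    norm is a supremum of finite pairings, and since the coefficients depend on y only, a weighted
    sum of x-translates of [u] solves the same equation; for that one scalar function sup bounds
    suffice. Sampling spends one x-derivative, leaving parabolic order 5 out of 6, and the
    expansions stop at order 4. The same duality replaces Minkowski's inequality when a kernel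
    integral leaves the l2 norm. H1 bounds its error terms in L^p(Omega) only, hence not at a fixed
    y: the recursion runs on expectations, and speaks of [Y0] only at n = 0, where the chain is
    deterministic. The second derivative of nu exists everywhere but need not be continuous, so
    increments of nu' are bounded by integrating a measurable majorant rather than by the
    fundamental theorem of calculus. At the terminal time the equation gives only a left limit of
    [u]; estimates there are limits of those at earlier times. *)

Section two_sided_sums.
Context {R : realType}.
Implicit Types (a b d c : int -> R) (n : nat).

(** [Negz k] is -(k+1), so the window is -n <= i < n. It is not symmetric about 0, and the boundary
    terms in the shift lemmas below follow this convention. *)
Definition zbox n a : R := \sum_(k < n) (a (Posz k) + a (Negz k)).

(** Absolute summability as a bound on windows: no limit is involved, so it passes directly through
    comparisons and finite sums. *)
Definition zabs a : Prop := exists M, forall n, zbox n (fun i => `|a i|) <= M.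

Lemma zboxS n a : zbox n.+1 a = zbox n a + (a (Posz n) + a (Negz n)).
Proof. by rewrite /zbox big_ord_recr. Qed.

Lemma zbox0 a : zbox 0 a = 0. Proof. by rewrite /zbox big_ord0. Qed.

Lemma zboxD n a b : zbox n (fun i => a i + b i) = zbox n a + zbox n b.
Proof. by rewrite /zbox -big_split/=; apply: eq_bigr => k _; rewrite addrACA. Qed.

Lemma zboxZ n k a : zbox n (fun i => k * a i) = k * zbox n a.
Proof. by rewrite /zbox mulr_sumr; apply: eq_bigr => j _; rewrite mulrDr. Qed.

Lemma eq_zbox n a b : a =1 b -> zbox n a = zbox n b.
Proof. by move=> ab; apply: eq_bigr => k _; rewrite !ab. Qed.

Lemma zboxN n a : zbox n (fun i => - a i) = - zbox n a.
Proof. by rewrite -mulN1r -zboxZ; apply: eq_zbox => i; rewrite mulN1r. Qed.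

Lemma ler_zbox n a b : (forall i, a i <= b i) -> zbox n a <= zbox n b.
Proof. by move=> ab; apply: ler_sum => k _; rewrite lerD. Qed.

Lemma zbox_ge0 n a : (forall i, 0 <= a i) -> 0 <= zbox n a.
Proof. by move=> a0; apply: sumr_ge0 => k _; rewrite addr_ge0. Qed.

Lemma ler_norm_zbox n a : `|zbox n a| <= zbox n (fun i => `|a i|).
Proof.
apply: le_trans (ler_norm_sum _ _ _) _; apply: ler_sum => k _.
exact: ler_normD.
Qed.

Lemma zbox_nd a m n : (forall i, 0 <= a i) -> (m <= n)%N ->
  zbox m a <= zbox n a.
Proof.
move=> a0 /subnK <-; elim: (n - m)%N => [|k ih]; first by rewrite add0n.
by rewrite addSn zboxS; apply: le_trans ih _; rewrite lerDl addr_ge0.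
Qed.

Lemma zabs_le a b : (forall i, `|a i| <= b i) -> zabs b -> zabs a.
Proof.
move=> ab [M bM]; exists M => n; apply: le_trans (bM n).
by apply: ler_zbox => i; rewrite (le_trans (ab i))// ler_norm.
Qed.

Lemma zabs0 : zabs (fun=> 0).
Proof.
by exists 0 => n; rewrite /zbox big1// => k _; rewrite normr0 addr0.
Qed.

Lemma zabs_norm a : zabs a -> zabs (fun i => `|a i|).
Proof. by move=> [M aM]; exists M => n; under eq_zbox do rewrite normr_id. Qed.

Lemma zabsD a b : zabs a -> zabs b -> zabs (fun i => a i + b i).
Proof.
move=> [M aM] [M' bM]; exists (M + M') => n.
apply: (@le_trans _ _ (zbox n (fun i => `|a i| + `|b i|))).
  by apply: ler_zbox => i; exact: ler_normD.
by rewrite zboxD lerD.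
Qed.

Lemma zabsZ k a : zabs a -> zabs (fun i => k * a i).
Proof.
move=> [M aM]; exists (`|k| * M) => n.
under eq_zbox do rewrite normrM.
by rewrite zboxZ ler_wpM2l.
Qed.

Lemma zabsN a : zabs a -> zabs (fun i => - a i).
Proof. by move=> [M aM]; exists M => n; under eq_zbox do rewrite normrN. Qed.

Lemma eq_zabs a b : a =1 b -> zabs a -> zabs b.
Proof. by move=> /funext ->. Qed.

Lemma zabs_halves a : zabs a ->
  cvgn (series (fun n : nat => a (Posz n))) /\
  cvgn (series (fun n : nat => a (Negz n))).
Proof.
move=> [M aM]; split; apply: normed_cvg; apply: nondecreasing_is_cvgn.
- by apply: nondecreasing_series => n _ _; exact: normr_ge0.
- exists M => _ [n _ <-]; apply: le_trans (aM n).
  rewrite /normed_series_of /series/= /zbox big_mkord; apply: ler_sum => k _.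
  by rewrite lerDl.
- by apply: nondecreasing_series => n _ _; exact: normr_ge0.
- exists M => _ [n _ <-]; apply: le_trans (aM n).
  rewrite /normed_series_of /series/= /zbox big_mkord; apply: ler_sum => k _.
  by rewrite lerDr.
Qed.

(** [zsum] adds two one-sided limits. When both halves converge it is also the limit of the windows,
    and the later arguments handle windows only. *)
Lemma zsum_cvg a : zabs a -> zbox n a @[n --> \oo] --> zsum a.
Proof.
move=> /zabs_halves[c1 c2].
rewrite (_ : (fun n => zbox n a) = series (fun n : nat => a (Posz n)) +
    series (fun n : nat => a (Negz n))); first exact: cvgD.
by apply/funext => n; rewrite /zbox big_split/= fctE /series/= !big_mkord.
Qed.

Lemma zsum_uniq a l : zabs a -> zbox n a @[n --> \oo] --> l -> zsum a = l.
Proof. by move=> /zsum_cvg h1 h2; apply: cvg_unique h1 h2. Qed.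

Lemma eq_zsum a b : a =1 b -> zsum a = zsum b.
Proof. by move=> /funext ->. Qed.

Lemma zsumD a b : zabs a -> zabs b ->
  zsum (fun i => a i + b i) = zsum a + zsum b.
Proof.
move=> ha hb; apply: zsum_uniq; first exact: zabsD.
under eq_fun do rewrite zboxD.
by apply: cvgD; exact: zsum_cvg.
Qed.

Lemma zsumZ k a : zabs a -> zsum (fun i => k * a i) = k * zsum a.
Proof.
move=> ha; apply: zsum_uniq; first exact: zabsZ.
under eq_fun do rewrite zboxZ.
by apply: cvgMr; exact: zsum_cvg.
Qed.

Lemma zsumN a : zabs a -> zsum (fun i => - a i) = - zsum a.
Proof.
move=> ha; rewrite -mulN1r -zsumZ//.
by apply: eq_zsum => i; rewrite mulN1r.
Qed.

Lemma ler_zsum a b : zabs a -> zabs b -> (forall i, a i <= b i) ->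
  zsum a <= zsum b.
Proof.
move=> ha hb ab; apply: ler_cvg_to (zsum_cvg ha) (zsum_cvg hb) _.
by apply: nearW => n; exact: ler_zbox.
Qed.

Lemma zsum_ge0 a : zabs a -> (forall i, 0 <= a i) -> 0 <= zsum a.
Proof.
move=> ha a0; apply: cvgr_to_ge (zsum_cvg ha) _.
by apply: nearW => n; exact: zbox_ge0.
Qed.

Lemma zbox_le_zsum n a : zabs a -> (forall i, 0 <= a i) -> zbox n a <= zsum a.
Proof.
move=> ha a0; apply: cvgr_to_ge (zsum_cvg ha) _.
by exists n => // m /= nm; exact: zbox_nd.
Qed.

Lemma zsum_le a M : zabs a -> (forall n, zbox n a <= M) -> zsum a <= M.
Proof.
move=> ha aM; apply: cvgr_to_le (zsum_cvg ha) _.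
by apply: nearW => n.
Qed.

Lemma zabs_ge0 a M : (forall i, 0 <= a i) -> (forall n, zbox n a <= M) ->
  zabs a.
Proof.
by move=> a0 aM; exists M => n; under eq_zbox do rewrite ger0_norm//.
Qed.

Lemma ler_norm_zsum a : zabs a -> `|zsum a| <= zsum (fun i => `|a i|).
Proof.
move=> ha; have ha' := zabs_norm ha.
rewrite ler_norml -zsumN//; apply/andP; split.
  apply: ler_zsum => //; first exact: zabsN.
  by move=> i; rewrite lerNl ler_normr lexx orbT.
by apply: ler_zsum => // i; exact: ler_norm.
Qed.

Lemma term_le_zbox a i : (forall i, 0 <= a i) -> exists n, a i <= zbox n a.
Proof.
move=> a0; case: i => n; exists n.+1; rewrite zboxS.
  by rewrite addrCA lerDl addr_ge0// zbox_ge0.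
by rewrite addrA lerDr addr_ge0// zbox_ge0.
Qed.

Lemma term_le_zsum a i : zabs a -> (forall i, 0 <= a i) -> a i <= zsum a.
Proof.
move=> ha a0; have [n an] := term_le_zbox i a0.
exact: le_trans an (zbox_le_zsum _ ha a0).
Qed.

Lemma zabs_cvg0 a : zabs a ->
  a (Posz n) @[n --> \oo] --> 0 /\ a (Negz n) @[n --> \oo] --> 0.
Proof. by move=> /zabs_halves[/cvg_series_cvg_0 + /cvg_series_cvg_0]. Qed.

Lemma zbox_shift1 n a :
  zbox n (fun i => a (i + 1)) = zbox n a + a (Posz n) - a (- (Posz n)).
Proof.
elim: n => [|n ih]; first by rewrite !zbox0 oppr0 add0r subrr.
rewrite !zboxS ih.
have -> : Posz n + 1 = Posz n.+1 by rewrite intS addrC.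
have -> : Negz n + 1 = - Posz n by rewrite NegzE intS opprD addrAC addNr add0r.
have -> : - Posz n.+1 = Negz n by rewrite NegzE.
ring.
Qed.

Lemma zbox_shiftN1 n a :
  zbox n (fun i => a (i - 1)) = zbox n a - a (Posz n - 1) + a (Negz n).
Proof.
have := zbox_shift1 n (fun i => a (i - 1)).
under eq_zbox do rewrite addrK.
have -> : - Posz n - 1 = Negz n by rewrite NegzE intS opprD addrC.
by move=> ->; ring.
Qed.

Lemma zabs_shift1 a : zabs a -> zabs (fun i => a (i + 1)).
Proof.
move=> [M aM]; exists M => n; rewrite (zbox_shift1 n (fun i => `|a i|)).
apply: le_trans (aM n.+1); rewrite zboxS.
have := normr_ge0 (a (- Posz n)); have := normr_ge0 (a (Negz n)); lra.
Qed.

Lemma zabs_shiftN1 a : zabs a -> zabs (fun i => a (i - 1)).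
Proof.
move=> [M aM]; exists M => n; rewrite (zbox_shiftN1 n (fun i => `|a i|)).
apply: le_trans (aM n.+1); rewrite zboxS.
have := normr_ge0 (a (Posz n)); have := normr_ge0 (a (Posz n - 1)); lra.
Qed.

Lemma zsum_shift1 a : zabs a -> zsum (fun i => a (i + 1)) = zsum a.
Proof.
move=> ha; apply: zsum_uniq; first exact: zabs_shift1.
under eq_fun do rewrite zbox_shift1.
have [h1 h2] := zabs_cvg0 ha.
have -> : zsum a = zsum a + 0 - 0 by rewrite addr0 subr0.
apply: cvgB.
  by apply: cvgD => //; exact: zsum_cvg.
by rewrite -cvg_shiftS; under eq_fun do rewrite -NegzE.
Qed.

Lemma zsum_shiftN1 a : zabs a -> zsum (fun i => a (i - 1)) = zsum a.
Proof.
move=> ha; rewrite -[LHS]zsum_shift1; last exact: zabs_shiftN1.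
by apply: eq_zsum => i; rewrite addrK.
Qed.

(** Induction from unit shifts, whose boundary terms vanish in the limit. Summability and the value
    of the sum are carried together because each unit shift needs the former. *)
Lemma zshift a (k : int) : zabs a ->
  zabs (fun i => a (i + k)) /\ zsum (fun i => a (i + k)) = zsum a.
Proof.
move=> ha; case: k => n.
  elim: n => [|n [ih1 ih2]].
    by rewrite (_ : (fun i => a (i + _)) = a)//; apply/funext => i; rewrite addr0.
  rewrite (_ : (fun i => a (i + _)) = (fun i => a ((i + 1) + n))); last first.
    by apply/funext => i; rewrite -addrA intS.
  by rewrite (zsum_shift1 ih1); split => //; exact: (zabs_shift1 ih1).
elim: n => [|n [ih1 ih2]].
  by rewrite NegzE; split; [exact: zabs_shiftN1|exact: zsum_shiftN1].
rewrite (_ : (fun i => a (i + _)) = (fun i => a ((i - 1) + Negz n))); last first.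
  by apply/funext => i; rewrite !NegzE -addrA -opprD -intS.
by rewrite (zsum_shiftN1 ih1); split => //; exact: (zabs_shiftN1 ih1).
Qed.

Lemma zabs_shift a (k : int) : zabs a -> zabs (fun i => a (i + k)).
Proof. by move=> /zshift -/(_ k)[]. Qed.

Lemma zsum_shift a (k : int) : zabs a -> zsum (fun i => a (i + k)) = zsum a.
Proof. by move=> /zshift -/(_ k)[]. Qed.

Lemma zabs_zbox m (F : int -> int -> R) :
  (forall i, zabs (F i)) -> zabs (fun l => zbox m (F ^~ l)).
Proof.
move=> hF; elim: m => [|m ih].
  by under [X in zabs X]eq_fun do rewrite zbox0; exact: zabs0.
by under [X in zabs X]eq_fun do rewrite zboxS; do 2?[apply: zabsD => //].
Qed.

Lemma zsum_zbox m (F : int -> int -> R) : (forall i, zabs (F i)) ->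
  zbox m (fun i => zsum (F i)) = zsum (fun l => zbox m (F ^~ l)).
Proof.
move=> hF; elim: m => [|m ih].
  rewrite zbox0 (_ : (fun l => zbox 0 (F ^~ l)) = fun=> 0 * 0); last first.
    by apply/funext => l; rewrite zbox0 mulr0.
  by rewrite (@zsumZ 0 (fun=> 0)) ?mul0r//; exact: zabs0.
rewrite zboxS ih; under [in RHS]eq_zsum do rewrite zboxS.
rewrite zsumD; [|exact: zabs_zbox|exact: zabsD].
by rewrite (@zsumD (F (Posz m)) (F (Negz m))).
Qed.

(** Splitting the integers into the ranges of [Posz] and [Negz] turns the unordered sum inside
    [l2norm] into a limit of windows. *)
Lemma esum_zbox a : (forall i, 0 <= a i) ->
  (\esum_(i in [set: int]) (a i)%:E)%E = limn (fun n => (zbox n a)%:E).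
Proof.
move=> a0; rewrite (esumID (range Posz)); last by move=> i _; rewrite lee_fin.
rewrite setTI setTI (_ : ~` _ = range Negz); last first.
  apply/seteqP; split => [[n|n]|] /=.
  - by move=> h; exfalso; apply: h; exists n.
  - by move=> _; exists n.
  - by move=> _ [n _ <-] [].
rewrite !esum_image; [|by move=> x y _ _ []|by move=> x y _ _ []].
rewrite -!nneseries_esumT; [|by move=> n; rewrite lee_fin..].
rewrite -nneseriesD; [|by move=> n _; rewrite lee_fin..].
apply: congr_lim; apply/funext => n.
by rewrite /zbox -sumEFin big_mkord; apply: eq_bigr => k _; rewrite EFinD.
Qed.

End two_sided_sums.

(** * Duality, shifts and tridiagonal operators in l2 *)

Section square_summable.
Context {R : realType}.
Implicit Types (a b d c v w : int -> R) (n : nat).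

Definition l2s d : Prop := zabs (fun i => d i ^+ 2).

Definition sqsum d : R := zsum (fun i => d i ^+ 2).

Lemma sqsum_ge0 d : l2s d -> 0 <= sqsum d.
Proof. by move=> ld; apply: zsum_ge0 => // i; exact: sqr_ge0. Qed.

Lemma l2s_bound d M : (forall n, zbox n (fun i => d i ^+ 2) <= M) -> l2s d.
Proof. by move=> dM; apply: zabs_ge0 dM => i; exact: sqr_ge0. Qed.

Lemma sqsum_le d M : (forall n, zbox n (fun i => d i ^+ 2) <= M) ->
  sqsum d <= M.
Proof. by move=> dM; apply: zsum_le => //; exact: l2s_bound dM. Qed.

Lemma zbox_le_sqsum n d : l2s d -> zbox n (fun i => d i ^+ 2) <= sqsum d.
Proof. by move=> ld; apply: zbox_le_zsum => // i; exact: sqr_ge0. Qed.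

Lemma l2sD c d : l2s c -> l2s d -> l2s (fun i => c i + d i).
Proof.
move=> lc ld; apply: (@zabs_le _ _ (fun i => 2 * c i ^+ 2 + 2 * d i ^+ 2)).
  move=> i; rewrite ger0_norm ?sqr_ge0// -subr_ge0.
    by rewrite (_ : _ - _ = (c i - d i) ^+ 2) ?sqr_ge0//; ring.
by apply: zabsD; exact: zabsZ.
Qed.

Lemma l2sZ k d : l2s d -> l2s (fun i => k * d i).
Proof.
move=> ld; rewrite /l2s; under eq_fun do rewrite exprMn.
exact: zabsZ.
Qed.

Lemma l2sN d : l2s d -> l2s (fun i => - d i).
Proof.
rewrite /l2s (_ : (fun i => (- d i) ^+ 2) = (fun i => d i ^+ 2))//.
by apply/funext => i; rewrite sqrrN.
Qed.

Lemma l2s_shift d (k : int) : l2s d -> l2s (fun i => d (i + k)).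
Proof. by move=> ld; exact: (@zabs_shift _ (fun i => d i ^+ 2)). Qed.

Lemma sqsum_shift d (k : int) : l2s d -> sqsum (fun i => d (i + k)) = sqsum d.
Proof. by move=> ld; exact: (@zsum_shift _ (fun i => d i ^+ 2)). Qed.

Lemma l2sM c d : l2s c -> l2s d -> zabs (fun i => c i * d i).
Proof.
move=> lc ld; apply: (@zabs_le _ _ (fun i => c i ^+ 2 + d i ^+ 2)).
  move=> i; have := sqr_ge0 (c i + d i); have := sqr_ge0 (c i - d i).
    rewrite sqrrB sqrrD => h1 h2; rewrite ler_norml; apply/andP; split; lra.
exact: zabsD.
Qed.

Lemma l2s0 : l2s (fun=> 0).
Proof. by rewrite /l2s; under eq_fun do rewrite expr0n/=; exact: zabs0. Qed.

Lemma CauchySchwarz_zbox n c d : zbox n (fun i => c i * d i) <=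
  Num.sqrt (zbox n (fun i => c i ^+ 2)) * Num.sqrt (zbox n (fun i => d i ^+ 2)).
Proof.
set A := zbox n (fun i => c i ^+ 2); set D := zbox n (fun i => d i ^+ 2).
set B := zbox n _.
have A0 : 0 <= A by apply: zbox_ge0 => i; exact: sqr_ge0.
have D0 : 0 <= D by apply: zbox_ge0 => i; exact: sqr_ge0.
have Q s t : 0 <= s ^+ 2 * A - 2 * (s * t) * B + t ^+ 2 * D.
  rewrite /A /B /D -!zboxZ -zboxN -!zboxD; apply: zbox_ge0 => i.
  rewrite [leRHS](_ : _ = (s * c i - t * d i) ^+ 2) ?sqr_ge0//; ring.
apply: le_trans (ler_norm _) _; rewrite -sqrtr_sqr -sqrtrM// ler_sqrt; last first.
  exact: mulr_ge0.
(* If [D] = 0 the form at s = 1 is A - 2 t B; were [B] nonzero, t = (A + 1) / (2 B) would give it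
   the value -1. *)
have [D0'|Dn0] := eqVneq D 0.
  rewrite D0' mulr0 le_eqVlt; apply/orP; left; rewrite sqrf_eq0; apply/eqP.
  have [//|Bn0] := eqVneq B 0.
  have := Q 1 ((A + 1) / (2 * B)); rewrite D0' mulr0 addr0 expr1n !mul1r.
  rewrite [X in A - X](_ : _ = A + 1); last by field.
  lra.
have {}D0 : 0 < D by rewrite lt_neqAle eq_sym Dn0.
(* The choice s = [D], t = [B] in the quadratic form. *)
have : 0 <= D * (A * D - B ^+ 2) by apply: le_trans (Q D B) _; rewrite le_eqVlt; apply/orP; left; apply/eqP; ring.
by rewrite pmulr_rge0// subr_ge0.
Qed.

Lemma zbox_dual_le n d (C : R) : 0 <= C ->
  (forall c, zbox n (fun i => c i * d i) <=
     C * Num.sqrt (zbox n (fun i => c i ^+ 2))) ->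
  zbox n (fun i => d i ^+ 2) <= C ^+ 2.
Proof.
move=> C0 /(_ d); set S := zbox n (fun i => d i ^+ 2).
have S0 : 0 <= S by apply: zbox_ge0 => i; exact: sqr_ge0.
rewrite -/S -{1 3}(sqr_sqrtr S0) => h.
have := sqrtr_ge0 S; move: h; set t := Num.sqrt S => h t0.
have [->|tn0] := eqVneq t 0; first by rewrite expr0n/= sqr_ge0.
have {tn0}t0 : 0 < t by rewrite lt_neqAle eq_sym tn0.
by rewrite ler_sqr ?nnegrE// ?(ltW t0)//; rewrite expr2 ler_pM2r in h.
Qed.

(** Testing with c = d on each window suffices. A pairing over a window is a finite sum, so it
    commutes with kernel integrals; this is how l2 bounds on integrals of sequences are obtained
    below. *)
Lemma l2s_dual d (C : R) : 0 <= C ->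
  (forall n c, zbox n (fun i => c i * d i) <=
     C * Num.sqrt (zbox n (fun i => c i ^+ 2))) ->
  l2s d /\ sqsum d <= C ^+ 2.
Proof.
move=> C0 h; have dC n := zbox_dual_le C0 (h n).
by split; [exact: l2s_bound dC|exact: sqsum_le].
Qed.

Lemma l2s_bounded d : l2s d -> forall i, `|d i| <= Num.sqrt (sqsum d).
Proof.
move=> ld i; rewrite -sqrtr_sqr ler_sqrt ?sqsum_ge0//.
by apply: (@term_le_zsum _ (fun i => d i ^+ 2)) => // j; exact: sqr_ge0.
Qed.

(** A correlation rather than a convolution (index i + l): it matches the entries nu_y((j - i) dx)
    of the explicit matrix with l = j - i. *)
Definition zconv b v (i : int) : R := zsum (fun l => b l * v (i + l)).

Lemma zabs_bddr b v (M : R) : zabs b -> (forall i, `|v i| <= M) ->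
  zabs (fun l => b l * v l).
Proof.
move=> hb vM; apply: (@zabs_le _ _ (fun l => M * `|b l|)).
  by move=> l; rewrite normrM mulrC ler_wpM2r.
by apply: zabsZ; exact: zabs_norm.
Qed.

(** Young's inequality for l1 against l2, in dual form. Exchanging the finite sum over i with the
    series over l leaves, for each l, a pairing of c with a shift of v, bounded by Cauchy-Schwarz
    and shift invariance. *)
Lemma zconv_dual n b v c : zabs b -> l2s v ->
  zbox n (fun i => c i * zconv b v i) <= zsum (fun l => `|b l|) *
    Num.sqrt (sqsum v) * Num.sqrt (zbox n (fun i => c i ^+ 2)).
Proof.
move=> hb lv.
have bv i : zabs (fun l => b l * v (i + l)).
  apply: (@zabs_bddr _ _ (Num.sqrt (sqsum v))) => // l.
  exact: l2s_bounded.
under eq_zbox do rewrite -zsumZ//.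
rewrite zsum_zbox; last by move=> i; exact: zabsZ.
have hb' := zabs_norm hb.
rewrite -mulrA mulrC -zsumZ//; apply: ler_zsum; first by
  apply: zabs_zbox => i; exact: zabsZ.
  exact: zabsZ.
move=> l; under eq_zbox do rewrite mulrCA.
rewrite zboxZ; apply: le_trans (ler_norm _) _; rewrite normrM mulrC.
apply: ler_wpM2r => //; apply: le_trans (ler_norm_zbox _ _) _.
under eq_zbox do rewrite normrM.
apply: le_trans (CauchySchwarz_zbox _ _ _) _; rewrite mulrC.
apply: ler_pM; rewrite ?sqrtr_ge0//; last first.
  by under eq_zbox do rewrite real_normK ?num_real//.
rewrite ler_sqrt; last exact: sqsum_ge0.
under eq_zbox do rewrite real_normK ?num_real//.
rewrite -(sqsum_shift l lv); apply: zbox_le_sqsum; exact: l2s_shift.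
Qed.

Definition tri (a b c : R) w (i : int) : R :=
  b * w i + a * w (i - 1) + c * w (i + 1).

Lemma l2s_tri (a b c : R) w : l2s w -> l2s (tri a b c w).
Proof.
move=> lw; apply: l2sD; first apply: l2sD; apply: l2sZ => //.
  exact: (l2s_shift (-1)).
exact: (l2s_shift 1).
Qed.

(** From (x + y + z)^2 <= 3 (x^2 + y^2 + z^2) and shift invariance: a bound for the squared operator
    norm of [tri] on l2. *)
Definition tri_bound (a b c : R) : R := 3 * (a ^+ 2 + b ^+ 2 + c ^+ 2).

Lemma sqsum_tri (a b c : R) w : l2s w ->
  sqsum (tri a b c w) <= tri_bound a b c * sqsum w.
Proof.
move=> lw; have lw1 := l2s_shift 1 lw; have lw2 := l2s_shift (-1) lw.
have -> : tri_bound a b c * sqsum w = zsum (fun i => 3 * (b ^+ 2 * w i ^+ 2 +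
    a ^+ 2 * w (i - 1) ^+ 2 + c ^+ 2 * w (i + 1) ^+ 2)).
  rewrite zsumZ; last by do !apply: zabsD; exact: zabsZ.
  rewrite zsumD; [|by apply: zabsD; exact: zabsZ|exact: zabsZ].
  rewrite zsumD; [|exact: zabsZ..].
  rewrite !zsumZ// -/(sqsum w) -/(sqsum (fun i => w (i - 1))).
  rewrite -/(sqsum (fun i => w (i + 1))) !sqsum_shift// /tri_bound; ring.
apply: ler_zsum; first exact: l2s_tri.
  by apply: zabsZ; do !apply: zabsD; exact: zabsZ.
move=> i; rewrite /tri -subr_ge0.
set x := b * _; set y := a * _; set z := c * _.
rewrite (_ : _ - _ = (x - y) ^+ 2 + (x - z) ^+ 2 + (y - z) ^+ 2).
  by rewrite !addr_ge0 ?sqr_ge0.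
rewrite /x /y /z; ring.
Qed.

(** The centered first-order part is antisymmetric, so [al] cancels after a shift of the summation
    index. The second-order part contributes 2 be (|w|^2 - sum of w(i+1) w(i)), which is
    nonnegative. *)
Lemma tri_energy (al be : R) w : 0 <= be -> l2s w ->
  sqsum w <= zsum (fun i => tri (al - be) (1 + 2 * be) (- al - be) w i * w i).
Proof.
move=> be0 lw; have lw1 := l2s_shift 1 lw; have lw2 := l2s_shift (-1) lw.
pose x i := w (i + 1) * w i; have hx : zabs x by exact: l2sM.
have hx2 : zabs (fun i => x (i - 1)) by exact: (zabs_shift (-1)).
have -> : zsum (fun i => tri (al - be) (1 + 2 * be) (- al - be) w i * w i) =
   (1 + 2 * be) * sqsum w + - 2 * be * zsum x.
  under eq_zsum => i.
    rewrite (_ : _ * _ = ((1 + 2 * be) * w i ^+ 2 + (al - be) * x (i - 1)) +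
      (- al - be) * x i).
    over.
    rewrite /tri /x subrK; ring.
  rewrite zsumD; [|by apply: zabsD; exact: zabsZ|exact: zabsZ].
  rewrite zsumD; [|exact: zabsZ..].
  rewrite !zsumZ// (zsum_shift (-1))//.
  rewrite -/(sqsum w); ring.
have : zsum x <= sqsum w.
  rewrite (_ : sqsum w = zsum (fun i => 2^-1 * (w (i + 1) ^+ 2 + w i ^+ 2))).
    apply: ler_zsum => //; first by apply: zabsZ; exact: zabsD.
    move=> i; rewrite /x -subr_ge0.
    rewrite (_ : _ - _ = 2^-1 * (w (i + 1) - w i) ^+ 2); last by field.
    by rewrite mulr_ge0// sqr_ge0.
  rewrite zsumZ; last exact: zabsD.
  rewrite zsumD// -/(sqsum w) -/(sqsum (fun i => w (i + 1))) sqsum_shift//.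
  by field.
nra.
Qed.

(** Coercivity combined with g w <= (g^2 + w^2) / 2. This is the unconditional stability of the
    implicit step: no relation between h and dx enters. *)
Lemma sqsum_tri_ge (al be : R) w : 0 <= be -> l2s w ->
  sqsum w <= sqsum (tri (al - be) (1 + 2 * be) (- al - be) w).
Proof.
move=> be0 lw; have := tri_energy al be0 lw.
set g := tri _ _ _ w => h; have lg : l2s g by exact: l2s_tri.
have : zsum (fun i => g i * w i) <= 2^-1 * (sqsum g + sqsum w).
  rewrite -zsumD// -zsumZ; last exact: zabsD.
  apply: ler_zsum; [exact: l2sM|by apply: zabsZ; exact: zabsD|].
  move=> i; rewrite -subr_ge0.
  rewrite (_ : _ - _ = 2^-1 * (g i - w i) ^+ 2); last by field.
  by rewrite mulr_ge0// sqr_ge0.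
lra.
Qed.

End square_summable.

(** * Operators on the grid *)

Section tridiagonal_inverse.
Context {R : realType}.
Implicit Types (d g v w : int -> R) (n m : nat).

(* Richardson iteration: the coercivity of [tri] makes [1 - tau tri] a strict
   contraction of l2 for this [tau]. *)
Definition tri_tau (al be : R) : R :=
  (tri_bound (al - be) (1 + 2 * be) (- al - be))^-1.

Definition tri_res (al be : R) d (i : int) : R :=
  d i - tri_tau al be * tri (al - be) (1 + 2 * be) (- al - be) d i.

(** The Neumann series tau sum_m (1 - tau T)^m g, taken coordinatewise. Having the inverse as a
    limit of explicit finite expressions is what later makes the scheme measurable in y. *)
Definition tri_inv (al be : R) g (i : int) : R :=
  tri_tau al be * limn (series (fun m => iter m (tri_res al be) g i)).

Lemma tri_tau_itv (al be : R) : 0 <= be -> 0 < tri_tau al be < 1.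
Proof.
move=> be0; rewrite /tri_tau.
have h : 1 < tri_bound (al - be) (1 + 2 * be) (- al - be).
  rewrite /tri_bound; have := sqr_ge0 (al - be); have := sqr_ge0 (- al - be).
  nra.
have h0 := lt_trans ltr01 h.
by rewrite invr_gt0 h0 invf_lt1.
Qed.

Section fixed_coefficients.
Variables (al be : R).
Hypothesis be0 : 0 <= be.
Local Notation tau := (tri_tau al be).
Local Notation T := (tri (al - be) (1 + 2 * be) (- al - be)).

Lemma l2s_res d : l2s d -> l2s (tri_res al be d).
Proof. by move=> ld; apply: l2sD => //; apply: l2sN; apply: l2sZ; exact: l2s_tri. Qed.

(** In |d|^2 - 2 tau (T d, d) + tau^2 |T d|^2, coercivity makes the middle term at most -2 tau
    |d|^2, and the last is at most tau |d|^2 because tau is the inverse of the bound on the squared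
    norm of T. *)
Lemma sqsum_res d : l2s d -> sqsum (tri_res al be d) <= (1 - tau) * sqsum d.
Proof.
move=> ld; have lT : l2s (T d) by exact: l2s_tri.
have /andP[t0 t1] := tri_tau_itv al be0.
have -> : sqsum (tri_res al be d) = sqsum d + - (2 * tau) *
    zsum (fun i => T d i * d i) + tau ^+ 2 * sqsum (T d).
  rewrite /sqsum -!zsumZ//; last exact: l2sM.
  rewrite -!zsumD//; first by apply: eq_zsum => i; rewrite /tri_res; ring.
  - by apply: zabsD => //; apply: zabsZ; exact: l2sM.
  - exact: zabsZ.
  - by apply: zabsZ; exact: l2sM.
have h1 := tri_energy al be0 ld.
have h2 : tau ^+ 2 * sqsum (T d) <= tau * sqsum d.
  rewrite expr2 -mulrA ler_pM2l// -[leRHS](mulVKf (lt0r_neq0 t0)).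
  rewrite ler_pM2l// mulrC; apply: le_trans (sqsum_tri _ _ _ ld) _.
  by rewrite /tri_tau invrK mulrC.
have : tau * sqsum d <= tau * zsum (fun i => T d i * d i) by rewrite ler_pM2l.
lra.
Qed.

Lemma l2s_iter_res m g : l2s g -> l2s (iter m (tri_res al be) g).
Proof. by move=> lg; elim: m => // m ih; exact: l2s_res. Qed.

Lemma sqsum_iter_res m g : l2s g ->
  sqsum (iter m (tri_res al be) g) <= (1 - tau) ^+ m * sqsum g.
Proof.
move=> lg; have /andP[t0 t1] := tri_tau_itv al be0.
elim: m => [|m ih]; first by rewrite mul1r.
rewrite iterS exprS -mulrA; apply: le_trans (sqsum_res _) _.
  exact: l2s_iter_res.
by rewrite ler_wpM2l// subr_ge0 ltW.
Qed.

Lemma iter_res_bound m g (i : int) : l2s g ->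
  `|iter m (tri_res al be) g i| <=
    Num.sqrt (sqsum g) * (Num.sqrt (1 - tau)) ^+ m.
Proof.
move=> lg; have /andP[t0 t1] := tri_tau_itv al be0.
have t2 : 0 <= 1 - tau by rewrite subr_ge0 ltW.
apply: le_trans (l2s_bounded (l2s_iter_res m lg) i) _.
have -> : Num.sqrt (1 - tau) ^+ m = Num.sqrt ((1 - tau) ^+ m).
  by elim: m => [|m ih]; rewrite ?expr0 ?sqrtr1// !exprS ih sqrtrM.
rewrite -sqrtrM ?sqsum_ge0// ler_sqrt.
  by rewrite mulrC; exact: sqsum_iter_res.
by rewrite mulr_ge0 ?sqsum_ge0// exprn_ge0.
Qed.

Lemma cvg_iter_res g (i : int) : l2s g ->
  cvgn (series (fun m => iter m (tri_res al be) g i)).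
Proof.
move=> lg; have /andP[t0 t1] := tri_tau_itv al be0.
have t2 : 0 <= 1 - tau by rewrite subr_ge0 ltW.
apply: normed_cvg; apply: (@series_le_cvg _ _
  (geometric (Num.sqrt (sqsum g)) (Num.sqrt (1 - tau)))).
- by move=> n; exact: normr_ge0.
- by move=> n; rewrite /geometric/= mulr_ge0// ?exprn_ge0 ?sqrtr_ge0.
- by move=> n; exact: iter_res_bound.
- apply: is_cvg_geometric_series.
  by rewrite ger0_norm ?sqrtr_ge0// -[ltRHS]sqrtr1 ltr_sqrt// ltrBlDr ltrDl.
Qed.

Let psum g m (i : int) := tau * \sum_(k < m) iter k (tri_res al be) g i.

Let l2s_psum g m : l2s g -> l2s (psum g m).
Proof.
move=> lg; rewrite /psum; apply: l2sZ; elim: m => [|m ih].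
  by under [X in l2s X]eq_fun do rewrite big_ord0; exact: l2s0.
under [X in l2s X]eq_fun do rewrite big_ord_recr/=.
by apply: l2sD => //; exact: l2s_iter_res.
Qed.

(** Telescoping: tau T = 1 - (1 - tau T), so T applied to tau times the geometric sum leaves 1 minus
    the m-th power. *)
Let tri_psum g m (i : int) : T (psum g m) i = g i - iter m (tri_res al be) g i.
Proof.
elim: m => [|m ih].
  by rewrite /tri /psum !big_ord0 !mulr0 !addr0 subrr.
have E j : psum g m.+1 j = psum g m j + tau * iter m (tri_res al be) g j.
  by rewrite /psum big_ord_recr/= mulrDr.
rewrite iterS; set r := iter m _ g in ih E *.
transitivity (T (psum g m) i + tau * T r i); first by rewrite /tri !E; ring.
by rewrite ih /tri_res; ring.
Qed.

Let psum_cvg g (i : int) : l2s g -> psum g m i @[m --> \oo] --> tri_inv al be g i.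
Proof.
move=> lg; apply: cvgMr.
rewrite (_ : (fun m => \sum_(k < m) _) =
  series (fun m => iter m (tri_res al be) g i)); first exact: cvg_iter_res.
by apply/funext => m; rewrite /series/= big_mkord.
Qed.

Lemma tri_invP g : l2s g -> l2s (tri_inv al be g) /\ T (tri_inv al be g) =1 g.
Proof.
move=> lg; split.
  (* Only coordinatewise convergence is known, so the bound is passed to the limit on each window.
     For a partial sum s, |s|^2 <= |T s|^2 = |g - r|^2 <= 2 |g|^2 + 2 |r|^2 with |r| <= |g|, whence
     the 4. *)
  apply: (@l2s_bound _ _ (4 * sqsum g)) => n.
  have : zbox n (fun i => psum g m i ^+ 2) @[m --> \oo] -->
         zbox n (fun i => tri_inv al be g i ^+ 2).
    elim: n => [|n ih].
      by under eq_fun do rewrite zbox0; rewrite zbox0; exact: cvg_cst.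
    under eq_fun do rewrite zboxS; rewrite zboxS.
    by apply: cvgD => //; apply: cvgD; apply: cvgM; exact: psum_cvg.
  move/cvgr_to_le; apply; apply: nearW => m.
  apply: le_trans (zbox_le_sqsum _ (l2s_psum m lg)) _.
  apply: le_trans (sqsum_tri_ge al be0 (l2s_psum m lg)) _.
  have lr := l2s_iter_res m lg.
  rewrite (_ : 4 * sqsum g = zsum (fun i => 2 * g i ^+ 2) + 2 * sqsum g); last first.
    by rewrite zsumZ// -/(sqsum g); ring.
  apply: (@le_trans _ _ (zsum (fun i => 2 * g i ^+ 2 + 2 * (iter m (tri_res al be) g i) ^+ 2))).
    apply: ler_zsum; first by apply: l2s_tri; exact: l2s_psum.
      by apply: zabsD; exact: zabsZ.
    move=> i; rewrite tri_psum -subr_ge0.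
    rewrite (_ : _ - _ = (g i + iter m (tri_res al be) g i) ^+ 2) ?sqr_ge0//.
    ring.
  rewrite zsumD; [|exact: zabsZ..].
  rewrite lerD2l zsumZ// ler_pM2l//; apply: le_trans (sqsum_iter_res _ lg) _.
  rewrite -[leRHS]mul1r; apply: ler_wpM2r; first exact: sqsum_ge0.
  have /andP[t0 t1] := tri_tau_itv al be0.
  by apply: exprn_ile1; lra.
move=> i.
have h1 : T (psum g m) i @[m --> \oo] --> T (tri_inv al be g) i.
  by rewrite /tri; apply: cvgD; first apply: cvgD; apply: cvgMr; exact: psum_cvg.
have h2 : T (psum g m) i @[m --> \oo] --> g i.
  under eq_fun do rewrite tri_psum.
  have -> : g i = g i - 0 by rewrite subr0.
  apply: cvgB; first by rewrite subr0; exact: cvg_cst.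
  exact: cvg_series_cvg_0 (cvg_iter_res (i := i) lg).
exact: cvg_unique h1 h2.
Qed.

Lemma tri_inj w w' : l2s w -> l2s w' -> T w =1 T w' -> w =1 w'.
Proof.
move=> lw lw' ww'.
have ld : l2s (fun i => w i - w' i) by apply: l2sD => //; exact: l2sN.
have : sqsum (fun i => w i - w' i) <= 0.
  apply: le_trans (sqsum_tri_ge al be0 ld) _.
  rewrite (_ : sqsum _ = 0)//; rewrite -[RHS](mul0r (zsum (fun=> 0 : R))).
  rewrite -zsumZ; last exact: zabs0.
  apply: eq_zsum => i; rewrite mul0r (_ : T _ i = 0) ?expr0n//.
  rewrite (_ : T _ i = T w i - T w' i); first by rewrite ww' subrr.
  by rewrite /tri; ring.
move=> h i; apply/eqP; rewrite -subr_eq0 -normr_le0.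
apply: le_trans (l2s_bounded ld i) _.
by rewrite ler0_sqrtr.
Qed.

End fixed_coefficients.
End tridiagonal_inverse.

(** * The matrices of the scheme as operators on sequences *)

Section grid_operators.

Context {R : realType}.
Implicit Types (d g v w : int -> R) (n m : nat) (M : jump_model R).

Lemma zsum_delta (k : int) (x : R) :
  zabs (fun j => if j == k then x else 0) /\
  zsum (fun j => if j == k then x else 0) = x.
Proof.
have H0 (z : R) n : zbox n.+1 (fun j : int => if j == 0 then z else 0) = z.
  elim: n => [|n ih]; first by rewrite zboxS zbox0 /= add0r addr0.
  by rewrite zboxS ih /= !addr0.
have hz : zabs (fun j : int => if j == 0 then x else 0).
  exists `|x| => -[|n]; first by rewrite zbox0.
  under eq_zbox => i.
    rewrite (_ : `|_| = if i == 0 then `|x| else 0); last first.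
      by case: ifP => // _; rewrite normr0.
    over.
  by rewrite H0.
rewrite (_ : (fun j => _) = fun j => (if j - k == 0 then x else 0)); last first.
  by apply/funext => j; rewrite subr_eq0.
split; first exact: (@zabs_shift _ (fun j : int => if j == 0 then x else 0)).
rewrite (@zsum_shift _ (fun j : int => if j == 0 then x else 0))//.
apply: zsum_uniq => //; rewrite -cvg_shiftS; under eq_fun do rewrite H0.
exact: cvg_cst.
Qed.

Definition mx_alpha M (h dx y : R) : R := h / (2 * dx) * muX M y.
Definition mx_beta M (h dx y : R) : R := h / (2 * dx ^+ 2) * sigmaX M y ^+ 2.
Definition jump_weight M (dx y : R) (l : int) : R := nu_y M y (l%:~R * dx) * dx.

Definition tri_A M (h dx y : R) : (int -> R) -> int -> R :=
  tri (mx_alpha M h dx y - mx_beta M h dx y) (1 + 2 * mx_beta M h dx y)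
      (- mx_alpha M h dx y - mx_beta M h dx y).

Definition jump_part (k : int -> R) v (i : int) : R :=
  zsum (fun l => k l * (v (i + l) - v i)).

Definition explicit_B M (h dx y : R) v (i : int) : R :=
  v i + h * jump_part (jump_weight M dx y) v i.

Lemma mx_apply_A M (h dx y : R) w (i : int) :
  mx_apply (A_mx M h dx y) w i = tri_A M h dx y w i.
Proof.
rewrite /mx_apply /A_mx /tri_A /tri -/(mx_alpha M h dx y) -/(mx_beta M h dx y).
set a := mx_alpha M h dx y - mx_beta M h dx y; set b := 1 + _.
set c := - mx_alpha M h dx y - mx_beta M h dx y.
have [h1 e1] := zsum_delta (i - 1) (a * w (i - 1)).
have [h2 e2] := zsum_delta i (b * w i).
have [h3 e3] := zsum_delta (i + 1) (c * w (i + 1)).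
rewrite -{}e1 -{}e2 -{}e3 -zsumD// -zsumD//; last exact: zabsD.
apply: eq_zsum => j.
have -> : (i == j + 1) = (j == i - 1) by rewrite eq_sym -subr_eq opprK.
have -> : (i == j - 1) = (j == i + 1) by rewrite eq_sym subr_eq.
rewrite (eq_sym i j).
have [->|j1] := eqVneq j (i - 1).
  have -> : (i - 1 == i) = false by apply/eqP; lia.
  have -> : (i - 1 == i + 1) = false by apply/eqP; lia.
  by rewrite add0r addr0.
have [->|j2] := eqVneq j i.
  have -> : (i == i + 1) = false by apply/eqP; lia.
  by rewrite !addr0.
have [->|j3] := eqVneq j (i + 1); first by rewrite !add0r.
by rewrite mul0r !addr0.
Qed.

(** The diagonal entry is the off-diagonal formula taken at j = i plus 1 - h zsum k, so each row is
    a delta plus a correlation; boundedness of [v] makes the series converge. *)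
Lemma mx_apply_B M (h dx y : R) v (C : R) (i : int) :
  zabs (jump_weight M dx y) -> (forall i, `|v i| <= C) ->
  mx_apply (B_mx M h dx y) v i = explicit_B M h dx y v i.
Proof.
set k := jump_weight M dx y => hk vC.
have hkv : zabs (fun l => k l * v (i + l)) by exact: (zabs_bddr hk).
have hkv' : zabs (fun j => k (j - i) * v j).
  apply: (eq_zabs _ (zabs_shift (- i) hkv)) => j /=.
  by rewrite [i + _]addrC subrK.
have Ev : zsum (fun j => k (j - i) * v j) = zsum (fun l => k l * v (i + l)).
  rewrite -(zsum_shift (- i) hkv); apply: eq_zsum => j.
  by rewrite [i + _]addrC subrK.
have [hd ed] := zsum_delta i ((1 - h * zsum k) * v i).
rewrite /mx_apply /explicit_B.
transitivity (zsum (fun j => (if j == i then (1 - h * zsum k) * v i else 0) +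
    h * (k (j - i) * v j))).
  apply: eq_zsum => j; rewrite /B_mx eq_sym; have [->|ji] := eqVneq j i.
    rewrite -/(jump_weight M dx y) -/k subrr /k /jump_weight mul0r; ring.
  by rewrite /k /jump_weight add0r !mulrA.
rewrite zsumD//; last exact: zabsZ.
rewrite ed zsumZ// Ev /jump_part.
have -> : zsum (fun l => k l * (v (i + l) - v i)) =
  zsum (fun l => k l * v (i + l) + - v i * k l).
  by apply: eq_zsum => l; ring.
by rewrite zsumD//; [rewrite zsumZ//; ring|exact: zabsZ].
Qed.

Lemma jump_partE (k : int -> R) v (i : int) : zabs k -> l2s v ->
  jump_part k v i = zconv k v i - zsum k * v i.
Proof.
move=> hk lv.
have hkv : zabs (fun l => k l * v (i + l)).
  by apply: zabs_bddr => // l; exact: l2s_bounded.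
rewrite /jump_part /zconv (_ : (fun l => k l * (v (i + l) - v i)) =
  fun l => k l * v (i + l) + - v i * k l); last by apply/funext => l; ring.
by rewrite zsumD//; [rewrite zsumZ//; ring|exact: zabsZ].
Qed.

(** The explicit operator is (1 - h zsum k) times the identity plus h times the correlation with k.
    Since k has l1 norm at most [L], the two parts have norms at most 1 + hL and hL. *)
Lemma explicit_B_dual M (h dx y L : R) v n (c : int -> R) : 0 <= h ->
  zabs (jump_weight M dx y) -> zsum (fun l => `|jump_weight M dx y l|) <= L ->
  l2s v ->
  zbox n (fun i => c i * explicit_B M h dx y v i) <=
  (1 + 2 * h * L) * Num.sqrt (sqsum v) * Num.sqrt (zbox n (fun i => c i ^+ 2)).
Proof.
move=> h0 hk kL lv; set k := jump_weight _ _ _ in hk kL *.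
under eq_zbox => i.
  rewrite (_ : _ * _ = (1 - h * zsum k) * (c i * v i) + h * (c i * zconv k v i)).
    over.
  by rewrite /explicit_B jump_partE//; ring.
rewrite zboxD !zboxZ.
set q := Num.sqrt (zbox _ _); set s := Num.sqrt _.
have q0 : 0 <= q by exact: sqrtr_ge0.
have s0 : 0 <= s by exact: sqrtr_ge0.
have h1 : `|zbox n (fun i => c i * v i)| <= s * q.
  apply: le_trans (ler_norm_zbox _ _) _; under eq_zbox do rewrite normrM.
  apply: le_trans (CauchySchwarz_zbox _ _ _) _; rewrite mulrC; apply: ler_pM.
  - exact: sqrtr_ge0.
  - exact: sqrtr_ge0.
  - rewrite ler_sqrt ?sqsum_ge0//.
    under eq_zbox do rewrite real_normK ?num_real//.
    exact: zbox_le_sqsum.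
  - by under eq_zbox do rewrite real_normK ?num_real//.
have h2 : zbox n (fun i => c i * zconv k v i) <= L * (s * q).
  rewrite mulrA; apply: le_trans (zconv_dual _ _ hk lv) _.
  by do 2!(apply: ler_wpM2r => //).
have h3 : `|1 - h * zsum k| <= 1 + h * L.
  apply: le_trans (ler_normB _ _) _; rewrite normr1 lerD2l normrM (ger0_norm h0).
  by apply: ler_wpM2l => //; apply: le_trans (ler_norm_zsum hk) _.
have h4 : h * zbox n (fun i => c i * zconv k v i) <= h * (L * (s * q)).
  exact: ler_wpM2l.
have h5 : (1 - h * zsum k) * zbox n (fun i => c i * v i) <= (1 + h * L) * (s * q).
  apply: le_trans (ler_norm _) _; rewrite normrM.
  by apply: ler_pM.
rewrite -mulrA; apply: le_trans (lerD h5 h4) _.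
rewrite le_eqVlt; apply/orP; left; apply/eqP; ring.
Qed.

Lemma explicit_B_l2 M (h dx y L : R) v : 0 <= h ->
  zabs (jump_weight M dx y) -> zsum (fun l => `|jump_weight M dx y l|) <= L ->
  l2s v -> l2s (explicit_B M h dx y v) /\
    Num.sqrt (sqsum (explicit_B M h dx y v)) <=
      (1 + 2 * h * L) * Num.sqrt (sqsum v).
Proof.
move=> h0 hk kL lv.
have L0 : 0 <= L.
  by apply: le_trans kL; apply: zsum_ge0 => //; exact: zabs_norm.
have C0 : 0 <= (1 + 2 * h * L) * Num.sqrt (sqsum v).
  by rewrite mulr_ge0 ?sqrtr_ge0// addr_ge0// !mulr_ge0.
have [l1 l2] := l2s_dual C0 (fun n c => explicit_B_dual n c h0 hk kL lv).
by split => //; rewrite -(ger0_norm C0) -sqrtr_sqr ler_sqrt// sqr_ge0.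
Qed.

Lemma esum_sq_l2s (dx : R) v : 0 < dx -> l2s v ->
  (\esum_(i in [set: int]) (`|v i| ^+ 2 * dx)%:E = (sqsum v * dx)%:E)%E.
Proof.
move=> dx0 lv; rewrite (@esum_zbox _ (fun i => `|v i| ^+ 2 * dx)); last first.
  by move=> i; rewrite mulr_ge0 ?sqr_ge0 ?ltW.
under eq_fun do under eq_zbox do rewrite real_normK ?num_real// mulrC.
apply/cvg_lim => //; apply: cvg_EFin; first exact: nearW.
under eq_fun do rewrite /= zboxZ.
by rewrite mulrC; apply: cvgMr; exact: zsum_cvg.
Qed.

Lemma l2normE (dx : R) v : 0 < dx -> l2s v ->
  l2norm dx v = (Num.sqrt (sqsum v * dx))%:E.
Proof.
move=> dx0 lv; rewrite /l2norm esum_sq_l2s// poweR_EFin powR12_sqrt//.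
by rewrite mulr_ge0 ?sqsum_ge0 ?ltW.
Qed.

Lemma in_l2P (dx : R) v : 0 < dx -> in_l2 dx v <-> l2s v.
Proof.
move=> dx0; split; last by move=> lv; rewrite /in_l2 l2normE// ltry.
rewrite /in_l2 /l2norm => /lty_poweRy.
rewrite invr_eq0 pnatr_eq0 => /(_ isT).
rewrite (@esum_zbox _ (fun i => `|v i| ^+ 2 * dx)); last first.
  by move=> i; rewrite mulr_ge0 ?sqr_ge0 ?ltW.
set u := fun n => _ => lu.
have u0 i : 0 <= `|v i| ^+ 2 * dx by rewrite mulr_ge0 ?sqr_ge0 ?ltW.
have ul n : (u n <= limn u)%E.
  rewrite (cvg_lim _ (ereal_nondecreasing_cvgn _))//; first by apply: ereal_sup_ubound; exists n.
    by move=> p q pq; rewrite lee_fin; exact: zbox_nd.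
apply: (@l2s_bound _ _ (dx^-1 * fine (limn u))) => n.
have : u n = (dx * zbox n (fun i => v i ^+ 2))%:E.
  by rewrite /u -zboxZ; congr EFin; apply: eq_zbox => i; rewrite real_normK ?num_real// mulrC.
have := ul n => /[swap] ->.
have -> : limn u = (fine (limn u))%:E.
  rewrite fineK// ge0_fin_numE//; apply: le_trans (ul 0%N).
  by rewrite /u zbox0.
by rewrite lee_fin /= -ler_pdivlMl.
Qed.

(** [xget] returns an unspecified l2 solution; injectivity of the implicit matrix on l2 identifies
    it with the Neumann series. *)
Lemma Pi_opE M (h dx y : R) v : 0 < h -> 0 < dx ->
  zabs (jump_weight M dx y) -> l2s v ->
  Pi_op M h dx y v =
    tri_inv (mx_alpha M h dx y) (mx_beta M h dx y) (explicit_B M h dx y v).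
Proof.
move=> h0 dx0 hk lv.
have be0 : 0 <= mx_beta M h dx y.
  by rewrite /mx_beta mulr_ge0 ?sqr_ge0// divr_ge0 ?ltW// mulr_gt0 ?exprn_gt0.
have [lB _] := explicit_B_l2 (ltW h0) hk (lexx _) lv.
have [l1 l2] := tri_invP (mx_alpha M h dx y) be0 lB.
have vb := l2s_bounded lv.
rewrite /Pi_op; case: xgetP => [w -> [/= _ lw ew]|/(_ (tri_inv (mx_alpha M h dx y) (mx_beta M h dx y) (explicit_B M h dx y v)))].
  apply/funext; apply: (tri_inj be0 (al := mx_alpha M h dx y)) => //.
    exact/(in_l2P _ dx0).
  move=> i; rewrite l2 -(mx_apply_B _ _ hk vb) -ew.
  by rewrite mx_apply_A.
case; split; [exact/in_l2P|exact/in_l2P|move=> i].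
by rewrite mx_apply_A (mx_apply_B _ _ hk vb) -l2.
Qed.

Lemma Pi_op_outside M (h dx y : R) v : 0 < dx -> ~ l2s v ->
  Pi_op M h dx y v = fun=> 0.
Proof.
move=> dx0 nv; rewrite /Pi_op; case: xgetP => // w _ [/= lv _ _].
by case: nv; exact/(in_l2P _ dx0).
Qed.

Lemma Pi_opP M (h dx y L : R) v : 0 < h -> 0 < dx ->
  zabs (jump_weight M dx y) -> zsum (fun l => `|jump_weight M dx y l|) <= L ->
  l2s v ->
  [/\ l2s (Pi_op M h dx y v),
      tri_A M h dx y (Pi_op M h dx y v) =1 explicit_B M h dx y v &
      Num.sqrt (sqsum (Pi_op M h dx y v)) <=
        (1 + 2 * h * L) * Num.sqrt (sqsum v)].
Proof.
move=> h0 dx0 hk kL lv; rewrite Pi_opE//.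
have be0 : 0 <= mx_beta M h dx y.
  by rewrite /mx_beta mulr_ge0 ?sqr_ge0// divr_ge0 ?ltW// mulr_gt0 ?exprn_gt0.
have [lB nB] := explicit_B_l2 (ltW h0) hk kL lv.
have [l1 l2] := tri_invP (mx_alpha M h dx y) be0 lB.
split => //; apply: le_trans nB; rewrite ler_sqrt ?sqsum_ge0//.
apply: le_trans (sqsum_tri_ge (mx_alpha M h dx y) be0 l1) _.
by rewrite (_ : tri _ _ _ _ = explicit_B M h dx y v)//; exact/funext.
Qed.

End grid_operators.

(** * Sobolev sampling and quadrature *)

Section variation.
Context {R : realType}.
Local Notation mu := lebesgue_measure.

Lemma ge0_integral_itv_split (a b c : R) (G : R -> \bar R) :
  measurable_fun [set: R] G -> (forall x, 0 <= G x)%E -> a <= b -> b <= c ->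
  (\int[mu]_(x in `]a, c]) G x =
   \int[mu]_(x in `]a, b]) G x + \int[mu]_(x in `]b, c]) G x)%E.
Proof.
move=> mG G0 ab bc.
have -> : `]a, c]%classic = `]a, b] `|` `]b, c].
  by rewrite -itv_bndbnd_setU ?bnd_simp.
rewrite ge0_integral_setU//; first exact: measurable_funTS.
apply/disj_set2P; rewrite -subset0 => x [/=].
by rewrite !in_itv/= => /andP[_ h1] /andP[h2 _]; move: (lt_le_trans h2 h1); rewrite ltxx.
Qed.

(** The strict inequality l < c absorbs the o(d) term. Both sides of x are treated at once, as the
    continuation argument below moves to the right of a point and arrives at one from the left. *)
Lemma is_derive_lt_near (F : R -> R) (x l c : R) : is_derive x 1 F l -> l < c ->
  \forall d \near 0^'+, (F (x + d) - F x <= c * d) /\ (F x - F (x - d) <= c * d).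
Proof.
move=> [/cvg_ex[/= l' hl'] <-] lc.
have : h^-1 *: (F (h *: 1 + x) - F x) @[h --> 0^'] --> 'D_1 F x.
  by rewrite /derive (cvg_lim _ hl').
move=> /cvgr_lt => /(_ _ lc); rewrite near_withinE => -[e /= e0 he].
near=> d.
have d0 : 0 < d by near: d; exact: nbhs_right_gt.
have de : d < e by near: d; exact: nbhs_right_lt.
have := he d; rewrite /= sub0r normrN gtr0_norm// => /(_ de (lt0r_neq0 d0)).
have := he (- d); rewrite /= sub0r opprK gtr0_norm//.
rewrite oppr_eq0 => /(_ de (lt0r_neq0 d0)).
rewrite /GRing.scale /= !mulr1 (addrC _ x) (addrC _ x) => h1 h2; split; last first.
  move: h1; rewrite invrN mulNr -mulrN opprB -ltr_pdivlMl ?invr_gt0// invrK.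
  by rewrite mulrC => /ltW.
by move: h2; rewrite -ltr_pdivlMl ?invr_gt0// invrK mulrC => /ltW.
Unshelve. all: by end_near. Qed.

Lemma le_lebesgue_measure (A B : set R) : measurable A -> measurable B ->
  A `<=` B -> (mu A <= mu B)%E.
Proof. by move=> mA mB AB; apply: le_measure => //; exact: mem_set. Qed.

Lemma integral_scaled_indic (k : R) (A D : set R) : 0 <= k -> measurable A ->
  measurable D ->
  (\int[mu]_(x in D) (k * \1_A x)%:E = k%:E * mu (A `&` D))%E.
Proof.
move=> k0 mA mD; under eq_integral do rewrite EFinM.
rewrite ge0_integralZl_EFin ?integral_indic//.
by apply/measurable_EFinP; exact: measurable_indic.
Qed.

(* Covering the level set [n e <= g < (n+1) e] by an open set of almost the
   same measure makes the majorant [G] of [g] locally bounded below by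
   [(n+1) e], so that increments of [F] are compared with integrals of [G]
   near every point, without any continuity of the derivative. *)
Lemma derive_majorant_le (F F' g : R -> R) (a b : R) : a <= b ->
  (forall x : R, is_derive x 1 F (F' x)) -> measurable_fun [set: R] g ->
  (forall x, 0 <= g x) -> (forall x, F' x <= g x) ->
  ((F b - F a)%:E <= \int[mu]_(x in `[a, b]) (g x)%:E)%E.
Proof.
move=> ab dF mg g0 Fg; apply/lee_addgt0Pr => e' e'0.
(* The error budget: rounding [g] up to the next multiple of e costs e (b - a), and the open covers
   cost e altogether. *)
pose e := e' / (b - a + 1).
have ba0 : 0 < b - a + 1 by lra.
have e0 : 0 < e by rewrite divr_gt0.
pose E n := `[a, b]%classic `&` g @^-1` (`[n%:R * e, n.+1%:R * e[).
have mE n : measurable (E n).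
  apply: measurableI => //; rewrite -[X in measurable X]setTI.
  by apply: mg.
have finE n : (mu (E n) < +oo)%E.
  apply: (@le_lt_trans _ _ (mu `[a, b]%classic)).
    by apply: le_lebesgue_measure => // ? [].
  by rewrite lebesgue_measure_itv/=; case: ifP => // _; rewrite ltry.
(* Excess measure allowed to the n-th cover: times its height (n+1) e, it amounts to e / 2^(n+1). *)
pose r n := e / (2 ^ n.+1)%:R / (n.+1%:R * e).
have n1e (n : nat) : 0 < n.+1%:R * e :> R by rewrite mulr_gt0.
have r0 n : 0 < r n by rewrite !divr_gt0// ltr0n expn_gt0.
have /choice[U HU] : forall n, exists U : set R,
   [/\ open U, E n `<=` U & (mu (U `\` E n) < (r n)%:E)%E].
  by move=> n; by apply: lebesgue_regularity_outer; [exact: mE|exact: finE|exact: r0].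
have mU n : measurable (U n) by apply: open_measurable; have [] := HU n.
pose Gn n x : \bar R := ((n.+1%:R * e) * \1_(U n) x)%:E.
have Gn0 n x : (0 <= Gn n x)%E by rewrite lee_fin mulr_ge0// ltW.
have mGn n : measurable_fun [set: R] (Gn n).
  by apply/measurable_EFinP/measurable_funM => //; exact: measurable_indic.
pose G x : \bar R := (\sum_(n <oo) Gn n x)%E.
have G0 x : (0 <= G x)%E by exact: nneseries_ge0.
have mG : measurable_fun [set: R] G.
  exact: (@ge0_emeasurable_sum _ _ _ _ Gn xpredT).
have lev n x : g x \in `[n%:R * e, n.+1%:R * e[ -> Num.truncn (g x / e) = n.
  rewrite in_itv/= => /andP[h1 h2]; apply: truncn_def.
  by rewrite ler_pdivlMr// ltr_pdivrMr// h1.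
have intG : (\int[mu]_(x in `[a, b]) G x <= \int[mu]_(x in `[a, b]) (g x)%:E + e'%:E)%E.
  rewrite integral_nneseries//; last by move=> n; by apply: measurable_funTS; exact: mGn.
  apply: (@le_trans _ _ (\sum_(n <oo) (\int[mu]_(x in E n) (g x + e)%:E +
      (e / (2 ^ n.+1)%:R)%:E))%E).
    apply: lee_nneseries => // [n _ _|n _]; first exact: integral_ge0.
    rewrite /Gn integral_scaled_indic//; last exact: ltW.
    have [oU EU mUE] := HU n.
    apply: (@le_trans _ _ ((n.+1%:R * e)%:E * (mu (E n) + (r n)%:E))%E).
      rewrite lee_pmul2l//; last by rewrite lte_fin.
      apply: (@le_trans _ _ (mu (U n))).
        by apply: le_lebesgue_measure; [exact: measurableI|exact: mU|exact: subIsetl].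
      have -> : mu (U n) = (mu (E n) + mu (U n `\` E n))%E.
        rewrite -measureU; first by rewrite setDUK.
        - exact: mE.
        - by apply: measurableD; [exact: mU|exact: mE].
        - by rewrite setDIK.
      by rewrite leeD2l// ltW.
    rewrite ge0_muleDr ?measure_ge0//; last by rewrite lee_fin ltW.
    rewrite -EFinM [X in (_ + X%:E)%E](_ : _ = e / (2 ^ n.+1)%:R); last first.
      by rewrite /r mulrC mulfVK// gt_eqF.
    rewrite leeD2r// -integral_cst//; last exact: mE.
    apply: ge0_le_integral; first exact: mE.
    - by move=> x _; rewrite lee_fin ltW.
    - exact: measurable_cst.
    - by apply: measurable_funTS; apply/measurable_EFinP/measurable_funD.
    - move=> x [_ /=]; rewrite in_itv/= => /andP[h _]; rewrite lee_fin.
      by rewrite -natr1 mulrDl mul1r lerD2r.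
  apply: le_trans (epsilon_trick _ _ _) _ => //.
  - by move=> n; apply: integral_ge0 => x _; rewrite lee_fin addr_ge0// ltW.
  - exact: ltW.
  rewrite -ge0_integral_bigcup//; last 3 first.
  - apply/measurable_EFinP/measurable_funD => //; exact: measurable_funTS.
  - by move=> x _; rewrite lee_fin addr_ge0// ltW.
  - apply/trivIsetP => i j _ _ ij; rewrite -subset0 => x [[_ /=]].
    by move=> /lev hi [_ /lev hj]; move: ij; rewrite -hi -hj eqxx.
  have -> : \bigcup_k E k = `[a, b]%classic.
    apply/seteqP; split => [x [n _ []]//|x xab].
    exists (Num.truncn (g x / e)) => //; split => //=.
    rewrite in_itv/= -ler_pdivlMr// -ltr_pdivrMr//; apply: truncn_itv.
    by rewrite divr_ge0// ltW.
  under eq_integral do rewrite EFinD.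
  rewrite ge0_integralD//; last 3 first.
  - by move=> x _; rewrite lee_fin.
  - by apply/measurable_EFinP; exact: measurable_funTS.
  - by move=> x _; rewrite lee_fin ltW.
  rewrite -addeA leeD2l// integral_cst//= lebesgue_measure_itv/=.
  rewrite lte_fin; case: ltP => [_|_].
    rewrite -EFinB -EFinM -EFinD lee_fin -{2}(mulr1 e) -mulrDr /e mulfVK//.
    by rewrite gt_eqF.
  rewrite mule0 add0e lee_fin /e ler_pdivrMr//.
  by apply: ler_peMr; [exact: ltW|lra].
apply: le_trans intG.
have [->|Gfin] := eqVneq (\int[mu]_(x in `[a, b]) G x)%E +oo%E; first by rewrite leey.
pose W (x y : R) : \bar R := (\int[mu]_(z in `]x, y]) G z)%E.
have W0 (x y : R) : (0 <= W x y)%E by exact: integral_ge0.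
have WE : W a b = (\int[mu]_(x in `[a, b]) G x)%E.
  by rewrite /W -integral_itv_obnd_cbnd//; exact: measurable_funTS.
rewrite -WE.
(* Around x the set [U n] keeps [G] above (n+1) e, which exceeds F' x strictly; short increments of
   F on either side are therefore at most the integral of [G]. *)
have local (x : R) : a <= x <= b -> \forall d \near (0 : R)^'+,
   ((F (x + d) - F x)%:E <= W x (x + d)%R)%E /\
   ((F x - F (x - d))%:E <= W (x - d)%R x)%E.
  move=> xab; pose n := Num.truncn (g x / e).
  have gx : n%:R * e <= g x < n.+1%:R * e.
    rewrite -ler_pdivlMr// -ltr_pdivrMr//; apply: truncn_itv.
    by rewrite divr_ge0// ltW.
  have Ex : E n x by split; rewrite /= in_itv.
  have [oU EU _] := HU n.
  have /nbhs_ballP[s /= s0 sU] : nbhs x (U n) by exact: open_nbhs_nbhs (conj oU (EU _ Ex)).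
  have GU z : U n z -> ((n.+1%:R * e)%:E <= G z)%E.
    move=> Uz; apply: (@le_trans _ _ (Gn n z)).
      by rewrite /Gn indicE mem_set// mulr1.
    by rewrite /G (@nneseriesD1 _ _ n)// leeDl// nneseries_ge0.
  have Fc : F' x < n.+1%:R * e by apply: le_lt_trans (Fg x) _; case/andP: gx.
  have hd := is_derive_lt_near (dF x) Fc.
  near=> d.
  have d0 : 0 < d by near: d; exact: nbhs_right_gt.
  have ds : d < s by near: d; exact: nbhs_right_lt.
  have [h1 h2] : (F (x + d) - F x <= n.+1%:R * e * d) /\
     (F x - F (x - d) <= n.+1%:R * e * d) by near: d; exact: hd.
  have WW u v : u < v -> v - u = d -> (forall z, u < z <= v -> U n z) ->
     ((n.+1%:R * e * d)%:E <= W u v)%E.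
    move=> uv uvd hU.
    apply: (@le_trans _ _ (\int[mu]_(z in `]u, v]) cst (n.+1%:R * e)%:E z)%E).
      by rewrite integral_cst//= lebesgue_measure_itv/= lte_fin uv -EFinB uvd -EFinM.
    apply: ge0_le_integral => //.
    - by move=> z _; rewrite lee_fin ltW.
    - exact: measurable_funTS.
    - by move=> z /=; rewrite in_itv/= => /hU/GU.
  split.
    apply: (@le_trans _ _ (n.+1%:R * e * d)%:E); first by rewrite lee_fin.
    apply: WW; [lra|lra|move=> z zx; apply: sU; rewrite /ball/= ltr_norml].
    by apply/andP; split; lra.
  apply: (@le_trans _ _ (n.+1%:R * e * d)%:E); first by rewrite lee_fin.
  apply: WW; [lra|lra|move=> z zx; apply: sU; rewrite /ball/= ltr_norml].
  by apply/andP; split; lra.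
have Wadd (x y z : R) : x <= y -> y <= z -> W x z = (W x y + W y z)%E.
  by move=> *; exact: ge0_integral_itv_split.
(* Continuation argument: the estimate to the left of sup S puts sup S in [S], and the one to its
   right would extend [S] further unless sup S = b. *)
pose S := [set x : R | a <= x <= b /\ ((F x - F a)%:E <= W a x)%E].
have Sa : S a by split; rewrite ?lexx ?ab// subrr.
have supS : has_sup S by split; [exists a|exists b => x [/andP[]]].
have sab : a <= sup S <= b.
  apply/andP; split; first exact: ub_le_sup (proj2 supS) _ Sa.
  by apply: ge_sup; [exists a|move=> x [/andP[]]].
have step (x y : R) : a <= x -> x <= y -> ((F x - F a)%:E <= W a x)%E ->
    ((F y - F x)%:E <= W x y)%E -> ((F y - F a)%:E <= W a y)%E.
  move=> ax xy h1 h2; rewrite (Wadd a x y)//.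
  have -> : F y - F a = (F x - F a) + (F y - F x) by ring.
  by rewrite EFinD leeD.
have Ss : S (sup S).
  split=> //; have := local _ sab => -[d /= d0 hd].
  have [y Sy ys] := sup_adherent d0 supS.
  have ys2 : y <= sup S by exact: ub_le_sup (proj2 supS) _ Sy.
  case: Sy => /andP[ay yb] hy.
  have [<-//|ysn] := eqVneq y (sup S).
  have ys3 : 0 < sup S - y by rewrite subr_gt0 lt_neqAle ysn.
  have := hd (sup S - y); rewrite /= sub0r normrN gtr0_norm// => /(_ _ ys3).
  case; first lra.
  by move=> _; rewrite subKr => h; exact: step hy h.
have [sb|sb] := eqVneq (sup S) b; first by case: Ss => _; rewrite sb.
have {}sb : sup S < b by rewrite lt_neqAle sb; case/andP: sab.
have := local _ sab => -[d /= d0 hd].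
pose t := Num.min (d / 2) (b - sup S).
have t0 : 0 < t by rewrite lt_min subr_gt0 sb andbT divr_gt0.
have td : t < d by rewrite gt_min; apply/orP; left; lra.
have tb : t <= b - sup S by rewrite ge_min lexx orbT.
have := hd t; rewrite /= sub0r normrN gtr0_norm// => /(_ td t0)[h _].
suff : S (sup S + t).
  by move=> /(ub_le_sup (proj2 supS)); rewrite gerDl leNgt t0.
case: Ss => /andP[as_ _] hs; split; first by apply/andP; split; lra.
by apply: step hs h => //; lra.
Unshelve. all: by end_near. Qed.

Lemma increment_le_integral (F F' g : R -> R) (a b x y : R) :
  (forall x : R, is_derive x 1 F (F' x)) -> measurable_fun [set: R] g ->
  (forall x, `|F' x| <= g x) -> a <= x <= b -> a <= y <= b ->
  (`|F y - F x|%:E <= \int[mu]_(z in `[a, b]) (g z)%:E)%E.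
Proof.
move=> dF mg Fg xab yab.
have g0 z : 0 <= g z by apply: le_trans (Fg z).
wlog xy : x y xab yab / x <= y.
  by move=> h; have [/h->//|/ltW/h] := leP x y; rewrite distrC; apply.
apply: (@le_trans _ _ (\int[mu]_(z in `[x, y]) (g z)%:E)%E); last first.
  apply: ge0_subset_integral => //.
  - by apply/measurable_EFinP; exact: measurable_funTS.
  - by move=> z _; rewrite lee_fin.
  - apply: subset_itv; rewrite bnd_simp; lra.
case: (ger0P (F y - F x)) => h.
  by apply: (@derive_majorant_le _ F') => // z; apply: le_trans (ler_norm _) (Fg z).
rewrite opprB.
have := @derive_majorant_le (fun z => - F z) (fun z => - F' z) g x y xy.
rewrite opprK addrC; apply=> // z.
by apply: le_trans (Fg z); rewrite -normrN ler_norm.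
Qed.

End variation.

(** * Sampling and midpoint quadrature on uniform cells *)

Section cells.
Context {R : realType}.
Local Notation mu := lebesgue_measure.
Implicit Types (F G g : R -> R) (p eta : R).

Definition cell p eta (i : int) : set R :=
  `]p + i%:~R * eta, p + (i + 1)%:~R * eta]%classic.

(** The union of the cells of index -n <= i < n, that is, the region covered by the window of
    [zbox n]. *)
Definition block p eta (n : nat) : set R :=
  `]p - n%:R * eta, p + n%:R * eta]%classic.

Lemma measurable_cell p eta i : measurable (cell p eta i).
Proof. exact: measurable_itv. Qed.

Lemma measurable_block p eta n : measurable (block p eta n).
Proof. exact: measurable_itv. Qed.

Lemma blockS p eta (n : nat) : 0 < eta ->
  [/\ block p eta n.+1 =
        (block p eta n `|` cell p eta (Posz n)) `|` cell p eta (Negz n),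
      [disjoint block p eta n & cell p eta (Posz n)] &
      [disjoint (block p eta n `|` cell p eta (Posz n)) & cell p eta (Negz n)]].
Proof.
move=> eta0; rewrite /block /cell.
have -> : (Negz n + 1)%:~R = - n%:R :> R.
  by rewrite NegzE intS opprD addrAC addNr add0r rmorphN.
have -> : (Negz n)%:~R = - n.+1%:R :> R by rewrite NegzE rmorphN.
have -> : (Posz n + 1)%:~R = n.+1%:R :> R by rewrite -[_ + 1]/(Posz (n + 1)) addn1.
have n0 : 0 <= n%:R * eta by exact: mulr_ge0 (ler0n _ _) (ltW eta0).
have nS : n.+1%:R * eta = n%:R * eta + eta by rewrite -natr1 mulrDl mul1r.
rewrite !mulNr nS -[(Posz n)%:~R]/(n%:R : R).
split.
- rewrite -itv_bndbnd_setU ?bnd_simp; [|lra..].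
  by rewrite setUC -itv_bndbnd_setU ?bnd_simp//; lra.
- apply/disj_set2P; rewrite -subset0 => x [/=]; rewrite !in_itv/= => ? ?; lra.
- apply/disj_set2P; rewrite -subset0 => x [/= []]; rewrite /= !in_itv/= => ? ?; lra.
Qed.

Lemma block0 p eta : block p eta 0 = set0.
Proof. by rewrite /block mul0r subr0 addr0 set_itvoc0. Qed.

Lemma ge0_integral_cells_le (G : R -> \bar R) (a : int -> R) p eta n : 0 < eta ->
  measurable_fun [set: R] G -> (forall x, 0 <= G x)%E ->
  (forall i : int, ((a i)%:E <= \int[mu]_(x in cell p eta i) G x)%E) ->
  ((zbox n a)%:E <= \int[mu]_x G x)%E.
Proof.
move=> eta0 mG G0 aG.
apply: (@le_trans _ _ (\int[mu]_(x in block p eta n) G x)%E); last first.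
  by apply: ge0_subset_integral => //; exact: measurable_block.
elim: n => [|n ih]; first by rewrite zbox0 block0 integral_set0.
have [-> d1 d2] := blockS p n eta0.
rewrite zboxS !EFinD ge0_integral_setU//; last 3 first.
- by apply: measurableU; [exact: measurable_block|exact: measurable_cell].
- exact: measurable_cell.
- exact: measurable_funTS.
rewrite ge0_integral_setU//; last 3 first.
- exact: measurable_block.
- exact: measurable_cell.
- exact: measurable_funTS.
by rewrite addeA leeD// leeD.
Qed.

Lemma Rintegral_cells G p eta n : 0 < eta ->
  mu.-integrable [set: R] (EFin \o G) ->
  zbox n (fun i => \int[mu]_(x in cell p eta i) G x) =
  \int[mu]_(x in block p eta n) G x.
Proof.
move=> eta0 iG.
have iGS A : measurable A -> mu.-integrable A (EFin \o G).
  by move=> mA; exact: integrableS iG.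
elim: n => [|n ih]; first by rewrite zbox0 block0 Rintegral_set0.
have [-> d1 d2] := blockS p n eta0.
have mB := measurable_block p eta n; have mC := measurable_cell p eta.
rewrite Rintegral_setU//; last 2 first.
- exact: mC.
- by apply: iGS; do !apply: measurableU; [exact: mB|exact: mC..].
rewrite Rintegral_setU//.
- by rewrite zboxS ih addrA.
- exact: mC.
- by apply: iGS; apply: measurableU; [exact: mB|exact: mC].
- by apply: measurableU; [exact: mB|exact: mC].
Qed.

Lemma cvg_Rintegral_block G p eta : 0 < eta ->
  mu.-integrable [set: R] (EFin \o G) ->
  (\int[mu]_(x in block p eta n) G x) @[n --> \oo] --> \int[mu]_x G x.
Proof.
move=> eta0 iG; have mB := measurable_block p eta.
have mG : measurable_fun [set: R] (EFin \o G) by case/integrableP : iG.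
pose Gn n x : \bar R := ((EFin \o G) \_ (block p eta n)) x.
have [] := @dominated_convergence _ _ _ mu [set: R] measurableT Gn (EFin \o G)
   (abse \o (EFin \o G)).
- move=> n; have mGB : measurable_fun (block p eta n) (EFin \o G).
    exact: measurable_funTS.
  exact: (measurable_restrictT (EFin \o G) (mB n)).1 mGB.
- exact: mG.
- apply: aeW => x _; apply: cvg_near_cst.
  exists (Num.truncn (`|x - p| / eta)).+1 => //= n /= hn.
  rewrite /Gn patchE mem_set// /block /= in_itv/=.
  have h : `|x - p| < n%:R * eta.
    rewrite -ltr_pdivrMr//; apply: lt_le_trans (_ : (Num.truncn (`|x - p| / eta)).+1%:R <= _).
      have /truncn_itv : 0 <= `|x - p| / eta by rewrite divr_ge0// ltW.
      by case/andP.
    by rewrite ler_nat.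
  by move: h; rewrite ltr_norml => /andP[? ?]; apply/andP; split; lra.
- exact: integrable_abse.
- apply: aeW => x n _; rewrite /Gn patchE; case: ifP => _ //=.
  by rewrite normr0 lee_fin.
move=> _ _ h; apply: fine_cvg.
rewrite fineK; last exact: integrable_fin_num.
apply: cvg_trans h; apply: near_eq_cvg; apply: nearW => n.
by rewrite [RHS]integral_mkcond.
Qed.

(** For every z in the interval |F x| <= |F z| + int g; averaging over z gives the bound. It is the
    one-dimensional Sobolev inequality in L1 form. *)
Lemma sample_le F (F' g : R -> R) (a b x : R) : a <= x <= b ->
  (forall x : R, is_derive x 1 F (F' x)) -> measurable_fun [set: R] g ->
  (forall x, `|F' x| <= g x) ->
  (((b - a) * `|F x|)%:E <=
    \int[mu]_(z in `]a, b]) (`|F z| + (b - a) * g z)%:E)%E.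
Proof.
move=> xab dF mg Fg.
have ab : a <= b by case/andP: xab => *; lra.
have g0 z : 0 <= g z by apply: le_trans (Fg z).
have cF : continuous F.
  move=> z; apply: differentiable_continuous; apply/derivable1_diffP.
  by have [] := dF z.
have mF : measurable_fun [set: R] F by exact: continuous_measurable_fun.
have mnF : measurable_fun [set: R] (fun z => `|F z|) by exact: measurableT_comp.
set I := (\int[mu]_(z in `]a, b]) (g z)%:E)%E.
have I0 : (0 <= I)%E by apply: integral_ge0 => z _; rewrite lee_fin.
have IE : I = (\int[mu]_(z in `[a, b]) (g z)%:E)%E.
  rewrite /I -integral_itv_obnd_cbnd//; apply/measurable_EFinP.
  exact: measurable_funTS.
have muab : mu `]a, b]%classic = (b - a)%:E.
  rewrite lebesgue_measure_itv/= lte_fin; case: ltP => // ba.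
  by congr EFin; lra.
have -> : (\int[mu]_(z in `]a, b]) (`|F z| + (b - a) * g z)%:E =
    \int[mu]_(z in `]a, b]) (`|F z|)%:E + (b - a)%:E * I)%E.
  under eq_integral do rewrite EFinD.
  rewrite ge0_integralD//; last 3 first.
  - by apply/measurable_EFinP; exact: measurable_funTS.
  - by move=> z _; rewrite lee_fin mulr_ge0// subr_ge0.
  - by apply/measurable_EFinP/measurable_funM => //; exact: measurable_funTS.
  under [X in (_ + X)%E]eq_integral do rewrite EFinM.
  rewrite ge0_integralZl_EFin//; last 2 first.
  - by apply/measurable_EFinP; exact: measurable_funTS.
  - by rewrite subr_ge0.
  by move=> z _; rewrite lee_fin.
have [ba0|ba0] := eqVneq (b - a) 0.
  by rewrite ba0 mul0r mul0e adde0 integral_ge0.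
have {}ba0 : 0 < b - a by rewrite lt_neqAle eq_sym ba0 subr_ge0.
have [Iy|Ify] := eqVneq I +oo%E.
  by rewrite Iy gt0_muley ?lte_fin// addey ?leey// -ltNye (lt_le_trans _ (integral_ge0 _ _)).
have If : I \is a fin_num by rewrite ge0_fin_numE// lt_neqAle Ify leey.
rewrite -(fineK If) -EFinM mulrC.
have h : (\int[mu]_(z in `]a, b]) (cst (`|F x| - fine I)%:E z) <=
          \int[mu]_(z in `]a, b]) `|F z|%:E)%E.
  have [neg|pos] := leP (`|F x| - fine I) 0.
    apply: (@le_trans _ _ 0%E); last by apply: integral_ge0.
    by rewrite integral_cst//= muab -EFinM lee_fin mulr_le0_ge0// ltW.
  apply: ge0_le_integral => //.
  - by move=> z _; rewrite lee_fin ltW.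
  - by apply/measurable_EFinP; exact: measurable_funTS.
  - move=> z /=; rewrite in_itv/= => /andP[az zb]; rewrite lee_fin lerBlDl.
    have : (`|F x - F z|%:E <= I)%E.
      by rewrite IE; apply: (increment_le_integral dF mg Fg) => //; rewrite (ltW az).
    rewrite -(fineK If) lee_fin => v.
    have := ler_distD (F z) (F x) 0; rewrite !subr0; lra.
move: h; rewrite integral_cst//= muab -EFinM => h.
have -> : `|F x| * (b - a) = (`|F x| - fine I) * (b - a) + (b - a) * fine I.
  by ring.
by rewrite EFinD leeD2r.
Qed.

Lemma is_derive_continuous F (F' : R -> R) :
  (forall x : R, is_derive x 1 F (F' x)) -> continuous F.
Proof.
move=> dF x; apply: differentiable_continuous; apply/derivable1_diffP.
by have [] := dF x.
Qed.

(** The L1 sampling bound applied to F^2, whose derivative 2 F F' is at most F^2 + F'^2. With eta <=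
    1 the integrand is at most 2 F^2 + F'^2, hence the 3. Neither the base point nor the mesh enters
    the bound. *)
Lemma l2_sample_le F (F' : R -> R) p eta K n : 0 < eta -> eta <= 1 ->
  (forall x : R, is_derive x 1 F (F' x)) -> measurable_fun [set: R] F' ->
  (\int[mu]_x (F x ^+ 2)%:E <= K%:E)%E ->
  (\int[mu]_x (F' x ^+ 2)%:E <= K%:E)%E ->
  zbox n (fun i => F (p + i%:~R * eta) ^+ 2 * eta) <= 3 * K.
Proof.
move=> eta0 eta1 dF mF' FK F'K.
have mF : measurable_fun [set: R] F.
  by apply: continuous_measurable_fun; exact: is_derive_continuous dF.
have mF2 : measurable_fun [set: R] (fun x => (F x ^+ 2)%:E).
  by apply/measurable_EFinP; exact: measurable_funX.
have mF'2 : measurable_fun [set: R] (fun x => (F' x ^+ 2)%:E).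
  by apply/measurable_EFinP; exact: measurable_funX.
have m2F2 : measurable_fun [set: R] (fun x => 2%:E * (F x ^+ 2)%:E)%E.
  by apply: emeasurable_funM => //.
rewrite -lee_fin.
apply: (@le_trans _ _ (\int[mu]_x (2%:E * (F x ^+ 2)%:E + (F' x ^+ 2)%:E))%E);
  last first.
  rewrite ge0_integralD//; last 2 first.
  - by move=> x _; rewrite mule_ge0// lee_fin sqr_ge0.
  - by move=> x _; rewrite lee_fin sqr_ge0.
  rewrite ge0_integralZl_EFin//; last by move=> x _; rewrite lee_fin sqr_ge0.
  have -> : 3 * K = 2 * K + K by ring.
  by rewrite [leRHS]EFinD [(2 * K)%:E]EFinM leeD// lee_pmul2l.
apply: (@ge0_integral_cells_le _ _ p eta) => //.
- exact: emeasurable_funD.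
- by move=> x; rewrite adde_ge0 ?mule_ge0 ?lee_fin ?sqr_ge0.
move=> i; set a := p + i%:~R * eta.
have ab : p + (i + 1)%:~R * eta - a = eta.
  by rewrite rmorphD/= mulrDl mul1r /a; ring.
have h := @sample_le (fun x => F x ^+ 2) (fun x => 2 * F x * F' x)
  (fun x => F x ^+ 2 + F' x ^+ 2) a (p + (i + 1)%:~R * eta) a.
rewrite mulrC -{1}ab -[X in (_ * X)%:E]ger0_norm ?sqr_ge0//.
apply: le_trans (h _ _ _ _) _.
- by rewrite lexx -subr_ge0 ab ltW.
- move=> x; apply: (is_derive_eq (@is_deriveX _ _ F 2 x 1 (F' x) (dF x))).
  by rewrite expr1.
- by apply: measurable_funD; exact: measurable_funX.
- move=> x; rewrite ler_norml; have := sqr_ge0 (F x - F' x).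
  have := sqr_ge0 (F x + F' x); rewrite sqrrB sqrrD => h1 h2.
  by apply/andP; split; lra.
rewrite ab; apply: ge0_le_integral => //.
- move=> x _; rewrite lee_fin addr_ge0// mulr_ge0 ?(ltW eta0)//.
  by rewrite addr_ge0 ?sqr_ge0.
- apply: measurable_funTS; apply/measurable_EFinP; apply: measurable_funD.
    by apply: measurableT_comp => //; exact: measurable_funX.
  apply: measurable_funM => //; apply: measurable_funD; exact: measurable_funX.
- by apply: measurable_funTS; exact: emeasurable_funD.
move=> x _; rewrite -EFinM -EFinD lee_fin ger0_norm ?sqr_ge0//.
have := sqr_ge0 (F x); have := sqr_ge0 (F' x) => h1 h2.
have : eta * (F x ^+ 2 + F' x ^+ 2) <= 1 * (F x ^+ 2 + F' x ^+ 2).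
  by apply: ler_wpM2r => //; exact: addr_ge0.
lra.
Qed.

Lemma continuous_itv_integrable G a b : continuous G ->
  mu.-integrable `[a, b] (EFin \o G).
Proof.
move=> cG; apply: continuous_compact_integrable; first exact: segment_compact.
exact: continuous_subspaceT.
Qed.

(** The tangent L at the midpoint has integral exactly (b - a) G(c). By the mean value theorem G - L
    is (x - c) times an increment of G1, at most (b - a)/2 times the integral of [q]; integrating
    gives the factor (b - a)^2 / 2. *)
Lemma midpoint_le (G G1 G2 q : R -> R) (a b c : R) : a < b -> c = (a + b) / 2 ->
  (forall x : R, is_derive x 1 G (G1 x)) ->
  (forall x : R, is_derive x 1 G1 (G2 x)) -> measurable_fun [set: R] q ->
  (forall x, `|G2 x| <= q x) ->
  (`|\int[mu]_(x in `[a, b]) G x - (b - a) * G c|%:E <=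
   ((b - a) ^+ 2 / 2)%:E * \int[mu]_(x in `]a, b]) (q x)%:E)%E.
Proof.
move=> ab cab dG dG1 mq Gq.
have q0 x : 0 <= q x by apply: le_trans (Gq x).
set J := (\int[mu]_(x in `]a, b]) (q x)%:E)%E.
have J0 : (0 <= J)%E by apply: integral_ge0 => x _; rewrite lee_fin.
have JE : J = (\int[mu]_(x in `[a, b]) (q x)%:E)%E.
  rewrite /J -integral_itv_obnd_cbnd//; apply/measurable_EFinP.
  exact: measurable_funTS.
have ba0 : 0 < b - a by rewrite subr_gt0.
have [Jy|Jfy] := eqVneq J +oo%E.
  rewrite Jy gt0_muley ?leey// lte_fin; apply: divr_gt0 => //; exact: exprn_gt0.
have Jf : J \is a fin_num by rewrite ge0_fin_numE// lt_neqAle Jfy leey.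
rewrite -(fineK Jf) -EFinM lee_fin; set j := fine J.
have j0 : 0 <= j by rewrite fine_ge0.
have cG := is_derive_continuous dG.
pose L s := G c + (s - c) * G1 c.
pose P s := G c * s + G1 c / 2 * (s - c) ^+ 2.
have dP (x : R) : is_derive x 1 P (L x).
  have -> : P = cst (G c) * id + cst (G1 c / 2) * (id - cst c) ^+ 2 by [].
  by apply: is_derive_eq; rewrite /L /GRing.scale/= !fctE; field.
have dL (x : R) : is_derive x 1 L (G1 c).
  have -> : L = cst (G c) + (id - cst c) * cst (G1 c) by [].
  by apply: is_derive_eq; rewrite /GRing.scale/=; ring.
have cL := is_derive_continuous dL.
have intL : \int[mu]_(x in `[a, b]) L x = (b - a) * G c.
  rewrite /Rintegral (@continuous_FTC2 _ L P a b ab)/=.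
  - by rewrite /P cab; field.
  - exact: continuous_subspaceT.
  - have cP := is_derive_continuous dP; split.
    + by move=> x _; have [] := dP x.
    + by apply: cvg_at_right_filter; exact: cP.
    + by apply: cvg_at_left_filter; exact: cP.
  - by move=> x _; rewrite derive1E; have [_ ->] := dP x.
rewrite -intL -RintegralB//; [|exact: continuous_itv_integrable..].
have iGL : mu.-integrable `[a, b] (EFin \o (fun x => G x - L x)).
  by apply: continuous_itv_integrable => x; apply: cvgB; [exact: cG|exact: cL].
apply: le_trans (le_normr_Rintegral _ iGL) _ => //.
apply: (@le_trans _ _ (\int[mu]_(x in `[a, b]) ((b - a) / 2 * j))); last first.
  rewrite Rintegral_cst//= lebesgue_measure_itv/= lte_fin ab -EFinB/=.
  by rewrite le_eqVlt; apply/orP; left; apply/eqP; field.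
apply: le_Rintegral => //.
- exact: integrable_norm.
- by apply: continuous_itv_integrable => x; exact: cvg_cst.
move=> x /=; rewrite in_itv/= => /andP[ax xb].
have G1c y : a <= y <= b -> `|G1 y - G1 c| <= j.
  move=> yab; rewrite -lee_fin /j fineK// JE.
  by apply: (increment_le_integral dG1 mq Gq) => //; apply/andP; split; lra.
have MV u v : a <= u -> u <= v -> v <= b ->
    exists2 y, a <= y <= b & G v - G u = G1 y * (v - u).
  move=> au uv vb.
  have [y yuv e] := MVT_segment uv (fun x _ => dG x) (continuous_subspaceT cG).
  exists y => //; move: yuv; rewrite in_itv/= => /andP[? ?].
  by apply/andP; split; lra.
rewrite /L opprD addrA; have [xc|cx] := leP x c.
  have [|//||y yab e] := MV x c; [by []|lra|].
  rewrite (_ : _ - _ = - (G1 y - G1 c) * (c - x)); last first.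
    by rewrite -(opprB (G c)) e; ring.
  rewrite normrM normrN mulrC; apply: ler_pM => //; last exact: G1c.
  by rewrite ger0_norm; lra.
have [||//|y yab e] := MV c x; [lra|lra|].
rewrite e (_ : G1 y * (x - c) - (x - c) * G1 c = (G1 y - G1 c) * (x - c));
  last by ring.
rewrite normrM mulrC; apply: ler_pM => //; last exact: G1c.
by rewrite ger0_norm; lra.
Qed.

(** The midpoint errors add up over the cells of a window, with total at most eta^2 / 2 times the
    integral of [q2], and the windows exhaust the line. The first-derivative majorant [q1] is there
    to make the quadrature sum absolutely convergent. *)
Lemma quadrature_le (G G1 G2 q1 q2 : R -> R) eta K : 0 < eta ->
  (forall x : R, is_derive x 1 G (G1 x)) ->
  (forall x : R, is_derive x 1 G1 (G2 x)) ->
  measurable_fun [set: R] q1 -> measurable_fun [set: R] q2 ->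
  (forall x, `|G1 x| <= q1 x) -> (forall x, `|G2 x| <= q2 x) ->
  mu.-integrable [set: R] (EFin \o G) ->
  (\int[mu]_x (q1 x)%:E < +oo)%E -> (\int[mu]_x (q2 x)%:E <= K%:E)%E ->
  zabs (fun i => eta * G (i%:~R * eta)) /\
  `|\int[mu]_x G x - zsum (fun i => eta * G (i%:~R * eta))| <=
    eta ^+ 2 / 2 * K.
Proof.
move=> eta0 dG dG1 mq1 mq2 Gq1 Gq2 iG fq1 Kq2.
have q10 x : 0 <= q1 x by apply: le_trans (Gq1 x).
have q20 x : 0 <= q2 x by apply: le_trans (Gq2 x).
(* Shifting by half a mesh makes the grid points the midpoints of the cells. *)
pose p : R := - (eta / 2).
have iS (i : int) : (i + 1)%:~R = i%:~R + 1 :> R by rewrite rmorphD.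
have len i : p + (i + 1)%:~R * eta - (p + i%:~R * eta) = eta.
  by rewrite iS; ring.
have mid i : i%:~R * eta = (p + i%:~R * eta + (p + (i + 1)%:~R * eta)) / 2.
  by rewrite iS /p; field.
have mG : measurable_fun [set: R] G.
  by apply: continuous_measurable_fun; exact: is_derive_continuous dG.
have mnG : measurable_fun [set: R] (fun x => `|G x|) by exact: measurableT_comp.
have mnGE : measurable_fun [set: R] (fun x => `|G x|%:E) by exact/measurable_EFinP.
have mq1E : measurable_fun [set: R] (fun x => (q1 x)%:E) by exact/measurable_EFinP.
have mq2E : measurable_fun [set: R] (fun x => (q2 x)%:E) by exact/measurable_EFinP.
have z1 : zabs (fun i => eta * G (i%:~R * eta)).
  have : (\int[mu]_x (`|G x| + eta * q1 x)%:E < +oo)%E.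
    under eq_integral do rewrite EFinD EFinM.
    rewrite ge0_integralD//; last 2 first.
    - by move=> x _; rewrite -EFinM lee_fin mulr_ge0// ltW.
    - exact: emeasurable_funM.
    rewrite ge0_integralZl_EFin//; last 2 first.
    - by move=> x _; rewrite lee_fin.
    - exact: ltW.
    rewrite lte_add_pinfty//; first by case/integrableP : iG.
    by rewrite lte_mul_pinfty// lee_fin ltW.
  set A := (\int[mu]_x _)%E => Afin.
  have A0 : (0 <= A)%E.
    by apply: integral_ge0 => x _; rewrite lee_fin addr_ge0// mulr_ge0// ltW.
  exists (fine A) => n; rewrite -lee_fin fineK ?ge0_fin_numE//.
  apply: (@ge0_integral_cells_le _ _ p eta) => //.
  - by apply/measurable_EFinP/measurable_funD => //; exact: measurable_funM.
  - by move=> x; rewrite lee_fin addr_ge0// mulr_ge0// ltW.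
  move=> i; rewrite normrM (gtr0_norm eta0) -{1}(len i).
  apply: le_trans (sample_le _ dG mq1 Gq1) _; last by rewrite len.
  rewrite /p iS mulrDl mul1r; apply/andP; split; lra.
split => //.
have c1 : zbox n (fun i => \int[mu]_(x in cell p eta i) G x) @[n --> \oo] -->
    \int[mu]_x G x.
  under eq_fun do rewrite Rintegral_cells//.
  exact: cvg_Rintegral_block.
apply: cvgr_to_le (cvg_norm (cvgB c1 (zsum_cvg z1))) _; apply: nearW => n /=.
rewrite !fctE -zboxN -zboxD; apply: le_trans (ler_norm_zbox _ _) _.
rewrite -lee_fin EFinM; apply: (@le_trans _ _ (\int[mu]_x ((eta ^+ 2 / 2)%:E * (q2 x)%:E))%E).
  apply: (@ge0_integral_cells_le _ _ p eta) => //.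
  - exact: emeasurable_funM.
  - by move=> x; rewrite -EFinM lee_fin mulr_ge0// divr_ge0// sqr_ge0.
  move=> i.
  have abi : p + i%:~R * eta < p + (i + 1)%:~R * eta by rewrite -subr_gt0 len.
  have := midpoint_le abi (mid i) dG dG1 mq2 Gq2; rewrite len => h.
  rewrite ge0_integralZl_EFin//; last 4 first.
  - exact: measurable_cell.
  - by move=> x _; rewrite lee_fin.
  - exact: measurable_funTS.
  - by rewrite divr_ge0// sqr_ge0.
  apply: le_trans h; rewrite /cell Rintegral_itv_obnd_cbnd//.
  by apply: integrableS iG.
rewrite ge0_integralZl_EFin//.
- by rewrite lee_wpmul2l// lee_fin divr_ge0// sqr_ge0.
- by move=> x _; rewrite lee_fin.
- by rewrite divr_ge0// sqr_ge0.
Qed.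

End cells.

(** * The Levy density *)

Section levy.
Context {R : realType}.
Local Notation mu := lebesgue_measure.

Lemma is_derive_quotient_cvg (F : R -> R) (x l : R) : is_derive x 1 F l ->
  h^-1 * (F (x + h) - F x) @[h --> 0^'] --> l.
Proof.
move=> [/cvg_ex[/= l' hl'] <-].
rewrite /derive (cvg_lim _ hl')//.
apply: cvg_trans hl'; apply: near_eq_cvg; apply: nearW => h.
by rewrite /GRing.scale/= mulr1 (addrC x).
Qed.

(** A derivative is the pointwise limit of the continuous difference quotients with increments
    1/(n+1); no continuity of F' is involved. *)
Lemma measurable_fun_is_derive (F F' : R -> R) :
  (forall x : R, is_derive x 1 F (F' x)) -> measurable_fun [set: R] F'.
Proof.
move=> dF; have mF : measurable_fun [set: R] F.
  by apply: continuous_measurable_fun; exact: is_derive_continuous dF.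
pose q (n : nat) (x : R) := n.+1%:R * (F (x + n.+1%:R^-1) - F x).
apply: (@measurable_fun_cvg _ _ _ _ q).
  move=> n; apply: measurable_funM => //.
  apply: measurable_funB => //; apply: measurableT_comp => //.
  exact: measurable_funD.
move=> x _.
have cn : (n.+1%:R^-1 : R) @[n --> \oo] --> (0 : R)^'.
  move=> A /= [e /= e0 hA].
  have := near_infty_natSinv_lt (PosNum e0); apply: filterS => n /= hn.
  by apply: hA; rewrite ?invr_eq0 ?pnatr_eq0//= sub0r normrN gtr0_norm.
have h := cvg_comp _ _ cn (is_derive_quotient_cvg (dF x)).
apply: cvg_trans h; apply: near_eq_cvg; apply: nearW => n.
by rewrite /q /= invrK.
Qed.

(** A zero of a nonnegative function is a minimum: a nonzero slope would make the function negative
    on one side. *)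
Lemma is_derive_ge0_zero (F : R -> R) (x l : R) : is_derive x 1 F l ->
  (forall x, 0 <= F x) -> F x = 0 -> l = 0.
Proof.
move=> dF F0 Fx0; case: (ltgtP l 0) => // l0.
  have lc : l < l / 2 by lra.
  have [d [+ [h1 _]]] : exists d : R, 0 < d /\
      ((F (x + d) - F x <= l / 2 * d) /\ (F x - F (x - d) <= l / 2 * d)).
    have : ProperFilter (0 : R)^'+ by exact: _.
    move=> PF; near (0 : R)^'+ => d; exists d; split.
      by near: d; exact: nbhs_right_gt.
    by near: d; exact: is_derive_lt_near lc.
  by have := F0 (x + d) => *; nra.
have dN : is_derive x 1 (- F) (- l) by exact: is_deriveN.
have lc : - l < - l / 2 by lra.
have [d [+ [_ h1]]] : exists d : R, 0 < d /\
      (((- F) (x + d) - (- F) x <= - l / 2 * d) /\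
       ((- F) x - (- F) (x - d) <= - l / 2 * d)).
  near (0 : R)^'+ => d; exists d; split.
    by near: d; exact: nbhs_right_gt.
  by near: d; exact: is_derive_lt_near dN lc.
move: h1; rewrite !fctE => h1 *.
by have := F0 (x - d) => *; nra.
Unshelve. all: by end_near. Qed.

(* A zero of [F] where [F''] does not vanish is a zero of [F'] and is isolated
   among those, hence among the zeros of [F]. *)
Lemma countable_nondegenerate_zeros (F F' F'' : R -> R) :
  (forall x : R, is_derive x 1 F (F' x)) ->
  (forall x : R, is_derive x 1 F' (F'' x)) -> (forall x, 0 <= F x) ->
  countable [set x : R | F x = 0 /\ F'' x != 0].
Proof.
move=> dF dF' F0.
have F'0 (x : R) : F x = 0 -> F' x = 0 by exact: is_derive_ge0_zero.
have iso (x : R) : exists k : nat, F x = 0 /\ F'' x != 0 ->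
    forall y, F y = 0 -> `|y - x| < k.+1%:R^-1 -> y = x.
  have [[Fx F2x]|nx] := pselect (F x = 0 /\ F'' x != 0); last by exists 0%N.
  have := is_derive_quotient_cvg (dF' x).
  move/cvgr_neq0 => /(_ F2x) [e /= e0 he].
  have [k /= _ hk] := near_infty_natSinv_lt (PosNum e0).
  exists k => _ y Fy yx; apply/eqP/negPn/negP => yNx.
  have := he (y - x); rewrite /= sub0r normrN.
  rewrite subr_eq0 => /(_ (lt_trans yx (hk k (leqnn k))) yNx).
  by rewrite [x + _]addrC subrK (F'0 y Fy) (F'0 x Fx) subrr mulr0 eqxx.
have [k hk] := choice iso.
apply/countable_injP.
(* A zero is coded by its isolation index k and the integer part of x (k+1); two zeros with the same
   code are closer than 1/(k+1), hence equal. *)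
exists (fun x => pickle (k x, Num.floor (x * (k x).+1%:R))).
move=> x y; rewrite !inE => Ax Ay; move/(pcan_inj pickleK) => -[kk ff].
apply/esym; apply: (hk x Ax); first by case: Ay.
rewrite -kk in ff.
have K0 : 0 < (k x).+1%:R :> R by [].
have := Num.Theory.floor_itv (x * (k x).+1%:R).
have := Num.Theory.floor_itv (y * (k x).+1%:R).
rewrite -ff intrD => /andP[y1 y2] /andP[x1 x2].
rewrite -(ltr_pM2r K0) mulVf ?gt_eqF// -{1}(gtr0_norm K0) -normrM mulrBl.
by rewrite ltr_norml; apply/andP; split; lra.
Qed.

(** x / (x^2 + 1/(n+1)) is continuous and converges to the inverse everywhere, including at 0, where
    both sides are 0 by convention. *)
Lemma measurable_invr : measurable_fun [set: R] (fun x : R => x^-1).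
Proof.
apply: (@measurable_fun_cvg _ _ _ _
    (fun (n : nat) (x : R) => x * (x ^+ 2 + n.+1%:R^-1)^-1)).
  move=> n; apply: continuous_measurable_fun => x.
  have p0 : x ^+ 2 + n.+1%:R^-1 != 0.
    by rewrite gt_eqF// ltr_wpDl ?sqr_ge0// invr_gt0.
  apply: cvgM; first exact: cvg_id.
  apply: cvgV => //; apply: cvgD; last exact: cvg_cst.
  exact: exprn_continuous.
move=> x _; have [->|x0] := eqVneq x 0.
  under eq_fun do rewrite mul0r; rewrite invr0; exact: cvg_cst.
have -> : x^-1 = x * (x ^+ 2 + 0)^-1.
  by rewrite addr0 expr2 invfM mulrA mulfV// mul1r.
apply: cvgM; first exact: cvg_cst.
apply: cvgV; first by rewrite addr0 expf_neq0.
apply: cvgD; first exact: cvg_cst.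
exact: cvg_harmonic.
Qed.

(** Cauchy-Schwarz in pointwise form: |G| <= (G/F)^2 F + F where F is nonzero. Where F vanishes the
    quotient is 0 by convention and says nothing about G, so G must vanish there too, up to the
    countable exceptional set, which is null. *)
Lemma integrable_of_ratio (F G : R -> R) : measurable_fun [set: R] F ->
  measurable_fun [set: R] G -> (forall x, 0 <= F x) ->
  countable [set x : R | F x = 0 /\ G x != 0] ->
  (\int[mu]_x (F x)%:E < +oo)%E ->
  (\int[mu]_x ((G x / F x) ^+ 2 * F x)%:E < +oo)%E ->
  (\int[mu]_x `|G x|%:E < +oo)%E.
Proof.
move=> mF mG F0 cN iF iG.
have mN : measurable [set x : R | F x = 0 /\ G x != 0].
  by apply: countable_measurable cN => t; exact: measurable_set1.
have mr : measurable_fun [set: R] (fun x => (G x / F x) ^+ 2 * F x).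
  apply: measurable_funM => //; apply: measurable_funX; apply: measurable_funM => //.
  exact: (measurableT_comp measurable_invr).
have r0 x : 0 <= (G x / F x) ^+ 2 * F x by rewrite mulr_ge0 ?sqr_ge0.
apply: (@le_lt_trans _ _ (\int[mu]_x (((G x / F x) ^+ 2 * F x)%:E + (F x)%:E))%E).
  apply: ae_ge0_le_integral => //.
  - by apply/measurable_EFinP; exact: measurableT_comp.
  - by move=> x _; rewrite -EFinD lee_fin addr_ge0.
  - by apply/measurable_EFinP; exact: measurable_funD.
  exists [set x : R | F x = 0 /\ G x != 0]; split => //.
    exact: countable_lebesgue_measure0.
  move=> x /= hx; apply: contrapT => /not_andP nx; apply: hx => _.
  rewrite -EFinD lee_fin.
  have [Fx0|Fx0] := eqVneq (F x) 0.
    case: nx => // /negP; rewrite negbK => /eqP ->.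
    by rewrite normr0 mul0r expr0n mul0r add0r.
  have Fx1 : 0 < F x by rewrite lt_neqAle eq_sym Fx0 F0.
  rewrite -{1}(mulfVK Fx0 (G x)) normrM (gtr0_norm Fx1) -[in leRHS](mul1r (F x)).
  rewrite mulrA mulr1 -mulrDl ler_pM2r//.
  have := sqr_ge0 (`|G x / F x| - 1); rewrite sqrrB expr1n mulr1 real_normK ?num_real//.
  have := normr_ge0 (G x / F x); have := sqr_ge0 (G x / F x); nra.
rewrite ge0_integralD//.
- by rewrite lte_add_pinfty.
- by move=> x _; rewrite lee_fin.
- exact/measurable_EFinP.
- by move=> x _; rewrite lee_fin.
- exact/measurable_EFinP.
Qed.

(** At a zero of nu the first derivative vanishes, so it has no exceptional points; the second
    derivative may be nonzero at a zero, but only at countably many. *)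
Lemma levy_density_L1 (nu : R -> R) : levy_density_regular nu ->
  (forall x, 0 <= nu x) -> (\int[mu]_x (nu x)%:E < +oo)%E ->
  [/\ forall x : R, is_derive x 1 nu (derive1 nu x),
      forall x : R, is_derive x 1 (derive1 nu) (derive1n 2 nu x),
      (\int[mu]_x `|derive1 nu x|%:E < +oo)%E &
      (\int[mu]_x `|derive1n 2 nu x|%:E < +oo)%E].
Proof.
move=> [d1 d2 i1 i2] nu0 inu.
have dn (x : R) : is_derive x 1 nu (derive1 nu x).
  by rewrite derive1E; exact: derivableP.
have dn2 (x : R) : is_derive x 1 (derive1 nu) (derive1n 2 nu x).
  by rewrite /derive1n/= derive1E; exact: derivableP.
have mnu : measurable_fun [set: R] nu.
  by apply: continuous_measurable_fun; exact: is_derive_continuous dn.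
split => //.
  apply: integrable_of_ratio i1 => //; first exact: measurable_fun_is_derive dn.
  rewrite (_ : [set _ | _] = set0)//; apply/seteqP; split => // x [/= nx0].
  by rewrite (is_derive_ge0_zero (dn x) nu0 nx0) eqxx.
apply: integrable_of_ratio i2 => //; first exact: measurable_fun_is_derive dn2.
exact: countable_nondegenerate_zeros dn dn2 nu0.
Qed.

End levy.

(** * Taylor expansions on an interval *)

Section derive_on.
Context {R : realType}.
Implicit Types (A : set R) (g : R -> R).

Lemma is_derive_on A g (a l : R) : is_derive a 1 g l -> has_derive_on A g a l.
Proof.
move=> /is_derive_quotient_cvg h.
rewrite /has_derive_on /quotient_on.
apply: cvg_trans (_ : (g s - g a) / (s - a) @[s --> a^'] --> l).
  apply: cvg_app; rewrite /within; apply: cvg_within.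
have ha : (s - a) @[s --> a^'] --> (0 : R)^'.
  move=> P /= [e /= e0 hP]; exists e => //= s hs sa.
  by apply: hP; rewrite /= ?subr_eq0// sub0r normrN distrC.
have := cvg_comp _ _ ha h; apply: cvg_trans; apply: near_eq_cvg; apply: nearW => s /=.
by rewrite [a + _]addrC subrK mulrC.
Qed.

Lemma has_derive_onD A g1 g2 (a l1 l2 : R) : has_derive_on A g1 a l1 ->
  has_derive_on A g2 a l2 -> has_derive_on A (fun s => g1 s + g2 s) a (l1 + l2).
Proof.
move=> h1 h2; rewrite /has_derive_on; apply: cvg_trans (cvgD h1 h2).
apply: near_eq_cvg; apply: nearW => s; rewrite /quotient_on fctE.
by rewrite -mulrDl; congr (_ / _); ring.
Qed.

Lemma has_derive_onZ A g (k a l : R) : has_derive_on A g a l ->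
  has_derive_on A (fun s => k * g s) a (k * l).
Proof.
move=> h; rewrite /has_derive_on.
have hk : k * quotient_on g a s @[s --> within A a^'] --> k * l by exact: cvgMr.
apply: cvg_trans hk.
apply: near_eq_cvg; apply: nearW => s; rewrite /quotient_on.
by rewrite -mulrBr mulrA.
Qed.

Lemma has_derive_onB A g1 g2 (a l1 l2 : R) : has_derive_on A g1 a l1 ->
  has_derive_on A g2 a l2 -> has_derive_on A (fun s => g1 s - g2 s) a (l1 - l2).
Proof.
move=> h1 h2; rewrite /has_derive_on; apply: cvg_trans (cvgB h1 h2).
apply: near_eq_cvg; apply: nearW => s; rewrite /quotient_on !fctE.
by rewrite -mulrBl; congr (_ / _); ring.
Qed.

Lemma has_derive_on_cst A (k a : R) : has_derive_on A (fun=> k) a 0.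
Proof. by apply: is_derive_on; exact: is_derive_cst. Qed.

Lemma has_derive_on_zbox A (g : int -> R -> R) (l : int -> R) (a : R) n :
  (forall i, has_derive_on A (g i) a (l i)) ->
  has_derive_on A (fun s => zbox n (fun i => g i s)) a (zbox n l).
Proof.
move=> h; elim: n => [|n ih].
  rewrite zbox0; under [X in has_derive_on _ X]eq_fun do rewrite zbox0.
  exact: has_derive_on_cst.
rewrite zboxS; under [X in has_derive_on _ X]eq_fun do rewrite zboxS.
by apply: has_derive_onD => //; exact: has_derive_onD.
Qed.

Lemma has_derive_on_near A g (a l : R) : has_derive_on A g a l ->
  g s @[s --> within A a^'] --> g a.
Proof.
move=> h.
have F1 : Filter (within A a^') by exact: within_filter.
have ca : (s - a) @[s --> within A a^'] --> (0 : R).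
  rewrite -(subrr a); apply: cvgB; last exact: cvg_cst.
  apply: (@cvg_trans _ a^'); first exact: cvg_within.
  exact: cvg_within.
have /(_ F1 F1 F1) h2 := cvgD (cvgM h ca) (cvg_cst (g a)).
rewrite mulr0 add0r in h2; apply: cvg_trans h2.
have na : \forall s \near within A a^', s != a.
  apply: (@cvg_within _ a^'); exact: (@withinT _ (nbhs a) (fun s => s != a)).
apply: (@near_eq_cvg _ _ (within A a^')); apply: filterS na => s sa.
by rewrite !fctE /quotient_on /= mulfVK ?subr_eq0// subrK.
Qed.

Lemma within_dnbhs_right A (a b : R) : a < b -> `]a, b[ `<=` A ->
  a^'+ `=>` within A a^'.
Proof.
move=> ab abA P [e /= e0 hP].
near=> s.
have as_ : a < s by near: s; exact: nbhs_right_gt.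
have sb : s < b by near: s; exact: nbhs_right_lt.
have se : s < a + e by near: s; apply: nbhs_right_lt; rewrite ltrDl.
apply: hP; rewrite ?gt_eqF//=.
  by rewrite ltr0_norm ?subr_lt0//; lra.
by apply: abA; rewrite /= in_itv/= as_.
Unshelve. all: by end_near. Qed.

Lemma within_dnbhs_left A (a b : R) : a < b -> `]a, b[ `<=` A ->
  b^'- `=>` within A b^'.
Proof.
move=> ab abA P [e /= e0 hP].
near=> s.
have as_ : a < s by near: s; exact: nbhs_left_gt.
have sb : s < b by near: s; exact: nbhs_left_lt.
have se : b - e < s by near: s; apply: nbhs_left_gt; rewrite ltrBlDr ltrDl.
apply: hP; rewrite ?lt_eqF//=.
  by rewrite gtr0_norm ?subr_gt0//; lra.
by apply: abA; rewrite /= in_itv/= as_.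
Unshelve. all: by end_near. Qed.

Lemma has_derive_on_interior A g (a l : R) : nbhs a A -> has_derive_on A g a l ->
  is_derive a 1 g l.
Proof.
move=> [e /= e0 hA] h.
have h' : quotient_on g a s @[s --> a^'] --> l.
  apply: cvg_trans h; apply: cvg_app => P [e' /= e'0 hP].
  exists (Num.min e e') => /=; first by rewrite lt_min e0.
  move=> s /=; rewrite lt_min => /andP[se se'] sa.
  by apply: hP => //; exact: hA.
have hc : (a + d) @[d --> (0 : R)^'] --> a^'.
  move=> P /= [e' /= e'0 hP]; exists e' => //= s /=; rewrite sub0r normrN => hs s0.
  apply: hP => /=; first by rewrite opprD addrA subrr sub0r normrN.
  by rewrite -subr_eq0 addrAC subrr add0r.
have h2 := cvg_comp _ _ hc h'.
have h3 : d^-1 *: (g (d *: 1 + a) - g a) @[d --> (0 : R)^'] --> l.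
  apply: cvg_trans h2; apply: near_eq_cvg; apply: nearW => d /=.
  by rewrite /quotient_on /GRing.scale/= mulr1 (addrC d) [a + d - a]addrAC subrr add0r mulrC.
split; first by apply/cvg_ex; exists l.
exact/cvg_lim.
Qed.

(** Between two points of an interval the relative derivative is the ordinary one; at the two end
    points, possibly boundary points of A, only one-sided continuity is needed. *)
Lemma MVT_on A g (g' : R -> R) (y z : R) : is_interval A -> A y -> A z -> y < z ->
  (forall x, A x -> has_derive_on A g x (g' x)) ->
  exists2 x, y < x < z & g z - g y = g' x * (z - y).
Proof.
move=> iA Ay Az yz dg.
have yzA : `]y, z[ `<=` A.
  by move=> x /=; rewrite in_itv/= => /andP[yx xz]; apply: iA Ay Az _ _; rewrite !ltW.
have dgi x : x \in `]y, z[ -> is_derive x 1 g (g' x).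
  move=> xyz; apply: (@has_derive_on_interior A); last by apply: dg; exact: yzA.
  by apply: filterS yzA _; exact: near_in_itvoo.
have [|x xyz e] := @MVT R g g' y z yz dgi.
  apply/continuous_within_itvP => //; split.
  - move=> x /dgi dx; apply: differentiable_continuous; apply/derivable1_diffP.
    by have [] := dx.
  - have := has_derive_on_near (dg y Ay); apply: cvg_trans; apply: cvg_app.
    exact: within_dnbhs_right yz yzA.
  - have := has_derive_on_near (dg z Az); apply: cvg_trans; apply: cvg_app.
    exact: within_dnbhs_left yz yzA.
by exists x => //; move: xyz; rewrite in_itv.
Qed.

(** Unordered segment: the chain may move either way, so z lies on either side of y. *)
Definition between (y z s : R) : Prop := y <= s <= z \/ z <= s <= y.

Lemma between_norm (y z s : R) : between y z s -> `|s - y| <= `|z - y|.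
Proof.
case=> /andP[h1 h2].
  by rewrite !ger0_norm ?subr_ge0 ?lerB// (le_trans h1).
rewrite !ler0_norm ?subr_le0//; last exact: le_trans h2.
by rewrite lerN2 lerB.
Qed.

(** One integration of a remainder bound through the mean value theorem. The gain 1/(k+1) is given
    up, so the Taylor remainders below carry no factorials. *)
Lemma taylor_step A g (g' : R -> R) (y z K : R) (k : nat) : is_interval A ->
  A y -> A z -> (forall x, A x -> has_derive_on A g x (g' x)) ->
  (forall s, between y z s -> `|g' s| <= K * `|s - y| ^+ k) -> 0 <= K ->
  forall s, between y z s -> `|g s - g y| <= K * `|s - y| ^+ k.+1.
Proof.
move=> iA Ay Az dg gK K0 s bs.
have As : A s.
  by case: bs => bs; [exact: iA Ay Az _ bs|exact: iA Az Ay _ bs].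
suff : exists2 x, between y z x /\ `|x - y| <= `|s - y| &
    g s - g y = g' x * (s - y).
  case=> x [bx xs] ->; rewrite normrM exprSr mulrA ler_wpM2r//.
  apply: le_trans (gK _ bx) _; rewrite ler_wpM2l//.
  by apply: lerXn2r; rewrite ?nnegrE.
case: (ltgtP y s) => ys.
- have [x /andP[yx xs] e] := MVT_on iA Ay As ys dg; exists x => //; split.
    by left; case: bs => /andP[h1 h2]; apply/andP; split; lra.
  by apply: between_norm; left; rewrite !ltW.
- have [x /andP[sx xy] e] := MVT_on iA As Ay ys dg; exists x; last by lra.
  split; first by right; case: bs => /andP[h1 h2]; apply/andP; split; lra.
  by apply: between_norm; right; rewrite !ltW.
- exists y; first by split; [case: bs => /andP[h1 h2]; [left|right]; rewrite lexx/= (le_trans h1)|rewrite subrr normr0].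
  by rewrite ys !subrr mulr0.
Qed.

Lemma has_derive_on_monomial A (c y : R) (k : nat) (x : R) :
  has_derive_on A (fun s => c * (s - y) ^+ k.+1) x (c * (k.+1%:R * (x - y) ^+ k)).
Proof.
apply: is_derive_on.
have -> : (fun s => c * (s - y) ^+ k.+1) = cst c * (id - cst y) ^+ k.+1.
  by apply/funext => s; rewrite fctE exprfctE.
by apply: is_derive_eq; rewrite /GRing.scale/= !fctE; ring.
Qed.

Lemma taylor2 A (g g1 g2 : R -> R) (y z K : R) : is_interval A -> A y -> A z ->
  (forall x, A x -> has_derive_on A g x (g1 x)) ->
  (forall x, A x -> has_derive_on A g1 x (g2 x)) ->
  (forall s, between y z s -> `|g2 s| <= K) -> 0 <= K ->
  `|g z - g y - g1 y * (z - y)| <= K * (z - y) ^+ 2.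
Proof.
move=> iA Ay Az dg dg1 gK K0.
have h1 s : between y z s -> `|g1 s - g1 y| <= K * `|s - y| ^+ 1.
  by apply: (taylor_step iA Ay Az dg1) => // s' /gK; rewrite expr0 mulr1.
pose p s := g1 y * (s - y) ^+ 1.
have bz : between y z z by have [h|/ltW h] := leP y z; [left|right]; rewrite lexx h.
have := @taylor_step A (fun s => g s - p s) (fun s => g1 s - g1 y) y z K 1 iA Ay Az.
move=> /(_ _ h1 K0 z bz); rewrite /p !expr1 subrr mulr0 subr0.
rewrite real_normK ?num_real// => h; rewrite addrAC; apply: h.
move=> x Ax; apply: has_derive_onB; first exact: dg.
by have := @has_derive_on_monomial A (g1 y) y 0 x; rewrite expr0 !mulr1.
Qed.

(** Iterated integration of the remainder: each stage subtracts from a derivative of g its Taylor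
    polynomial at y, and the derivative of that difference is the quantity bounded at the stage
    before. *)
Lemma taylor4 A (g g1 g2 g3 g4 : R -> R) (y z K : R) : is_interval A -> A y -> A z ->
  (forall x, A x -> has_derive_on A g x (g1 x)) ->
  (forall x, A x -> has_derive_on A g1 x (g2 x)) ->
  (forall x, A x -> has_derive_on A g2 x (g3 x)) ->
  (forall x, A x -> has_derive_on A g3 x (g4 x)) ->
  (forall s, between y z s -> `|g4 s| <= K) -> 0 <= K ->
  `|g z - g y - g1 y * (z - y) - g2 y / 2 * (z - y) ^+ 2
     - g3 y / 6 * (z - y) ^+ 3| <= K * (z - y) ^+ 4.
Proof.
move=> iA Ay Az dg dg1 dg2 dg3 gK K0.
have m1 := fun c x => @has_derive_on_monomial A c y 0 x.
have m2 := fun c x => @has_derive_on_monomial A c y 1 x.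
have m3 := fun c x => @has_derive_on_monomial A c y 2 x.
have h3 s : between y z s -> `|g3 s - g3 y| <= K * `|s - y| ^+ 1.
  by apply: (taylor_step iA Ay Az dg3) => // s' /gK; rewrite expr0 mulr1.
have h2 s : between y z s ->
    `|(g2 s - g3 y * (s - y) ^+ 1) - (g2 y - g3 y * (y - y) ^+ 1)| <= K * `|s - y| ^+ 2.
  apply: (@taylor_step A (fun s => g2 s - g3 y * (s - y) ^+ 1)
    (fun s => g3 s - g3 y)) => // x Ax; apply: has_derive_onB; first exact: dg2.
  by have := m1 (g3 y) x; rewrite expr0 !mulr1.
have h1 s : between y z s ->
    `|(g1 s - g2 y * (s - y) ^+ 1 - g3 y / 2 * (s - y) ^+ 2)
     - (g1 y - g2 y * (y - y) ^+ 1 - g3 y / 2 * (y - y) ^+ 2)| <= K * `|s - y| ^+ 3.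
  apply: (@taylor_step A (fun s => g1 s - g2 y * (s - y) ^+ 1 - g3 y / 2 * (s - y) ^+ 2)
    (fun s => (g2 s - g3 y * (s - y) ^+ 1) - (g2 y - g3 y * (y - y) ^+ 1))) => // x Ax.
  rewrite (_ : g2 x - _ - _ = g2 x - g2 y * (1%:R * (x - y) ^+ 0)
     - g3 y / 2 * (2%:R * (x - y) ^+ 1)); last by field.
  by do 2!apply: has_derive_onB => //; exact: dg1.
have bz : between y z z by have [h|/ltW h] := leP y z; [left|right]; rewrite lexx h.
have := @taylor_step A (fun s => g s - g1 y * (s - y) ^+ 1 - g2 y / 2 * (s - y) ^+ 2
     - g3 y / 6 * (s - y) ^+ 3)
  (fun s => (g1 s - g2 y * (s - y) ^+ 1 - g3 y / 2 * (s - y) ^+ 2)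
     - (g1 y - g2 y * (y - y) ^+ 1 - g3 y / 2 * (y - y) ^+ 2)) y z K 3 iA Ay Az.
move=> /(_ _ h1 K0 z bz).
have -> : `|z - y| ^+ 4 = (z - y) ^+ 4.
  by rewrite -normrX ger0_norm// (exprM _ 2 2) sqr_ge0.
rewrite subrr [g y - _ - _ - _](_ : _ = g y); last by ring.
move=> h; rewrite [X in `|X|](_ : _ = g z - g1 y * (z - y) ^+ 1 -
   g2 y / 2 * (z - y) ^+ 2 - g3 y / 6 * (z - y) ^+ 3 - g y); last by ring.
apply: h => x Ax.
rewrite (_ : g1 x - _ - _ - _ = g1 x - g1 y * (1%:R * (x - y) ^+ 0)
   - g2 y / 2 * (2%:R * (x - y) ^+ 1) - g3 y / 6 * (3%:R * (x - y) ^+ 2)); last by field.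
by do 3!apply: has_derive_onB => //; exact: dg.
Qed.

End derive_on.

(** * Solutions of the integro-differential equation *)

Section model_facts.
Context {R : realType}.
Local Notation mu := lebesgue_measure.
Implicit Types (M : jump_model R) (V W : nat -> nat -> nat -> R -> R -> R -> R).

Lemma domain_is_interval (D : set R) : convex_domain_or_closure D -> is_interval D.
Proof.
move=> [U [_ iU _ [->//|->]]].
by apply/connected_intervalP/connected_closure/connected_intervalP.
Qed.

(** [derive_on] is a [lim], determined only along a proper filter. The nonempty open set underlying
    the domain ensures that every point of it, boundary included, is a limit point. *)
Lemma domain_limit_point (D : set R) (y : R) : convex_domain_or_closure D -> D y ->
  ProperFilter (within D y^').
Proof.
move=> [U [oU _ U0 DU]] Dy.
have UD : U `<=` D by case: DU => ->//; exact: subset_closure.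
have cUy : closure U y by case: DU Dy => -> //; exact: subset_closure.
apply: Build_ProperFilter_ex => P [e /= e0 hP].
have [u [Uu yu]] := cUy _ (nbhsx_ballx y e e0).
have [uy|uy] := eqVneq u y; last by exists u; apply: hP => //; exact: UD.
rewrite uy in Uu.
have [e' /= e'0 hU] : nbhs y U by exact: open_nbhs_nbhs.
pose d := Num.min e e' / 2.
have m0 : 0 < Num.min e e' by rewrite lt_min e0.
have d0 : 0 < d by rewrite divr_gt0.
have dm : d < Num.min e e' by rewrite /d; lra.
have /andP[de de'] : (d < e) && (d < e') by rewrite -lt_min.
have nd : `|y - (y + d)| = d by rewrite opprD addrA subrr sub0r normrN gtr0_norm.
exists (y + d); apply: hP => /=; first by rewrite nd.
  by rewrite -subr_eq0 addrAC subrr add0r gt_eqF.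
by apply: UD; apply: hU; rewrite /= nd.
Qed.

Lemma time_limit_point (T t : R) : 0 <= t < T -> ProperFilter (within `[0, T[ t^').
Proof.
move=> /andP[t0 tT]; apply: Build_ProperFilter_ex => P [e /= e0 hP].
pose d := Num.min e (T - t) / 2.
have m0 : 0 < Num.min e (T - t) by rewrite lt_min e0 subr_gt0.
have d0 : 0 < d by rewrite divr_gt0.
have dm : d < Num.min e (T - t) by rewrite /d; lra.
have /andP[de dT] : (d < e) && (d < T - t) by rewrite -lt_min.
have nd : `|t - (t + d)| = d by rewrite opprD addrA subrr sub0r normrN gtr0_norm.
exists (t + d); apply: hP => /=; first by rewrite nd.
  by rewrite -subr_eq0 addrAC subrr add0r gt_eqF.
by rewrite in_itv/=; apply/andP; split; lra.
Qed.

Lemma derive_onE (A : set R) (g : R -> R) (a l : R) : ProperFilter (within A a^') ->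
  has_derive_on A g a l -> derive_on A g a = l.
Proof. by move=> PF h; apply/cvg_lim. Qed.

Lemma eq_has_derive_on (A : set R) (g1 g2 : R -> R) (a l : R) :
  (forall s, A s -> g1 s = g2 s) -> A a -> has_derive_on A g1 a l ->
  has_derive_on A g2 a l.
Proof.
move=> g12 Aa h; rewrite /has_derive_on.
have F1 : Filter (within A a^') by exact: within_filter.
have h0 : {near within A a^', quotient_on g1 a =1 quotient_on g2 a}.
  apply: filterS (@withinT _ a^' A _) => s As.
  by rewrite /quotient_on !g12.
exact: cvg_trans (near_eq_cvg h0) h.
Qed.

Definition nonlocal M (g : R -> R) (x y : R) : R :=
  \int[mu]_z ((g (x + gammaX M y * z) - g x) * levy_density M z).

Definition partials_eq M V (t x y : R) : Prop :=
  V 1%N 0%N 0%N t x y + (2^-1 * sigmaX M y ^+ 2 * V 0%N 2%N 0%N t x y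
   + 2^-1 * sigmaY M y ^+ 2 * V 0%N 0%N 2%N t x y
   + muX M y * V 0%N 1%N 0%N t x y + muY M y * V 0%N 0%N 1%N t x y
   + nonlocal M (V 0%N 0%N 0%N t ^~ y) x y) = 0.

Lemma pide_partials M f u V : convex_domain_or_closure (dom M) ->
  is_partials M 6 u V -> solves_pide M f u ->
  forall t x y, 0 <= t < horizon M -> dom M y -> partials_eq M V t x y.
Proof.
move=> cD [V0 hV] [hp _] t x y tT Dy.
have /andP[t0 tT'] := tT; have := hp t x y t0 tT' Dy.
have It : `[0, horizon M[%classic t by rewrite /= in_itv/= t0.
have [_ dt dx dy] := hV 0%N 0%N 0%N isT.
have [_ _ dx2 _] := hV 0%N 1%N 0%N isT.
have [_ _ _ dy2] := hV 0%N 0%N 1%N isT.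
have uV x' y' : dom M y' -> V 0%N 0%N 0%N t x' y' = u t x' y' by move=> ?; exact: V0.
have Et : derive_on `[0, horizon M[%classic (fun s => u s x y) t = V 1%N 0%N 0%N t x y.
  apply: derive_onE; first exact: time_limit_point.
  apply: eq_has_derive_on (dt isT t x y It Dy) => // s Is.
  exact: V0.
have Ey y' : dom M y' -> derive_on (dom M) (u t x) y' = V 0%N 0%N 1%N t x y'.
  move=> Dy'; apply: derive_onE; first exact: domain_limit_point.
  apply: eq_has_derive_on (dy isT t x y' It Dy') => // s Ds.
  exact: uV.
have Eyy : derive_on (dom M) (derive_on (dom M) (u t x)) y = V 0%N 0%N 2%N t x y.
  apply: derive_onE; first exact: domain_limit_point.
  apply: eq_has_derive_on (dy2 isT t x y It Dy) => // s Ds.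
  by rewrite Ey.
have ux : (fun x' => u t x' y) = V 0%N 0%N 0%N t ^~ y.
  by apply/funext => x'; rewrite uV.
have Ex : derive1 (fun x' => u t x' y) = V 0%N 1%N 0%N t ^~ y.
  apply/funext => x'; rewrite ux derive1E.
  by have [_ ->] := dx isT t x' y It Dy.
have Exx : derive1n 2 (fun x' => u t x' y) x = V 0%N 2%N 0%N t x y.
  rewrite /derive1n/= Ex derive1E.
  by have [_ ->] := dx2 isT t x y It Dy.
rewrite Et /generator Eyy Ey// Exx Ex /partials_eq /nonlocal => <-.
do 2 congr (_ + _); apply: eq_Rintegral => z _.
by rewrite !uV.
Qed.

Lemma Lnorm2_le (f : R -> R) (B : R) :
  ('N[mu]_(2%:E)[EFin \o f] <= B%:E)%E -> (\int[mu]_x (f x ^+ 2)%:E <= (B ^+ 2)%:E)%E.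
Proof.
move=> h; have B0 : 0 <= B by rewrite -lee_fin; apply: le_trans h; exact: Lnorm_ge0.
have := @gt0_ler_poweR R 2 (ler0n _ 2) _ _ _ _ h.
rewrite powR_Lnorm// poweR_EFin powR_mulrn//.
have -> : (\int[mu]_x (f x ^+ 2)%:E = \int[mu]_x `|(EFin \o f) x| `^ 2)%E.
  apply: eq_integral => x _.
  by rewrite /= powR_mulrn// real_normK ?num_real.
by apply; rewrite in_itv/= leey andbT ?lee_fin// Lnorm_ge0.
Qed.

(* [W k m l] is d_t^k d_x^m d_y^l of a solution with terminal value [WT]. *)
Record scalar_sol M (Q : R -> R) W (WT : R -> R -> R) : Prop := {
  ss_t : forall k m l, (2 * k.+1 + m + l <= 6)%N -> forall t x y,
    0 <= t < horizon M -> dom M y ->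
    has_derive_on `[0, horizon M[ (fun s => W k m l s x y) t (W k.+1 m l t x y);
  ss_x : forall k m l, (2 * k + m.+1 + l <= 6)%N -> forall t (x y : R),
    0 <= t < horizon M -> dom M y ->
    is_derive x 1 (fun s => W k m l t s y) (W k m.+1 l t x y);
  ss_y : forall k m l, (2 * k + m + l.+1 <= 6)%N -> forall t x y,
    0 <= t < horizon M -> dom M y ->
    has_derive_on (dom M) (fun s => W k m l t x s) y (W k m l.+1 t x y);
  ss_bound : forall k m l, (2 * k + m + l <= 5)%N -> forall t x y,
    0 <= t < horizon M -> dom M y -> `|W k m l t x y| <= Q y;
  ss_pide : forall t x y, 0 <= t < horizon M -> dom M y -> partials_eq M W t x y;
  ss_T : forall x y, dom M y ->
    W 0%N 0%N 0%N s x y @[s --> (horizon M)^'-] --> WT x y }.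

Definition growth (C a y : R) : R := C * (1 + `|y| `^ a).

Lemma growth_ge0 (C a y : R) : 0 <= C -> 0 <= growth C a y.
Proof. by move=> C0; rewrite mulr_ge0// addr_ge0// powR_ge0. Qed.

Lemma levy_density_ge0 M : model_hypotheses M -> forall x, 0 <= levy_density M x.
Proof.
move=> hM x; rewrite mulr_ge0 ?(ltW (intensity_gt0 hM))//.
exact: jump_density_ge0 hM x.
Qed.

Lemma levy_density_integrable M : model_hypotheses M ->
  mu.-integrable [set: R] (EFin \o levy_density M).
Proof.
move=> hM; apply/integrableP; split.
  apply/measurable_EFinP; apply: measurable_funM => //.
  exact: jump_density_measurable hM.
under eq_integral do rewrite /= ger0_norm ?levy_density_ge0// EFinM.
rewrite ge0_integralZl_EFin//.
- by rewrite (jump_density_mass hM) mule1 ltry.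
- by move=> x _; rewrite lee_fin (jump_density_ge0 hM).
- by apply/measurable_EFinP; exact: jump_density_measurable hM.
- exact/ltW/(intensity_gt0 hM).
Qed.

Lemma bounded_mul_integrable (g w : R -> R) (B : R) :
  measurable_fun [set: R] g -> (forall z, `|g z| <= B) ->
  mu.-integrable [set: R] (EFin \o w) ->
  mu.-integrable [set: R] (EFin \o (fun z => g z * w z)).
Proof.
move=> mg gB iL.
have mL : measurable_fun [set: R] w by case/integrableP : iL => /measurable_EFinP.
apply: (@le_integrable _ _ _ mu _ measurableT _ (fun z => B%:E * (EFin \o w) z)%E).
- by apply/measurable_EFinP; exact: measurable_funM.
- move=> z _; rewrite /= lee_fin normrM [in leRHS]normrM; apply: ler_wpM2r => //.
  exact: le_trans (gB z) (ler_norm _).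
- exact: integrableZl.
Qed.

(** Cauchy-Schwarz with the weight dx: the square root is the norm of c in the scaling of [l2norm],
    and [B] bounds that of v. *)
Lemma pairing_le (dx B : R) n (c v : int -> R) : 0 < dx -> 0 <= B ->
  zbox n (fun i => v i ^+ 2 * dx) <= B ^+ 2 ->
  `|dx * zbox n (fun i => c i * v i)| <=
    Num.sqrt (dx * zbox n (fun i => c i ^+ 2)) * B.
Proof.
move=> dx0 B0 vB; rewrite normrM (gtr0_norm dx0).
have z0 (w : int -> R) : 0 <= zbox n (fun i => w i ^+ 2) by apply: zbox_ge0 => i; exact: sqr_ge0.
have h : `|zbox n (fun i => c i * v i)| <= Num.sqrt (zbox n (fun i => c i ^+ 2)) *
    Num.sqrt (zbox n (fun i => v i ^+ 2)).
  apply: le_trans (ler_norm_zbox _ _) _; under eq_zbox do rewrite normrM.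
  apply: le_trans (CauchySchwarz_zbox _ _ _) _.
  by under eq_zbox do rewrite real_normK ?num_real//;
     under [X in _ * Num.sqrt X]eq_zbox do rewrite real_normK ?num_real//.
rewrite -{1}(sqr_sqrtr (ltW dx0)) sqrtrM ?(ltW dx0)// expr2 -!mulrA.
apply: ler_wpM2l; first exact: sqrtr_ge0.
apply: le_trans (ler_wpM2l (sqrtr_ge0 _) h) _.
rewrite mulrCA; apply: ler_wpM2l; first exact: sqrtr_ge0.
rewrite -sqrtrM ?(ltW dx0)// -(ger0_norm B0) -sqrtr_sqr ler_sqrt ?sqr_ge0//.
by rewrite -zboxZ; under eq_zbox do rewrite mulrC.
Qed.

(** * Weighted translates of the solution *)

Section combination.
Variables (M : jump_model R) (f : R -> R -> R) (u : R -> R -> R -> R).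
Variables (V : nat -> nat -> nat -> R -> R -> R -> R) (C a : R).
Hypotheses (hM : model_hypotheses M) (hV : is_partials M 6 u V)
  (hp : solves_pide M f u) (C0 : 0 < C).
Hypothesis hL : forall k m l, (2 * k + m + l <= 6)%N -> forall t y,
      0 <= t -> t < horizon M -> dom M y ->
      ('N[mu]_(2%:E)[EFin \o (V k m l t ^~ y)] <= (C * (1 + `|y| `^ a))%:E)%E.

(** Sampling consumes one x-derivative, hence order at most 5 here against 6 in the hypothesis. The
    factor 2 comes from 3 <= 2^2. The free base point p makes later bounds uniform in the shift
    x. *)
Lemma sampled_partials_le k m l t y p eta n : (2 * k + m + l <= 5)%N ->
  0 <= t < horizon M -> dom M y -> 0 < eta -> eta <= 1 ->
  zbox n (fun i => V k m l t (p + i%:~R * eta) y ^+ 2 * eta) <=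
    (2 * growth C a y) ^+ 2.
Proof.
move=> kml tT Dy eta0 eta1; have /andP[t0 tT'] := tT.
have It : `[0, horizon M[%classic t by rewrite /= in_itv/= t0.
have kml6 : (2 * k + m + l <= 6)%N by apply: leq_trans kml _.
have kml6' : (2 * k + m.+1 + l <= 6)%N by rewrite addnS addSn.
have kml7 : (2 * k + m.+2 + l <= 6)%N \/ (2 * k + m + l = 5)%N by lia.
have [_ _ dx _] := hV.2 k m l kml6.
have d1 (x : R) : is_derive x 1 (V k m l t ^~ y) (V k m.+1 l t x y) by exact: dx.
have m1 : measurable_fun [set: R] (V k m.+1 l t ^~ y) by exact: measurable_fun_is_derive d1.
have h1 := Lnorm2_le (hL kml6 t0 tT' Dy).
have h2 := Lnorm2_le (hL kml6' t0 tT' Dy).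
apply: le_trans (l2_sample_le p n eta0 eta1 d1 m1 h1 h2) _.
rewrite -/(growth C a y) [in leRHS]exprMn; apply: ler_wpM2r; first exact: sqr_ge0.
by rewrite expr2; lra.
Qed.

(** The sampling bound with mesh 1 and a window of two points, one of which is x itself. *)
Lemma partials_sup_le k m l t x y : (2 * k + m + l <= 5)%N ->
  0 <= t < horizon M -> dom M y -> `|V k m l t x y| <= 2 * growth C a y.
Proof.
move=> kml tT Dy.
have := @sampled_partials_le k m l t y x 1 1 kml tT Dy ltr01 (lexx _).
rewrite zboxS zbox0 add0r !mulr1 mulr0z addr0 => h.
have g0 : 0 <= 2 * growth C a y by rewrite mulr_ge0// growth_ge0// ltW.
rewrite -(ger0_norm g0) -ler_sqr ?nnegrE// !real_normK ?num_real//.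
by apply: le_trans h; rewrite lerDl sqr_ge0.
Qed.

(** The dual pairing of the shifted samples with c, viewed as a function of the shift x. As the
    coefficients of the equation do not depend on x, it is again a solution; its value at 0 is the
    pairing on the grid, and its values at l dx are pairings with shifted samples. *)
Definition combine (X0 dx : R) (n : nat) (c : int -> R) (k m l : nat) (t x y : R) : R :=
  dx * zbox n (fun i => c i * V k m l t (grid X0 dx i + x) y).

Lemma combine_scalar_sol (X0 dx : R) n c : 0 < dx -> dx <= 1 ->
  scalar_sol M
    (fun y => Num.sqrt (dx * zbox n (fun i => c i ^+ 2)) * (2 * growth C a y))
    (combine X0 dx n c)
    (fun x y => dx * zbox n (fun i => c i * f (grid X0 dx i + x) y)).
Proof.
move=> dx0 dx1; have cD := dom_convex hM.
have It t : 0 <= t < horizon M -> `[0, horizon M[%classic t.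
  by move=> /andP[t0 tT]; rewrite /= in_itv/= t0.
split.
- move=> k m l kml t x y /It tT Dy; apply: has_derive_onZ.
  apply: (@has_derive_on_zbox _ _ (fun i s => c i * V k m l s (grid X0 dx i + x) y)) => i.
  apply: has_derive_onZ; have [_ dt _ _] := hV.2 k m l ltac:(lia).
  exact: dt.
- move=> k m l kml t x y /It tT Dy; have [_ _ dx' _] := hV.2 k m l ltac:(lia).
  have dX i : is_derive x 1 (fun s => V k m l t (grid X0 dx i + s) y)
      (V k m.+1 l t (grid X0 dx i + x) y).
    have h := dx' kml t (grid X0 dx i + x) y tT Dy.
    have hs : is_derive x 1 (fun s => grid X0 dx i + s) 1.
      have -> : (fun s => grid X0 dx i + s) = cst (grid X0 dx i) + id by [].
      by apply: is_derive_eq; rewrite add0r.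
    by have := @is_derive1_comp _ _ _ _ _ _ h hs; rewrite mulr1.
  (* Relative to the whole line the two notions of derivative agree, so the lemma on finite sums of
     relative derivatives applies. *)
  apply: (@has_derive_on_interior _ setT); first exact: filterT.
  apply: has_derive_onZ.
  apply: (@has_derive_on_zbox _ _ (fun i s => c i * V k m l t (grid X0 dx i + s) y)) => i.
  by apply: has_derive_onZ; exact: is_derive_on.
- move=> k m l kml t x y /It tT Dy; apply: has_derive_onZ.
  apply: (@has_derive_on_zbox _ _ (fun i s => c i * V k m l t (grid X0 dx i + x) s)) => i.
  apply: has_derive_onZ; have [_ _ _ dy] := hV.2 k m l ltac:(lia).
  exact: dy.
- move=> k m l kml t x y tT Dy; apply: pairing_le => //.
    by rewrite mulr_ge0// growth_ge0// ltW.
  have := @sampled_partials_le k m l t y (X0 + x) dx n kml tT Dy dx0 dx1.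
  apply: le_trans; apply: ler_zbox => i.
  by rewrite /grid addrAC.
- move=> t x y tT Dy.
  have pV i := pide_partials cD hV hp (grid X0 dx i + x) tT Dy.
  have mV x0 : measurable_fun [set: R] (fun z => V 0%N 0%N 0%N t (x0 + gammaX M y * z) y - V 0%N 0%N 0%N t x0 y).
    apply: measurable_funB => //.
    apply: (measurableT_comp (f := V 0%N 0%N 0%N t ^~ y)).
      apply: continuous_measurable_fun; apply: (@is_derive_continuous _ _ (V 0%N 1%N 0%N t ^~ y)).
      by have [_ _ dx' _] := hV.2 0%N 0%N 0%N isT => s; apply: dx' => //; exact: It.
    by apply: measurable_funD => //; exact: measurable_funM.
  have bV x0 z : `|V 0%N 0%N 0%N t (x0 + gammaX M y * z) y - V 0%N 0%N 0%N t x0 y| <= 2 * growth C a y + 2 * growth C a y.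
    by apply: le_trans (ler_normB _ _) _; apply: lerD; exact: partials_sup_le.
  have iV x0 := bounded_mul_integrable (mV x0) (bV x0) (levy_density_integrable hM).
  (* The jump integral commutes with the finite combination. Integrability is carried through the
     induction because each step splits an integral. *)
  have nl : nonlocal M (combine X0 dx n c 0 0 0 t ^~ y) x y =
     dx * zbox n (fun i => c i * nonlocal M (V 0%N 0%N 0%N t ^~ y) (grid X0 dx i + x) y).
    have [-> //] : nonlocal M (combine X0 dx n c 0 0 0 t ^~ y) x y =
        dx * zbox n (fun i => c i * nonlocal M (V 0%N 0%N 0%N t ^~ y) (grid X0 dx i + x) y) /\
       mu.-integrable [set: R] (EFin \o (fun z => ((combine X0 dx n c 0 0 0 t) (x + gammaX M y * z) y
          - combine X0 dx n c 0 0 0 t x y) * levy_density M z)).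
    pose w i z := (V 0%N 0%N 0%N t (grid X0 dx i + x + gammaX M y * z) y - V 0%N 0%N 0%N t (grid X0 dx i + x) y) * levy_density M z.
    have iw i (k : R) : mu.-integrable [set: R] (EFin \o (fun z => k * w i z)).
      apply: eq_integrable (integrableZl measurableT k (iV (grid X0 dx i + x))) => //.
    have E (m : nat) : (fun z => (combine X0 dx m c 0 0 0 t (x + gammaX M y * z) y
          - combine X0 dx m c 0 0 0 t x y) * levy_density M z) =
        (fun z => zbox m (fun i => (dx * c i) * w i z)).
      apply/funext => z; rewrite /combine -mulrBr -zboxN -zboxD -!zboxZ mulrC -zboxZ.
      by apply: eq_zbox => i; rewrite /w addrA; ring.
    rewrite /nonlocal E.
    elim: (n) => [|m [ih1 ih2]].
      split.
        rewrite zbox0 mulr0; under eq_Rintegral do rewrite zbox0.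
        by rewrite Rintegral_cst// mul0r.
      by apply: eq_integrable (integrable0 _ _) => // z _ /=; rewrite zbox0.
    have i1 := iw (Posz m) (dx * c (Posz m)).
    have i2 := iw (Negz m) (dx * c (Negz m)).
    have i12 : mu.-integrable [set: R] (EFin \o (fun z => dx * c m * w m z + dx * c (Negz m) * w (Negz m) z)).
      exact: eq_integrable (integrableD measurableT i1 i2).
    have i3 : mu.-integrable [set: R] (EFin \o (fun z => zbox m.+1 (fun i => dx * c i * w i z))).
      apply: eq_integrable (integrableD measurableT ih2 i12) => // z _ /=.
      by rewrite zboxS.
    split=> //.
    under eq_Rintegral do rewrite zboxS.
    rewrite RintegralD// ih1 RintegralD// RintegralZl//; last exact: iV.
    rewrite RintegralZl//; last exact: iV.
    by rewrite zboxS /nonlocal; ring.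
  transitivity (dx * zbox n (fun i => c i * 0)); last first.
    by rewrite /zbox big1 ?mulr0// => k _; rewrite !mulr0 addr0.
  rewrite (_ : zbox n (fun i => c i * 0) = zbox n (fun i => c i * 
    (V 1%N 0%N 0%N t (grid X0 dx i + x) y
     + (2^-1 * sigmaX M y ^+ 2 * V 0%N 2%N 0%N t (grid X0 dx i + x) y
     + 2^-1 * sigmaY M y ^+ 2 * V 0%N 0%N 2%N t (grid X0 dx i + x) y
     + muX M y * V 0%N 1%N 0%N t (grid X0 dx i + x) y
     + muY M y * V 0%N 0%N 1%N t (grid X0 dx i + x) y
     + nonlocal M (V 0%N 0%N 0%N t ^~ y) (grid X0 dx i + x) y)))); last first.
    by apply: eq_zbox => i; rewrite -[in LHS](pV i).
  rewrite nl /combine.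
  rewrite -!zboxZ -!zboxD.
  by apply: eq_zbox => i; ring.
- move=> x y Dy; apply: cvgMr.
  elim: (n) => [|m ih].
    by under eq_fun do rewrite zbox0; rewrite zbox0; exact: cvg_cst.
  under eq_fun do rewrite zboxS; rewrite zboxS.
  have hc i : c i * V 0%N 0%N 0%N s (grid X0 dx i + x) y @[s --> (horizon M)^'-] -->
      c i * f (grid X0 dx i + x) y.
    apply: cvgMr; have [_ h] := hp.2 (grid X0 dx i + x) y Dy.
    apply: cvg_trans h; apply: near_eq_cvg; near=> s.
    apply/esym/hV.1 => //; rewrite /= in_itv/=; apply/andP; split.
      by near: s; apply: nbhs_left_ge; exact: horizon_gt0.
    by near: s; exact: nbhs_left_lt.
  by apply: cvgD => //; exact: cvgD.
Unshelve. all: by end_near. Qed.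

End combination.
End model_facts.

Section reflection.
Context {R : realType}.

(** Reflection sends the window -n <= i < n to -n < i <= n, which is the same window shifted by
    one. *)
Lemma zsum_opp (b : int -> R) : zabs b ->
  zabs (fun i => b (- i)) /\ zsum (fun i => b (- i)) = zsum b.
Proof.
move=> hb.
have E (c : int -> R) n : zbox n (fun i => c (- i)) = zbox n (fun i => c (i + 1)).
  apply: eq_bigr => k _; rewrite addrC; congr (c _ + c _).
    by rewrite NegzE opprK addrC -intS.
  by rewrite NegzE intS opprD addrAC addNr add0r.
have z1 : zabs (fun i => b (- i)).
  by have [K hK] := zabs_shift1 hb; exists K => n; rewrite (E (fun i => `|b i|)).
split => //; apply: zsum_uniq => //.
under eq_fun do rewrite E.
by rewrite -(zsum_shift1 hb); apply: zsum_cvg; exact: zabs_shift1.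
Qed.

End reflection.

(** * Quadrature of the jump integral *)

Section jumps.
Context {R : realType}.
Local Notation mu := lebesgue_measure.

Lemma is_derive_scaled (g g1 : R -> R) (k x : R) :
  (forall x : R, is_derive x 1 g (g1 x)) ->
  is_derive x 1 (fun s => g (k * s)) (k * g1 (k * x)).
Proof.
move=> dg.
have hs : is_derive x 1 (fun s : R => k * s) k.
  have -> : (fun s : R => k * s) = cst k * id by [].
  by apply: is_derive_eq; rewrite /GRing.scale/= mulr0 addr0 mulr1.
by have := @is_derive1_comp _ _ _ _ _ _ (dg (k * x)) hs; rewrite mulrC.
Qed.

Lemma is_derive_pointM (g h : R -> R) (x g' h' : R) :
  is_derive x 1 g g' -> is_derive x 1 h h' ->
  is_derive x 1 (fun s => g s * h s) (g' * h x + g x * h').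
Proof.
move=> dg dh; apply: (is_derive_eq (@is_deriveM _ _ g h x 1 g' h' dg dh)).
by rewrite /GRing.scale/=; ring.
Qed.

(** In the jump variable z the grid of mesh dx becomes one of mesh dx/|gamma|, and the midpoint rule
    is applied to g(gamma z) nu(z). Its second derivative involves nu, nu', nu'' with factors
    |gamma|^2, 2 |gamma|, 1, times the sup bound [q]. *)
Lemma jump_quadrature (nu n1 n2 : R -> R) (N0 N1 N2 gam dx q : R)
    (g g1 g2 : R -> R) :
  (forall x, 0 <= nu x) -> (forall x : R, is_derive x 1 nu (n1 x)) ->
  (forall x : R, is_derive x 1 n1 (n2 x)) ->
  mu.-integrable [set: R] (EFin \o nu) ->
  0 <= N0 -> 0 <= N1 -> 0 <= N2 ->
  (\int[mu]_x (nu x)%:E <= N0%:E)%E ->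
  (\int[mu]_x `|n1 x|%:E <= N1%:E)%E ->
  (\int[mu]_x `|n2 x|%:E <= N2%:E)%E ->
  gam != 0 -> 0 < dx ->
  (forall x : R, is_derive x 1 g (g1 x)) ->
  (forall x : R, is_derive x 1 g1 (g2 x)) ->
  (forall x, `|g x| <= q) -> (forall x, `|g1 x| <= q) -> (forall x, `|g2 x| <= q) ->
  let eta := dx / `|gam| in
  let a (i : int) := eta * (g (gam * (i%:~R * eta)) * nu (i%:~R * eta)) in
  zabs a /\ `|\int[mu]_z (g (gam * z) * nu z) - zsum a| <=
    eta ^+ 2 / 2 * (q * (`|gam| ^+ 2 * N0 + 2 * `|gam| * N1 + N2)).
Proof.
move=> nu0 dn dn2 inu N00 N10 N20 i0 i1 i2 gam0 dx0 dg dg1 gq g1q g2q eta a.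
have q0 : 0 <= q by apply: le_trans (gq 0).
have ng0 : 0 < `|gam| by rewrite normr_gt0.
have eta0 : 0 < eta by rewrite divr_gt0.
have mnu : measurable_fun [set: R] nu.
  by apply: continuous_measurable_fun; exact: is_derive_continuous dn.
have mn1 : measurable_fun [set: R] (fun x => `|n1 x|).
  by apply: measurableT_comp => //; exact: measurable_fun_is_derive dn.
have mn2 : measurable_fun [set: R] (fun x => `|n2 x|).
  by apply: measurableT_comp => //; exact: measurable_fun_is_derive dn2.
pose G z := g (gam * z) * nu z.
pose G1 z := gam * g1 (gam * z) * nu z + g (gam * z) * n1 z.
pose G2 z := gam ^+ 2 * g2 (gam * z) * nu z + 2 * gam * g1 (gam * z) * n1 z
   + g (gam * z) * n2 z.
have dG (x : R) : is_derive x 1 G (G1 x).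
  by apply: is_derive_pointM => //; exact: is_derive_scaled.
have dgg (x : R) : is_derive x 1 (fun s => gam * g1 (gam * s)) (gam ^+ 2 * g2 (gam * x)).
  have -> : gam ^+ 2 * g2 (gam * x) = 0 * g1 (gam * x) + gam * (gam * g2 (gam * x)) by ring.
  apply: (@is_derive_pointM (cst gam) (fun s => g1 (gam * s)) x 0).
  exact: is_derive_scaled.
have dG1 (x : R) : is_derive x 1 G1 (G2 x).
  have -> : G2 x = (gam ^+ 2 * g2 (gam * x) * nu x + gam * g1 (gam * x) * n1 x) +
     (gam * g1 (gam * x) * n1 x + g (gam * x) * n2 x) by rewrite /G2; ring.
  apply: (@is_deriveD _ _ _ (fun z => gam * g1 (gam * z) * nu z) (fun z => g (gam * z) * n1 z)).
    exact: (@is_derive_pointM (fun s => gam * g1 (gam * s)) nu x).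
  by apply: is_derive_pointM => //; exact: is_derive_scaled.
pose q1 z := q * (`|gam| * nu z + `|n1 z|).
pose q2 z := q * (`|gam| ^+ 2 * nu z + 2 * `|gam| * `|n1 z| + `|n2 z|).
have mq1 : measurable_fun [set: R] q1.
  by apply: measurable_funM => //; apply: measurable_funD => //; exact: measurable_funM.
have mq2 : measurable_fun [set: R] q2.
  by apply: measurable_funM => //; do !apply: measurable_funD => //; exact: measurable_funM.
have Gq1 x : `|G1 x| <= q1 x.
  rewrite /q1 mulrDr; apply: le_trans (ler_normD _ _) _; apply: lerD.
    rewrite normrM [`|gam * _|]normrM (ger0_norm (nu0 x)) mulrA.
    apply: ler_wpM2r => //.
    by rewrite mulrC; apply: ler_wpM2r.
  by rewrite normrM; apply: ler_wpM2r.
have Gq2 x : `|G2 x| <= q2 x.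
  rewrite /q2 !mulrDr; apply: le_trans (ler_normD _ _) _; apply: lerD.
    apply: le_trans (ler_normD _ _) _; apply: lerD.
      rewrite normrM [`|gam ^+ 2 * _|]normrM (ger0_norm (nu0 x)) normrX mulrA.
      apply: ler_wpM2r => //.
      by rewrite mulrC; apply: ler_wpM2r; rewrite ?exprn_ge0.
    rewrite !normrM mulrA; apply: ler_wpM2r => //.
    by rewrite mulrC normr_nat; apply: ler_wpM2r; rewrite ?mulr_ge0.
  by rewrite normrM; apply: ler_wpM2r.
have mg : measurable_fun [set: R] (fun z => g (gam * z)).
  apply: (measurableT_comp (f := g)); last exact: measurable_funM.
  by apply: continuous_measurable_fun; exact: is_derive_continuous dg.
have iG : mu.-integrable [set: R] (EFin \o G).
  exact: (@bounded_mul_integrable _ (fun z => g (gam * z)) nu q).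
have mnuE : measurable_fun [set: R] (fun x => (nu x)%:E) by exact/measurable_EFinP.
have mn1E : measurable_fun [set: R] (fun x => `|n1 x|%:E) by exact/measurable_EFinP.
have mn2E : measurable_fun [set: R] (fun x => `|n2 x|%:E) by exact/measurable_EFinP.
have lin (k0 k1 k2 : R) : 0 <= k0 -> 0 <= k1 -> 0 <= k2 ->
   (\int[mu]_x (q * (k0 * nu x + k1 * `|n1 x| + k2 * `|n2 x|))%:E
     <= (q * (k0 * N0 + k1 * N1 + k2 * N2))%:E)%E.
  move=> k00 k10 k20.
  have p0 x : 0 <= k0 * nu x by rewrite mulr_ge0.
  have p1 x : 0 <= k1 * `|n1 x| by rewrite mulr_ge0.
  have p2 x : 0 <= k2 * `|n2 x| by rewrite mulr_ge0.
  under eq_integral do rewrite EFinM.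
  rewrite ge0_integralZl_EFin//; last 2 first.
  - by move=> x _; rewrite lee_fin !addr_ge0.
  - apply/measurable_EFinP; do !apply: measurable_funD; exact: measurable_funM.
  rewrite [leRHS]EFinM; apply: lee_wpmul2l; first by rewrite lee_fin.
  under eq_integral do rewrite 2!EFinD !EFinM.
  rewrite ge0_integralD//; last 4 first.
  - by move=> x _; rewrite -!EFinM -EFinD lee_fin addr_ge0.
  - by apply: emeasurable_funD; exact: emeasurable_funM.
  - by move=> x _; rewrite -!EFinM lee_fin.
  - exact: emeasurable_funM.
  rewrite ge0_integralD//; last 4 first.
  - by move=> x _; rewrite -!EFinM lee_fin.
  - exact: emeasurable_funM.
  - by move=> x _; rewrite -!EFinM lee_fin.
  - exact: emeasurable_funM.
  rewrite !ge0_integralZl_EFin//; [|by move=> x _; rewrite lee_fin..].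
  rewrite [leRHS]EFinD [((_ + _)%R)%:E]EFinD ![((_ * _)%R)%:E]EFinM.
  by apply: leeD; first apply: leeD; apply: lee_wpmul2l; rewrite ?lee_fin.
apply: (quadrature_le eta0 dG dG1 mq1 mq2 Gq1 Gq2 iG).
  apply: (@le_lt_trans _ _ (q * (`|gam| * N0 + 1 * N1 + 0 * N2))%:E); last by rewrite ltry.
  apply: le_trans (lin _ _ _ _ _ _) => //; rewrite le_eqVlt; apply/orP; left; apply/eqP.
  by apply: eq_integral => x _; rewrite /q1 mul0r addr0 mul1r.
rewrite -(mul1r N2).
have p1 : 0 <= `|gam| ^+ 2 by exact: exprn_ge0.
have p2 : 0 <= 2 * `|gam| by exact: mulr_ge0.
apply: le_trans (lin _ _ _ p1 p2 ler01).
rewrite le_eqVlt; apply/orP; left; apply/eqP.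
by apply: eq_integral => x _; rewrite /q2 mul1r.
Qed.

Variable M : jump_model R.
Hypotheses (hM : model_hypotheses M)
  (hnu : levy_density_regular (levy_density M)).
Local Notation nu := (levy_density M).

Lemma levy_constants : exists N0 N1 N2 : R, [/\ 0 <= N0, 0 <= N1, 0 <= N2 &
  [/\ (\int[mu]_x (nu x)%:E <= N0%:E)%E,
      (\int[mu]_x `|derive1 nu x|%:E <= N1%:E)%E &
      (\int[mu]_x `|derive1n 2 nu x|%:E <= N2%:E)%E]].
Proof.
have nu0 := levy_density_ge0 hM.
have inu : (\int[mu]_x (nu x)%:E < +oo)%E.
  have /integrableP[_] := levy_density_integrable hM.
  by under eq_integral do rewrite /= ger0_norm//.
have [_ _ i1 i2] := levy_density_L1 hnu nu0 inu.
have fin (h : R -> R) : (forall x, 0 <= h x) -> (\int[mu]_x (h x)%:E < +oo)%E ->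
    exists2 N, 0 <= N & (\int[mu]_x (h x)%:E <= N%:E)%E.
  move=> h0 hf; have hi : (0 <= \int[mu]_x (h x)%:E)%E.
    by apply: integral_ge0 => x _; rewrite lee_fin.
  exists (fine (\int[mu]_x (h x)%:E)); first exact: fine_ge0.
  by rewrite fineK// ge0_fin_numE.
have [N0 ? ?] := fin _ nu0 inu.
have [N1 ? ?] := fin _ (fun x => normr_ge0 (derive1 nu x)) i1.
have [N2 ? ?] := fin _ (fun x => normr_ge0 (derive1n 2 nu x)) i2.
by exists N0, N1, N2.
Qed.

(** Uniformity in y comes from the dichotomy on gamma: either there are no jumps and both constants
    are 0, or |gamma| >= eps. The first constant bounds the mass of the discrete jump weights
    (stability), the second the quadrature error (consistency). *)
Lemma jump_constants : exists L CJ : R, [/\ 0 <= L, 0 <= CJ &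
  forall dx y, 0 < dx -> dx <= 1 -> dom M y ->
  [/\ zabs (jump_weight M dx y), zsum (fun l => `|jump_weight M dx y l|) <= L &
    forall (g g1 g2 : R -> R) (q : R),
      (forall x : R, is_derive x 1 g (g1 x)) ->
      (forall x : R, is_derive x 1 g1 (g2 x)) ->
      (forall x, `|g x| <= q) -> (forall x, `|g1 x| <= q) ->
      (forall x, `|g2 x| <= q) ->
      `|nonlocal M g 0 y -
        zsum (fun l => jump_weight M dx y l * (g (l%:~R * dx) - g 0))|
        <= CJ * q * dx ^+ 2]].
Proof.
have [[gv _]|ngv] := pselect (gamma_vanishes M /\ True).
  have w0 dx y l : jump_weight M dx y l = 0.
    by rewrite /jump_weight /nu_y asboolT// mul0r.
  exists 0, 0; split => // dx y dx0 dx1 Dy.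
  have -> : jump_weight M dx y = fun=> 0 by apply/funext.
  split; first exact: zabs0.
    by under eq_zsum do rewrite normr0 -(mul0r 0); rewrite (zsumZ 0 zabs0) mul0r.
  move=> g g1 g2 q dg dg1 gq g1q g2q.
  rewrite /nonlocal; under eq_Rintegral do rewrite (gv y Dy) mul0r addr0 subrr mul0r.
  rewrite Rintegral_cst//= mul0r sub0r normrN.
  under eq_zsum do rewrite mul0r -(mul0r 0).
  by rewrite (zsumZ 0 zabs0) !mul0r normr0.
have [eps eps0 heps] : exists2 eps : R, 0 < eps &
    forall y, dom M y -> eps <= `|gammaX M y|.
  by case: (gamma_dichotomy hM) => // gv; case: ngv.
have {}ngv : ~ gamma_vanishes M by move=> gv; apply: ngv.
have [N0 [N1 [N2 [N00 N10 N20 [i0 i1 i2]]]]] := levy_constants.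
have nu0 := levy_density_ge0 hM.
have inu := levy_density_integrable hM.
have inu' : (\int[mu]_x (nu x)%:E < +oo)%E by apply: le_lt_trans i0 _; rewrite ltry.
have [dn dn2 _ _] := levy_density_L1 hnu nu0 inu'.
(* The squared mesh dx^2 / |gamma|^2 turns the factors |gamma|^2, 2 |gamma|, 1 into 1, 2/|gamma|,
   1/|gamma|^2, and |gamma| >= eps. *)
pose CJ := N0 + 2 * N1 / eps + N2 / eps ^+ 2.
have CJ0 : 0 <= CJ by rewrite /CJ !addr_ge0// divr_ge0 ?mulr_ge0 ?exprn_ge0// ltW.
have CB gam : eps <= `|gam| -> (`|gam| ^+ 2 * N0 + 2 * `|gam| * N1 + N2) / `|gam| ^+ 2 <= CJ.
  move=> eg; have g0 : 0 < `|gam| by exact: lt_le_trans eg.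
  have gn0 := lt0r_neq0 g0.
  have -> : (`|gam| ^+ 2 * N0 + 2 * `|gam| * N1 + N2) / `|gam| ^+ 2 =
     N0 + 2 * N1 / `|gam| + N2 / `|gam| ^+ 2 by field.
  rewrite /CJ; apply: lerD; first rewrite lerD2l.
    by apply: ler_wpM2l; rewrite ?mulr_ge0// lef_pV2.
  apply: ler_wpM2l => //; rewrite lef_pV2 ?posrE ?exprn_gt0//.
  by apply: lerXn2r => //; rewrite nnegrE ltW.
have key dx y (g g1 g2 : R -> R) (q : R) : 0 < dx -> dom M y ->
    (forall x : R, is_derive x 1 g (g1 x)) ->
    (forall x : R, is_derive x 1 g1 (g2 x)) ->
    (forall x, `|g x| <= q) -> (forall x, `|g1 x| <= q) -> (forall x, `|g2 x| <= q) ->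
    let b (l : int) := jump_weight M dx y l * g (l%:~R * dx) in
    zabs b /\ `|\int[mu]_z (g (gammaX M y * z) * nu z) - zsum b| <=
      dx ^+ 2 / 2 * (q * CJ).
  move=> dx0 Dy dg dg1 gq g1q g2q b.
  have eg := heps y Dy; have g0 : 0 < `|gammaX M y| by exact: lt_le_trans eg.
  have gn0 : gammaX M y != 0 by rewrite -normr_gt0.
  have q0 : 0 <= q by apply: le_trans (gq 0).
  have := jump_quadrature nu0 dn dn2 inu N00 N10 N20 i0 i1 i2 gn0 dx0 dg dg1 gq g1q g2q.
  set gam := gammaX M y in eg g0 gn0 *.
  move=> /=; set a := (fun i : int => _) => -[za ea].
  have bound : (dx / `|gam|) ^+ 2 / 2 * (q * (`|gam| ^+ 2 * N0 + 2 * `|gam| * N1 + N2))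
      <= dx ^+ 2 / 2 * (q * CJ).
    have -> : (dx / `|gam|) ^+ 2 / 2 * (q * (`|gam| ^+ 2 * N0 + 2 * `|gam| * N1 + N2)) =
       dx ^+ 2 / 2 * (q * ((`|gam| ^+ 2 * N0 + 2 * `|gam| * N1 + N2) / `|gam| ^+ 2)).
      by field; exact: lt0r_neq0.
    apply: ler_wpM2l; first by rewrite divr_ge0 ?sqr_ge0.
    by apply: ler_wpM2l => //; exact: CB.
  have wE l : jump_weight M dx y l = dx / `|gam| * nu (l%:~R * dx / gam).
    by rewrite /jump_weight /nu_y asboolF// -/gam mulrAC (mulrC _ dx).
  have [gpos|gneg] := leP 0 gam.
    have ba : b = a.
      apply/funext => l; rewrite /b /a wE (ger0_norm gpos).
      have -> : l%:~R * (dx / gam) = l%:~R * dx / gam by rewrite mulrA.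
      have -> : gam * (l%:~R * dx / gam) = l%:~R * dx by field.
      ring.
    by rewrite ba; split => //; exact: le_trans ea bound.
  (* For gamma < 0 the grid point l dx is the image of the node of index -l, so the two sums differ
     by a reflection. *)
  have [za' ea'] := zsum_opp za.
  have ba : b = fun l => a (- l).
    apply/funext => l; rewrite /b /a wE (ltr0_norm gneg) rmorphN/=.
    have -> : - l%:~R * (dx / - gam) = l%:~R * dx / gam by field.
    have -> : gam * (l%:~R * dx / gam) = l%:~R * dx by field.
    ring.
  by rewrite ba; split => //; rewrite ea'; exact: le_trans ea bound.
exists (N0 + CJ), CJ; split => //; first exact: addr_ge0.
move=> dx y dx0 dx1 Dy.
have d1 (x : R) : is_derive x 1 (fun=> 1 : R) 0 by exact: is_derive_cst.
have d0 (x : R) : is_derive x 1 (fun=> 0 : R) 0 by exact: is_derive_cst.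
(* The integrand g = 1 shows that the weights are summable, with mass at most N0 + CJ when dx <=
   1. *)
have [z1 e1] := key dx y (fun=> 1) (fun=> 0) (fun=> 0) 1 dx0 Dy d1 d0
  (fun=> ltac:(by rewrite normr1)) (fun=> ltac:(by rewrite normr0)) (fun=> ltac:(by rewrite normr0)).
have zw : zabs (jump_weight M dx y).
  by apply: eq_zabs z1 => l; rewrite mulr1.
have w0 l : 0 <= jump_weight M dx y l.
  rewrite /jump_weight /nu_y asboolF// mulr_ge0 ?(ltW dx0)//.
  by rewrite mulr_ge0 ?invr_ge0.
split => //.
  under eq_zsum do rewrite ger0_norm//.
  have : zsum (fun l => jump_weight M dx y l * 1) <= \int[mu]_z (1 * nu z) + CJ.
    have : dx ^+ 2 / 2 * (1 * CJ) <= CJ.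
      rewrite mul1r; apply: ler_piMl => //.
      have : dx ^+ 2 <= 1 by apply: exprn_ile1 => //; exact: ltW.
      lra.
    by move: e1; rewrite ler_norml => /andP[h1 h2]; lra.
  under eq_zsum do rewrite mulr1; move=> h; apply: le_trans h _; rewrite lerD2r.
  under eq_Rintegral do rewrite mul1r.
  rewrite -lee_fin /Rintegral fineK//; exact: integrable_fin_num.
move=> g g1 g2 q dg dg1 gq g1q g2q.
(* Subtracting g 0 doubles the sup bound; this 2 cancels the 1/2 of the midpoint rule. *)
pose gg x := g x - g 0.
have q0 : 0 <= q by apply: le_trans (gq 0).
have dgg (x : R) : is_derive x 1 gg (g1 x).
  have -> : gg = g - cst (g 0) by [].
  by apply: is_derive_eq; rewrite subr0.
have [_ e2] := key dx y gg g1 g2 (2 * q) dx0 Dy dgg dg1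
  (fun x => ltac:(by apply: le_trans (ler_normB _ _) _; rewrite mulr_natl mulr2n lerD))
  (fun x => ltac:(by apply: le_trans (g1q x) _; lra))
  (fun x => ltac:(by apply: le_trans (g2q x) _; lra)).
rewrite /nonlocal; under eq_Rintegral do rewrite add0r.
by apply: le_trans e2 _; rewrite le_eqVlt; apply/orP; left; apply/eqP; field.
Qed.

End jumps.

(** * Consistency *)

Section scalar_consistency.
Context {R : realType}.
Local Notation mu := lebesgue_measure.

(** [jump_part] is linear and of norm at most 2 L in sup norm. The bound [B0] serves the convergence
    of the three separate series and does not enter the estimate. *)
Lemma jump_part_linear_le (k v v1 v2 : int -> R) (s B B0 L : R) (i : int) :
  zabs k -> zsum (fun l => `|k l|) <= L ->
  (forall j, `|v j| <= B0) -> (forall j, `|v1 j| <= B0) -> (forall j, `|v2 j| <= B0) ->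
  (forall j, `|v j - v1 j - s * v2 j| <= B) ->
  `|jump_part k v i - jump_part k v1 i - s * jump_part k v2 i| <= 2 * L * B.
Proof.
move=> hk kL vB v1B v2B vvB.
have B0' : 0 <= B by apply: le_trans (vvB 0).
have zb w : (forall j, `|w j| <= B0) -> zabs (fun l => k l * (w (i + l) - w i)).
  move=> wB; apply: (@zabs_le _ _ (fun l => (2 * B0) * `|k l|)).
    move=> l; rewrite normrM mulrC; apply: ler_wpM2r => //.
    by apply: le_trans (ler_normB _ _) _; rewrite mulr_natl mulr2n lerD.
  by apply: zabsZ; exact: zabs_norm.
have z0 := zb _ vB; have z1 := zb _ v1B; have z2 := zb _ v2B.
pose a w l := k l * (w (i + l) - w i).
pose b l := (a v l + (-1) * a v1 l) + (- s) * a v2 l.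
have zbb : zabs b by apply: zabsD; [apply: zabsD => //|]; exact: zabsZ.
have -> : jump_part k v i - jump_part k v1 i - s * jump_part k v2 i = zsum b.
  rewrite /b zsumD; [|by apply: zabsD => //; exact: zabsZ|exact: zabsZ].
  rewrite (@zsumD _ (a v) (fun l => -1 * a v1 l))//; last exact: zabsZ.
  by rewrite !zsumZ// mulN1r mulNr.
apply: le_trans (ler_norm_zsum zbb) _.
apply: (@le_trans _ _ (zsum (fun l => 2 * B * `|k l|))).
  apply: ler_zsum; [exact: zabs_norm|by apply: zabsZ; exact: zabs_norm|].
  move=> l; rewrite (_ : b l = k l * ((v (i + l) - v1 (i + l) - s * v2 (i + l))
     - (v i - v1 i - s * v2 i))); last by rewrite /b /a; ring.
  rewrite normrM mulrC; apply: ler_wpM2r => //.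
  by apply: le_trans (ler_normB _ _) _; rewrite mulr_natl mulr2n lerD.
rewrite zsumZ; last exact: zabs_norm.
by rewrite mulrAC; apply: ler_wpM2r => //; apply: ler_wpM2l.
Qed.

Lemma jump_part_le (k v : int -> R) (B L : R) (i : int) :
  zabs k -> zsum (fun l => `|k l|) <= L -> (forall j, `|v j| <= B) ->
  `|jump_part k v i| <= 2 * L * B.
Proof.
move=> hk kL vB.
have B0 : 0 <= B by apply: le_trans (vB 0).
have := @jump_part_linear_le k v (fun=> 0) (fun=> 0) 0 B B L i hk kL vB.
rewrite {2}/jump_part; under eq_zsum do rewrite subrr mulr0 -(mul0r 0).
rewrite (zsumZ 0 zabs0) !mul0r !subr0; apply.
- by move=> j; rewrite normr0.
- by move=> j; rewrite normr0.
- by move=> j; rewrite !subr0.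
Qed.

(** * Consistency of one step for a scalar solution *)

Section at_time.
Variables (M : jump_model R) (Q : R -> R)
  (W : nat -> nat -> nat -> R -> R -> R -> R) (WT : R -> R -> R) (L CJ : R).
Hypotheses (hM : model_hypotheses M) (hW : scalar_sol M Q W WT)
  (Q0 : forall y, 0 <= Q y)
  (Qb : forall y z s, between y z s -> Q s <= Q y + Q z).
Variables (t h dx y : R) (nxt : R -> R -> R).
Hypotheses (t0 : 0 <= t) (h0 : 0 < h) (thT : t + h <= horizon M)
  (dx0 : 0 < dx) (dx1 : dx <= 1) (Dy : dom M y).
Hypothesis hnxt : forall x z, dom M z ->
  nxt x z = if t + h < horizon M then W 0%N 0%N 0%N (t + h) x z else WT x z.
Hypotheses (hk : zabs (jump_weight M dx y))
  (kL : zsum (fun l => `|jump_weight M dx y l|) <= L).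
Hypothesis hJ : forall (g g1 g2 : R -> R) (q : R),
      (forall x : R, is_derive x 1 g (g1 x)) ->
      (forall x : R, is_derive x 1 g1 (g2 x)) ->
      (forall x, `|g x| <= q) -> (forall x, `|g1 x| <= q) ->
      (forall x, `|g2 x| <= q) ->
      `|nonlocal M g 0 y -
        zsum (fun l => jump_weight M dx y l * (g (l%:~R * dx) - g 0))|
        <= CJ * q * dx ^+ 2.

Let tT : 0 <= t < horizon M. Proof. by have := h0; have := thT => *; rewrite t0/=; lra. Qed.
Let iD : is_interval (dom M).
Proof. exact: domain_is_interval (dom_convex hM). Qed.

Lemma next_time_le x z : dom M z ->
  `|nxt x z - W 0%N 0%N 0%N t x z - h * W 1%N 0%N 0%N t x z| <= h ^+ 2 * Q z.
Proof.
move=> Dz.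
have iI : is_interval (`[0, horizon M[%classic : set R).
  exact: interval_is_interval.
have It s : 0 <= s < horizon M -> `[0, horizon M[%classic s by rewrite /= in_itv.
have tay s : t < s -> s < horizon M -> `|W 0%N 0%N 0%N s x z - W 0%N 0%N 0%N t x z
    - W 1%N 0%N 0%N t x z * (s - t)| <= Q z * (s - t) ^+ 2.
  move=> ts sT; have Is : 0 <= s < horizon M by rewrite sT (le_trans t0 (ltW ts)).
  apply: (@taylor2 _ _ (fun r => W 0%N 0%N 0%N r x z) (fun r => W 1%N 0%N 0%N r x z)
    (fun r => W 2%N 0%N 0%N r x z) _ _ _ iI (It t tT) (It s Is)) => //.
  - by move=> r; rewrite /= in_itv/= => hr; exact: (ss_t hW).
  - by move=> r; rewrite /= in_itv/= => hr; exact: (ss_t hW).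
  - move=> r [] /andP[r1 r2]; last by lra.
    by apply: (ss_bound hW) => //; rewrite (le_trans t0 r1) (le_lt_trans r2 sT).
rewrite hnxt// [h * _]mulrC [_ * Q z]mulrC; case: ifPn => thT'.
  have E : t + h - t = h by rewrite addrAC subrr add0r.
  by have := tay (t + h); rewrite E; apply => //; rewrite ltrDl.
have {thT'}thT' : t + h = horizon M by apply/eqP; rewrite eq_le thT leNgt.
have c1 : `|W 0%N 0%N 0%N s x z - W 0%N 0%N 0%N t x z - W 1%N 0%N 0%N t x z * (s - t)|
    @[s --> (horizon M)^'-] --> `|WT x z - W 0%N 0%N 0%N t x z - W 1%N 0%N 0%N t x z * h|.
  apply: cvg_norm; apply: cvgB.
    by apply: cvgB; [exact: (ss_T hW)|exact: cvg_cst].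
  apply: cvgMr; have -> : h = horizon M - t by lra.
  apply: cvgB; last exact: cvg_cst.
  exact: cvg_at_left_filter.
have c2 : Q z * (s - t) ^+ 2 @[s --> (horizon M)^'-] --> Q z * h ^+ 2.
  apply: cvgMr; have -> : h = horizon M - t by lra.
  have c0 : s - t @[s --> (horizon M)^'-] --> horizon M - t.
    by apply: cvgB; [exact: cvg_at_left_filter|exact: cvg_cst].
  by rewrite expr2; under eq_fun do rewrite expr2; exact: cvgM.
apply: ler_cvg_to c1 c2 _; near=> s; apply: tay.
  by near: s; apply: nbhs_left_gt; case/andP: tT.
by near: s; exact: nbhs_left_lt.
Unshelve. all: by end_near. Qed.

Lemma space_taylor4_le x z : dom M z ->
  `|W 0%N 0%N 0%N t x z - W 0%N 0%N 0%N t x y - W 0%N 0%N 1%N t x y * (z - y)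
    - W 0%N 0%N 2%N t x y / 2 * (z - y) ^+ 2
    - W 0%N 0%N 3%N t x y / 6 * (z - y) ^+ 3| <= (Q y + Q z) * (z - y) ^+ 4.
Proof.
move=> Dz.
apply: (@taylor4 _ _ (W 0%N 0%N 0%N t x) (W 0%N 0%N 1%N t x) (W 0%N 0%N 2%N t x)
   (W 0%N 0%N 3%N t x) (W 0%N 0%N 4%N t x) _ _ _ iD Dy Dz).
- by move=> r Dr; exact: (ss_y hW).
- by move=> r Dr; exact: (ss_y hW).
- by move=> r Dr; exact: (ss_y hW).
- by move=> r Dr; exact: (ss_y hW).
- move=> s bs; apply: le_trans (Qb bs); apply: (ss_bound hW) => //.
  by case: bs => bs; [exact: iD Dy Dz _ bs|exact: iD Dz Dy _ bs].
- by rewrite addr_ge0.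
Qed.

Lemma space_taylor2_le (k : nat) x z : (k <= 1)%N -> dom M z ->
  `|W k 0%N 0%N t x z - W k 0%N 0%N t x y - W k 0%N 1%N t x y * (z - y)|
    <= (Q y + Q z) * (z - y) ^+ 2.
Proof.
move=> k1 Dz.
apply: (@taylor2 _ _ (W k 0%N 0%N t x) (W k 0%N 1%N t x) (W k 0%N 2%N t x)
   _ _ _ iD Dy Dz).
- by move=> r Dr; apply: (ss_y hW) => //; lia.
- by move=> r Dr; apply: (ss_y hW) => //; lia.
- move=> s bs; apply: le_trans (Qb bs); apply: (ss_bound hW) => //; first lia.
  by case: bs => bs; [exact: iD Dy Dz _ bs|exact: iD Dz Dy _ bs].
- by rewrite addr_ge0.
Qed.

Local Notation k := (jump_weight M dx y).
Let onx (g : R -> R) (l : int) : R := g (l%:~R * dx).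

(** The explicit operator applied to the next layer, at x = 0 only: the other grid points are
    already absorbed in the weighted translates. *)
Definition next_mean z : R :=
  nxt 0 z + h * jump_part k (onx (nxt ^~ z)) 0.

(** Degree 3 in z - y matches the three conditional moments controlled by H1. Terms carrying a
    factor h are expanded to first order only, since h (z - y)^2 <= h^2 + (z - y)^4 already counts
    as remainder. *)
Definition expansion z : R :=
  (W 0%N 0%N 0%N t 0 y + h * W 1%N 0%N 0%N t 0 y
     + h * jump_part k (onx (W 0%N 0%N 0%N t ^~ y)) 0)
  + (W 0%N 0%N 1%N t 0 y + h * W 1%N 0%N 1%N t 0 y
     + h * jump_part k (onx (W 0%N 0%N 1%N t ^~ y)) 0) * (z - y)
  + W 0%N 0%N 2%N t 0 y / 2 * (z - y) ^+ 2
  + W 0%N 0%N 3%N t 0 y / 6 * (z - y) ^+ 3.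

(** Q y + Q z dominates the derivatives at all intermediate points; the terms h^2 and (z - y)^4 are
    of the same size when z - y is of order sqrt h. *)
Definition remainder_bound z : R := (Q y + Q z) * (h ^+ 2 + (z - y) ^+ 4).

Lemma expansion_le z : dom M z ->
  `|next_mean z - expansion z| <= 2 * (1 + 2 * L * (horizon M + 1)) * remainder_bound z.
Proof.
have h0' := h0.
move=> Dz; have hT : h <= horizon M by rewrite (le_trans _ thT)// lerDr.
have L0 : 0 <= L by apply: le_trans kL; apply: zsum_ge0 => //; exact: zabs_norm.
set s := z - y; set qq := Q y + Q z.
have qz : Q z <= qq by rewrite lerDr.
have q0 : 0 <= qq by rewrite addr_ge0.
have n1 := next_time_le 0 Dz; have n2 := space_taylor4_le 0 Dz.
have n3 := @space_taylor2_le 1 0 z isT Dz.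
rewrite -/s -/qq in n2 n3.
have n1' : `|nxt 0 z - W 0%N 0%N 0%N t 0 z - h * W 1%N 0%N 0%N t 0 z| <= h ^+ 2 * qq.
  by apply: le_trans n1 _; rewrite ler_wpM2l ?sqr_ge0.
have hT1 : 0 <= horizon M by exact: le_trans (ltW h0) hT.
have b0 m l x : (m + l <= 5)%N -> `|W 0%N m l t x y| <= Q y.
  by move=> ml; apply: (ss_bound hW) => //; lia.
(* A crude bound, uniform in x, used only for the convergence of the jump series. *)
have nb x : `|nxt x z| <= qq * (2 + h + h ^+ 2 ).
  have := next_time_le x Dz.
  have w0 : `|W 0%N 0%N 0%N t x z| <= Q z by exact: (ss_bound hW).
  have w1 : `|W 1%N 0%N 0%N t x z| <= Q z by exact: (ss_bound hW).
  move=> nn.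
  have -> : nxt x z = (nxt x z - W 0%N 0%N 0%N t x z - h * W 1%N 0%N 0%N t x z) +
    W 0%N 0%N 0%N t x z + h * W 1%N 0%N 0%N t x z by ring.
  apply: le_trans (ler_normD _ _) _; apply: le_trans (lerD (ler_normD _ _) (lexx _)) _.
  rewrite normrM (gtr0_norm h0).
  have : h * `|W 1%N 0%N 0%N t x z| <= h * qq by rewrite ler_pM2l//; lra.
  have : h ^+ 2 * Q z <= h ^+ 2 * qq by rewrite ler_wpM2l ?sqr_ge0.
  lra.
have B0ge : Q y <= qq * (2 + h + h ^+ 2).
  have : 0 <= qq * h by rewrite mulr_ge0// ltW.
  have : 0 <= qq * h ^+ 2 by rewrite mulr_ge0 ?sqr_ge0.
  have : Q y <= qq by rewrite lerDl.
  lra.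
have n4 : `|jump_part k (onx (nxt ^~ z)) 0 - jump_part k (onx (W 0%N 0%N 0%N t ^~ y)) 0
     - s * jump_part k (onx (W 0%N 0%N 1%N t ^~ y)) 0| <=
    2 * L * (qq * (h ^+ 2 + h + s ^+ 2)).
  apply: (@jump_part_linear_le _ _ _ _ _ _ (qq * (2 + h + h ^+ 2))) => //.
  - by move=> j; exact: nb.
  - by move=> j; apply: le_trans (b0 _ _ _ _) _.
  - by move=> j; apply: le_trans (b0 _ _ _ _) _.
  move=> j; rewrite /onx; set x := j%:~R * dx.
  have m1 := next_time_le x Dz.
  have m2 := @space_taylor2_le 0 x z isT Dz; rewrite -/s -/qq in m2.
  have w1 : `|W 1%N 0%N 0%N t x z| <= Q z by exact: (ss_bound hW).
  have -> : nxt x z - W 0%N 0%N 0%N t x y - s * W 0%N 0%N 1%N t x y =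
    (nxt x z - W 0%N 0%N 0%N t x z - h * W 1%N 0%N 0%N t x z)
    + (W 0%N 0%N 0%N t x z - W 0%N 0%N 0%N t x y - W 0%N 0%N 1%N t x y * s)
    + h * W 1%N 0%N 0%N t x z by ring.
  apply: le_trans (ler_normD _ _) _; apply: le_trans (lerD (ler_normD _ _) (lexx _)) _.
  rewrite normrM (gtr0_norm h0).
  have : h * `|W 1%N 0%N 0%N t x z| <= h * qq by rewrite ler_pM2l//; lra.
  have : h ^+ 2 * Q z <= h ^+ 2 * qq by rewrite ler_wpM2l ?sqr_ge0.
  lra.
rewrite /next_mean /expansion -/s.
rewrite (_ : _ - _ =
  (nxt 0 z - W 0%N 0%N 0%N t 0 z - h * W 1%N 0%N 0%N t 0 z)
  + (W 0%N 0%N 0%N t 0 z - W 0%N 0%N 0%N t 0 y - W 0%N 0%N 1%N t 0 y * s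
    - W 0%N 0%N 2%N t 0 y / 2 * s ^+ 2 - W 0%N 0%N 3%N t 0 y / 6 * s ^+ 3)
  + h * (W 1%N 0%N 0%N t 0 z - W 1%N 0%N 0%N t 0 y - W 1%N 0%N 1%N t 0 y * s)
  + h * (jump_part k (onx (nxt ^~ z)) 0 - jump_part k (onx (W 0%N 0%N 0%N t ^~ y)) 0
     - s * jump_part k (onx (W 0%N 0%N 1%N t ^~ y)) 0)); last by ring.
apply: le_trans (ler_normD _ _) _.
apply: le_trans (lerD (ler_normD _ _) (lexx _)) _.
apply: le_trans (lerD (lerD (ler_normD _ _) (lexx _)) (lexx _)) _.
rewrite !normrM (gtr0_norm h0).
have n3' : h * `|W 1%N 0%N 0%N t 0 z - W 1%N 0%N 0%N t 0 y - W 1%N 0%N 1%N t 0 y * s|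
   <= h * (qq * s ^+ 2) by rewrite ler_pM2l.
have n4' := ler_wpM2l (ltW h0) n4.
apply: le_trans (lerD (lerD (lerD n1' n2) n3') n4') _.
rewrite /remainder_bound -/s -/qq.
have s4 : s ^+ 4 = (s ^+ 2) ^+ 2 by rewrite -exprM.
(* The mixed term from expanding the time derivative in space, absorbed through (h - s^2)^2 >= 0. *)
have e1 : h * s ^+ 2 <= h ^+ 2 + s ^+ 4.
  have := sqr_ge0 (h - s ^+ 2); rewrite sqrrB s4.
  have := sqr_ge0 h; have := sqr_ge0 (s ^+ 2); lra.
have s40 : 0 <= s ^+ 4 by rewrite s4 sqr_ge0.
have h20 : 0 <= h ^+ 2 by exact: sqr_ge0.
have e2 : h * (h ^+ 2 + h + s ^+ 2) <= 2 * ((horizon M + 1) * (h ^+ 2 + s ^+ 4)).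
  have h3 : h * h ^+ 2 <= horizon M * h ^+ 2 by rewrite ler_wpM2r.
  have h4 : 0 <= horizon M * s ^+ 4 by rewrite mulr_ge0.
  have h5 : 0 <= horizon M * h ^+ 2 by rewrite mulr_ge0.
  have : h * h = h ^+ 2 by [].
  lra.
have E1 : qq * (h * s ^+ 2) <= qq * (h ^+ 2 + s ^+ 4) by rewrite ler_wpM2l.
have LQ0 : 0 <= 2 * L * qq by rewrite !mulr_ge0.
have E2 := ler_wpM2l LQ0 e2.
have -> : h ^+ 2 * qq + qq * s ^+ 4 + h * (qq * s ^+ 2) +
    h * (2 * L * (qq * (h ^+ 2 + h + s ^+ 2))) =
  qq * (h ^+ 2 + s ^+ 4) + qq * (h * s ^+ 2) +
  2 * L * qq * (h * (h ^+ 2 + h + s ^+ 2)) by ring.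
apply: le_trans (lerD (lerD (lexx _) E1) E2) _.
rewrite le_eqVlt; apply/orP; left; apply/eqP; ring.
Qed.

(** Fourth-order Taylor at 0 evaluated at dx and -dx: even and odd terms separate, so the centered
    quotients for the first and second x-derivatives both have error of order dx^2. *)
Lemma implicit_part_le :
  `|tri_A M h dx y (onx (W 0%N 0%N 0%N t ^~ y)) 0 - W 0%N 0%N 0%N t 0 y
    + h * (muX M y * W 0%N 1%N 0%N t 0 y
           + 2^-1 * sigmaX M y ^+ 2 * W 0%N 2%N 0%N t 0 y)|
  <= 2 * (h * dx ^+ 2 * Q y * (`|muX M y| + sigmaX M y ^+ 2)).
Proof.
have h0' := h0; have dx0' := dx0; have dx1' := dx1.
pose g x := W 0%N 0%N 0%N t x y.
pose g1 x := W 0%N 1%N 0%N t x y; pose g2 x := W 0%N 2%N 0%N t x y.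
pose g3 x := W 0%N 3%N 0%N t x y; pose g4 x := W 0%N 4%N 0%N t x y.
have tay z : `|g z - g 0 - g1 0 * z - g2 0 / 2 * z ^+ 2 - g3 0 / 6 * z ^+ 3|
    <= Q y * z ^+ 4.
  have iT : is_interval [set: R] by [].
  have := @taylor4 _ _ g g1 g2 g3 g4 0 z (Q y) iT I I; rewrite subr0; apply => //.
  - by move=> r _; apply: is_derive_on; exact: (ss_x hW).
  - by move=> r _; apply: is_derive_on; exact: (ss_x hW).
  - by move=> r _; apply: is_derive_on; exact: (ss_x hW).
  - by move=> r _; apply: is_derive_on; exact: (ss_x hW).
  - by move=> s _; exact: (ss_bound hW).
have b3 : `|g3 0| <= Q y by exact: (ss_bound hW).
rewrite /tri_A /tri /onx mul0r sub0r add0r mulN1r mul1r.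
rewrite -/(g (- dx)) -/(g dx) -/(g 0) -/(g1 0) -/(g2 0).
have tp := tay dx; have tm := tay (- dx).
set rp := g dx - _ - _ - _ - _ in tp; set rm := g (- dx) - _ - _ - _ - _ in tm.
have dn0 : dx != 0 by exact: lt0r_neq0.
(* (g(dx) - g(-dx)) / dx = 2 g1(0) + e1, and below (g(dx) - 2 g(0) + g(-dx)) / dx^2 = g2(0) + e2. *)
pose e1 := (g3 0 / 3 * dx ^+ 3 + rp - rm) / dx.
pose e2 := (rp + rm) / dx ^+ 2.
rewrite [X in `|X|](_ : _ = - (h / 2 * muX M y * e1) - (h / 2 * sigmaX M y ^+ 2 * e2));
  last first.
  rewrite /mx_alpha /mx_beta /e1 /e2 /rp /rm; field; exact: dn0.
have q0 := Q0 y.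
have d40 : 0 <= dx ^+ 4 by rewrite (exprM _ 2 2) sqr_ge0.
have d20 : 0 <= dx ^+ 2 by exact: sqr_ge0.
have tm' : `|rm| <= Q y * dx ^+ 4 by move: tm; rewrite (exprM (- dx) 2 2) sqrrN -exprM.
have qd : 0 <= Q y * dx ^+ 2 by rewrite mulr_ge0.
have E1 : `|e1| <= 3 * (Q y * dx ^+ 2).
  rewrite /e1 normrM normfV (gtr0_norm dx0) ler_pdivrMr//.
  apply: le_trans (ler_normB _ _) _; apply: le_trans (lerD (ler_normD _ _) (lexx _)) _.
  rewrite normrM [`|g3 0 / 3|]normrM normfV normr_nat normrX (gtr0_norm dx0).
  have h1 : `|g3 0| / 3 * dx ^+ 3 <= Q y / 3 * dx ^+ 3.
    by apply: ler_wpM2r; [exact: exprn_ge0 (ltW dx0)|lra].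
  have h2 : Q y * dx ^+ 4 <= Q y * dx ^+ 2 * dx.
    rewrite -mulrA -exprSr; apply: ler_wpM2l => //.
    by rewrite exprSr ler_piMr// exprn_ge0// ltW.
  have h3 : Q y / 3 * dx ^+ 3 = (Q y * dx ^+ 2 * dx) / 3 by rewrite [dx ^+ 3]exprSr; field.
  have h4 : 0 <= Q y * dx ^+ 2 * dx by rewrite mulr_ge0// ltW.
  lra.
have E2 : `|e2| <= 2 * (Q y * dx ^+ 2).
  rewrite /e2 normrM normfV (ger0_norm d20) ler_pdivrMr ?exprn_gt0//.
  apply: le_trans (ler_normD _ _) _.
  have -> : 2 * (Q y * dx ^+ 2) * dx ^+ 2 = Q y * dx ^+ 4 + Q y * dx ^+ 4 by ring.
  exact: lerD.
move: E1 E2; move: e1 e2 => e1 e2 E1 E2.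
have h2 : 0 <= h / 2 by rewrite divr_ge0// ltW.
have n1 : `|h / 2 * muX M y| = h / 2 * `|muX M y| by rewrite normrM ger0_norm.
have n2 : `|h / 2 * sigmaX M y ^+ 2| = h / 2 * sigmaX M y ^+ 2.
  by rewrite ger0_norm// mulr_ge0// sqr_ge0.
apply: le_trans (ler_normB _ _) _.
rewrite normrN [`|_ * e1|]normrM [`|_ * e2|]normrM n1 n2.
have F1 := ler_wpM2l (mulr_ge0 (divr_ge0 (ltW h0) (ler0n _ 2)) (normr_ge0 (muX M y))) E1.
have F2 := ler_wpM2l (mulr_ge0 (divr_ge0 (ltW h0) (ler0n _ 2)) (sqr_ge0 (sigmaX M y))) E2.
apply: le_trans (lerD F1 F2) _.
have p1 : 0 <= h * dx ^+ 2 * Q y * `|muX M y| by rewrite !mulr_ge0// ltW.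
have p2 : 0 <= h * dx ^+ 2 * Q y * sigmaX M y ^+ 2.
  by apply: mulr_ge0; [rewrite !mulr_ge0// ltW|exact: sqr_ge0].
lra.
Qed.

(** In order: the remainder of the expansion, the jump quadrature, the centered differences, and the
    products of h with the mean increment of the chain. *)
Definition consistency_const : R :=
  2 * (1 + 2 * L * (horizon M + 1)) + CJ + 2 + (1 + 2 * L) * (horizon M + 1).

(** The implicit matrix, acting at time t, contributes -h times the x-part of the generator; the
    integrated expansion contributes h times the time derivative and jump term, plus the moments
    times y-derivatives. The equation cancels the terms of order h; what remains is the quadrature,
    difference, moment and remainder errors. *)
Lemma scalar_consistency (kap : {measure set R -> \bar R}) (S : set R)
    (fh gh jh : R) : 0 <= CJ ->
  measurable S -> S `<=` dom M -> kap S = 1%E ->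
  kap.-integrable S (EFin \o (fun z => z - y)) ->
  kap.-integrable S (EFin \o (fun z => (z - y) ^+ 2)) ->
  kap.-integrable S (EFin \o (fun z => (z - y) ^+ 3)) ->
  kap.-integrable S (EFin \o remainder_bound) ->
  measurable_fun S next_mean ->
  \int[kap]_(z in S) (z - y) = muY M y * h + fh ->
  \int[kap]_(z in S) ((z - y) ^+ 2) = sigmaY M y ^+ 2 * h + gh ->
  \int[kap]_(z in S) ((z - y) ^+ 3) = jh ->
  `|tri_A M h dx y (onx (W 0%N 0%N 0%N t ^~ y)) 0
     - \int[kap]_(z in S) next_mean z|
  <= consistency_const * (Q y * (h * dx ^+ 2 * (1 + `|muX M y| + sigmaX M y ^+ 2)
        + `|fh| + `|gh| + `|jh| + h ^+ 2 * `|muY M y|)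
      + \int[kap]_(z in S) remainder_bound z).
Proof.
move=> CJ0 mS SD kS i1 i2 i3 ir mF e1 e2 e3.
have h0' := h0; have dx0' := dx0; have thT' := thT; have t0' := t0.
have hT : h <= horizon M by lra.
have L0 : 0 <= L by apply: le_trans kL; apply: zsum_ge0 => //; exact: zabs_norm.
pose c0 := W 0%N 0%N 0%N t 0 y + h * W 1%N 0%N 0%N t 0 y
     + h * jump_part k (onx (W 0%N 0%N 0%N t ^~ y)) 0.
pose c1 := W 0%N 0%N 1%N t 0 y + h * W 1%N 0%N 1%N t 0 y
     + h * jump_part k (onx (W 0%N 0%N 1%N t ^~ y)) 0.
pose c2 := W 0%N 0%N 2%N t 0 y / 2; pose c3 := W 0%N 0%N 3%N t 0 y / 6.
have i0 : kap.-integrable S (EFin \o (fun=> c0)).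
  by apply: measurable_bounded_integrable => //; [rewrite kS ltry|exact: bounded_cst].
have iZ (g : R -> R) (c : R) : kap.-integrable S (EFin \o g) ->
    kap.-integrable S (EFin \o (fun z => c * g z)).
  by move=> ig; apply: eq_integrable (integrableZl mS c ig).
have iD2 (g g' : R -> R) : kap.-integrable S (EFin \o g) ->
    kap.-integrable S (EFin \o g') -> kap.-integrable S (EFin \o (fun z => g z + g' z)).
  by move=> ig ig'; apply: eq_integrable (integrableD mS ig ig').
have z1 := iZ _ c1 i1; have z2 := iZ _ c2 i2; have z3 := iZ _ c3 i3.
have iA1 := iD2 _ _ i0 z1; have iA2 := iD2 _ _ iA1 z2.
have iE : kap.-integrable S (EFin \o expansion) by exact: iD2 _ _ iA2 z3.
have IE : \int[kap]_(z in S) expansion z = c0 + c1 * (muY M y * h + fh)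
    + c2 * (sigmaY M y ^+ 2 * h + gh) + c3 * jh.
  rewrite -e1 -e2 -e3 -!RintegralZl// /expansion -/c0 -/c1 -/c2 -/c3.
  rewrite RintegralD// RintegralD// RintegralD//.
  by rewrite Rintegral_cst// kS mulr1.
pose K1 := 2 * (1 + 2 * L * (horizon M + 1)).
have K10 : 0 <= K1 by rewrite /K1 !(mulr_ge0, addr_ge0)//; lra.
have rb0 z : 0 <= remainder_bound z.
  rewrite mulr_ge0// addr_ge0 ?Q0 ?sqr_ge0//.
  by rewrite (exprM _ 2 2) sqr_ge0.
(* [next_mean] is dominated by its expansion, a cubic with integrable moments, plus the integrable
   remainder. *)
have iF : kap.-integrable S (EFin \o next_mean).
  apply: (@le_integrable _ _ _ kap _ mS _
    (EFin \o (fun z => `|expansion z| + K1 * remainder_bound z))).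
  - exact/measurable_EFinP.
  - move=> z Sz; rewrite /= lee_fin [leRHS]ger0_norm; last first.
      by rewrite addr_ge0// mulr_ge0.
    have := expansion_le (SD _ Sz).
    rewrite (_ : next_mean z = expansion z + (next_mean z - expansion z)); last by ring.
    move=> hh; apply: le_trans (ler_normD _ _) _; rewrite lerD2l.
    by move: hh; rewrite [expansion z + _]addrC subrK.
  - by apply: iD2; [exact: integrable_norm|exact: iZ].
have IF : `|\int[kap]_(z in S) next_mean z - \int[kap]_(z in S) expansion z|
    <= K1 * \int[kap]_(z in S) remainder_bound z.
  rewrite -RintegralB// -RintegralZl//.
  have iFE : kap.-integrable S (EFin \o (fun z => next_mean z - expansion z)).
    by apply: eq_integrable (integrableB mS iF iE).
  apply: le_trans (le_normr_Rintegral mS iFE) _.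
  apply: le_Rintegral => //; [exact: integrable_norm|exact: iZ|].
  by move=> z Sz; exact: expansion_le (SD _ Sz).
have b m l k' x : (2 * k' + m + l <= 5)%N -> `|W k' m l t x y| <= Q y.
  by move=> ml; exact: (ss_bound hW).
have E5 : `|nonlocal M (W 0%N 0%N 0%N t ^~ y) 0 y
     - jump_part k (onx (W 0%N 0%N 0%N t ^~ y)) 0| <= CJ * Q y * dx ^+ 2.
  have := hJ (g := W 0%N 0%N 0%N t ^~ y) (g1 := W 0%N 1%N 0%N t ^~ y)
     (g2 := W 0%N 2%N 0%N t ^~ y) (q := Q y).
  rewrite /jump_part /onx; under [in X in _ -> X]eq_zsum do rewrite add0r.
  rewrite mul0r; apply.
  - by move=> x; exact: (ss_x hW).
  - by move=> x; exact: (ss_x hW).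
  - by move=> x; exact: b.
  - by move=> x; exact: b.
  - by move=> x; exact: b.
have E4 := implicit_part_le.
have J1 : `|jump_part k (onx (W 0%N 0%N 1%N t ^~ y)) 0| <= 2 * L * Q y.
  by apply: jump_part_le => // j; exact: b.
have := ss_pide hW 0 tT Dy; rewrite /partials_eq => pde.
set I := \int[kap]_(z in S) next_mean z in IF *.
set RB := \int[kap]_(z in S) remainder_bound z in IF *.
have RB0 : 0 <= RB by exact: Rintegral_ge0.
set A0 := tri_A _ _ _ _ _ _ in E4 *.
rewrite IE /c0 /c1 /c2 /c3 in IF.
set w1 := W 1%N 0%N 0%N t 0 y in pde IF *.
set J0 := jump_part k (onx (W 0%N 0%N 0%N t ^~ y)) 0 in E5 IF *.
set J01 := jump_part _ _ _ in J1 IF *.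
set NL := nonlocal _ _ _ _ in pde E5 *.
set w := W 0%N 0%N 0%N t 0 y in E4 IF *.
set m := W 0%N 0%N 1%N t 0 y in pde IF *.
set w2 := W 0%N 0%N 2%N t 0 y in pde IF *.
set w3 := W 0%N 0%N 3%N t 0 y in IF *.
set wx := W 0%N 1%N 0%N t 0 y in pde E4 *.
set wxx := W 0%N 2%N 0%N t 0 y in pde E4 *.
set w11 := W 1%N 0%N 1%N t 0 y in IF *.
(* Exact error identity once w1, the time derivative, is eliminated through the equation; each
   summand is then bounded separately. *)
have key : A0 - I = (A0 - w + h * (muX M y * wx + 2^-1 * sigmaX M y ^+ 2 * wxx))
   + h * (NL - J0) - m * fh - w2 / 2 * gh - w3 / 6 * jh
   - h * (w11 + J01) * (muY M y * h + fh)
   - (I - ((w + h * w1 + h * J0) + (m + h * w11 + h * J01) * (muY M y * h + fh)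
           + w2 / 2 * (sigmaY M y ^+ 2 * h + gh) + w3 / 6 * jh)).
  have pde' : w1 = - (2^-1 * sigmaX M y ^+ 2 * wxx + 2^-1 * sigmaY M y ^+ 2 * w2
     + muX M y * wx + muY M y * m + NL) by apply/eqP; rewrite -addr_eq0; apply/eqP.
  by rewrite pde'; field.
rewrite key.
have q0 := Q0 y.
have T1 : `|h * (NL - J0)| <= h * dx ^+ 2 * Q y * CJ.
  rewrite normrM (gtr0_norm h0); apply: le_trans (ler_wpM2l (ltW h0) E5) _.
  by rewrite le_eqVlt; apply/orP; left; apply/eqP; ring.
have T2 : `|m * fh| <= Q y * `|fh| by rewrite normrM; apply: ler_wpM2r => //; exact: b.
have T3 : `|w2 / 2 * gh| <= Q y * `|gh|.
  rewrite normrM; apply: ler_wpM2r => //; rewrite normrM normfV normr_nat.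
  by have := b 0%N 2%N 0%N 0 isT; rewrite -/w2; have := normr_ge0 w2; lra.
have T4 : `|w3 / 6 * jh| <= Q y * `|jh|.
  rewrite normrM; apply: ler_wpM2r => //; rewrite normrM normfV normr_nat.
  by have := b 0%N 3%N 0%N 0 isT; rewrite -/w3; have := normr_ge0 w3; lra.
have T5 : `|h * (w11 + J01) * (muY M y * h + fh)| <=
    (1 + 2 * L) * (Q y * (h ^+ 2 * `|muY M y|) + horizon M * (Q y * `|fh|)).
  have s1 : `|w11 + J01| <= (1 + 2 * L) * Q y.
    apply: le_trans (ler_normD _ _) _; rewrite mulrDl mul1r; apply: lerD => //.
    exact: b.
  have s2 : `|muY M y * h + fh| <= h * `|muY M y| + `|fh|.
    apply: le_trans (ler_normD _ _) _; rewrite lerD2r normrM (gtr0_norm h0).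
    by rewrite mulrC.
  have c0' : 0 <= (1 + 2 * L) * Q y by rewrite mulr_ge0// addr_ge0// mulr_ge0.
  rewrite !normrM (gtr0_norm h0) -mulrA.
  apply: (@le_trans _ _ (h * ((1 + 2 * L) * Q y * (h * `|muY M y| + `|fh|)))).
    by apply: ler_wpM2l; [exact: ltW|apply: ler_pM].
  have fh0 : 0 <= `|fh| by [].
  have : h * ((1 + 2 * L) * Q y * `|fh|) <= horizon M * ((1 + 2 * L) * Q y * `|fh|).
    by apply: ler_wpM2r => //; exact: mulr_ge0.
  lra.
have tri7 (a1 a2 a3 a4 a5 a6 a7 : R) : `|a1 + a2 - a3 - a4 - a5 - a6 - a7| <=
    `|a1| + `|a2| + `|a3| + `|a4| + `|a5| + `|a6| + `|a7|.
  apply: le_trans (ler_normB _ _) _; rewrite lerD2r.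
  apply: le_trans (ler_normB _ _) _; rewrite lerD2r.
  apply: le_trans (ler_normB _ _) _; rewrite lerD2r.
  apply: le_trans (ler_normB _ _) _; rewrite lerD2r.
  by apply: le_trans (ler_normB _ _) _; rewrite lerD2r ler_normD.
apply: le_trans (tri7 _ _ _ _ _ _ _) _.
apply: (@le_trans _ _ (2 * (h * dx ^+ 2 * Q y * (`|muX M y| + sigmaX M y ^+ 2))
   + h * dx ^+ 2 * Q y * CJ + Q y * `|fh| + Q y * `|gh| + Q y * `|jh|
   + (1 + 2 * L) * (Q y * (h ^+ 2 * `|muY M y|) + horizon M * (Q y * `|fh|))
   + K1 * RB)).
  by do 6!apply: lerD => //.
pose X1 := h * dx ^+ 2 * Q y.
pose X2 := h * dx ^+ 2 * Q y * (`|muX M y| + sigmaX M y ^+ 2).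
pose F := Q y * `|fh|; pose G := Q y * `|gh|; pose J := Q y * `|jh|.
pose Y := Q y * (h ^+ 2 * `|muY M y|).
have X10 : 0 <= X1 by rewrite !mulr_ge0 ?sqr_ge0// ltW.
have X20 : 0 <= X2 by rewrite mulr_ge0// addr_ge0 ?sqr_ge0.
have F0 : 0 <= F by rewrite mulr_ge0.
have G0 : 0 <= G by rewrite mulr_ge0.
have JJ0 : 0 <= J by rewrite mulr_ge0.
have Y0 : 0 <= Y by apply: mulr_ge0 => //; apply: mulr_ge0 => //; exact: sqr_ge0.
have T0 : 0 <= horizon M by lra.
have LT0 : 0 <= L * horizon M by rewrite mulr_ge0.
set CC := consistency_const.
have CE : CC = 2 + 4 * (L * horizon M) + 4 * L + CJ + 2 + horizon M + 1
    + 2 * (L * horizon M) + 2 * L by rewrite /CC /consistency_const; ring.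
have CX1 : CJ * X1 <= CC * X1 by apply: ler_wpM2r => //; lra.
have CX2 : 2 * X2 <= CC * X2 by apply: ler_wpM2r => //; lra.
have CF : (1 + (1 + 2 * L) * horizon M) * F <= CC * F by apply: ler_wpM2r => //; lra.
have CG : 1 * G <= CC * G by apply: ler_wpM2r => //; lra.
have CJJ : 1 * J <= CC * J by apply: ler_wpM2r => //; lra.
have CY : (1 + 2 * L) * Y <= CC * Y by apply: ler_wpM2r => //; lra.
have CR : K1 * RB <= CC * RB by apply: ler_wpM2r => //; rewrite /K1; lra.
have -> : CC * (Q y * (h * dx ^+ 2 * (1 + `|muX M y| + sigmaX M y ^+ 2) + `|fh| + `|gh| + `|jh| +
     h ^+ 2 * `|muY M y|) + RB) =
  CC * X1 + CC * X2 + CC * F + CC * G + CC * J + CC * Y + CC * RB.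
  by rewrite /X1 /X2 /F /G /J /Y; ring.
apply: le_trans (_ : _ <= CJ * X1 + 2 * X2 + (1 + (1 + 2 * L) * horizon M) * F + 1 * G
   + 1 * J + (1 + 2 * L) * Y + K1 * RB) _.
  rewrite le_eqVlt; apply/orP; left; apply/eqP.
  by rewrite /X1 /X2 /F /G /J /Y; ring.
by do 6!apply: lerD => //.
Qed.

End at_time.
End scalar_consistency.

(** * Kernels and conditional expectations *)

Section pair_law.
Context {R : realType} {d : measure_display} {Omega : measurableType d}.
Variables (P : probability Omega R) (X X' : Omega -> R).
Hypotheses (mX : measurable_fun [set: Omega] X) (mX' : measurable_fun [set: Omega] X').
Variable kap : R.-pker R ~> R.

(** P seen as a kernel from a one-point space, so that the joint law of (X, X') becomes a
    composition of kernels and the integration formula for compositions applies. *)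
Definition const_kernel (_ : unit) : {measure set Omega -> \bar R} := P.

Let measurable_const_kernel U : measurable U ->
  measurable_fun [set: unit] (const_kernel ^~ U).
Proof. by move=> mU; exact: measurable_cst. Qed.

HB.instance Definition _ :=
  isKernel.Build _ _ _ _ R const_kernel measurable_const_kernel.

Let const_kernel_prob x : const_kernel x [set: Omega] = 1%E.
Proof. exact: probability_setT. Qed.

HB.instance Definition _ :=
  Kernel_isProbability.Build _ _ _ _ _ const_kernel const_kernel_prob.

Definition pair_kernel (x : unit * Omega) : {measure set (R * R) -> \bar R} :=
  measure_function_pushforward__canonical__measure_function_Measure
    (kap (X x.2)) (pair1_measurable (X x.2)).

Lemma pair_kernelE x A : pair_kernel x A = kap (X x.2) (xsection A (X x.2)).
Proof. by rewrite xsectionE. Qed.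

Let measurable_pair_kernel U : measurable U ->
  measurable_fun [set: unit * Omega] (pair_kernel ^~ U).
Proof.
move=> mU; under eq_fun do rewrite pair_kernelE.
apply: (@measurableT_comp _ _ _ _ _ _ (fun y => kap y (xsection U y)) _ (X \o snd)).
  by apply: measurable_fun_xsection_finite_kernel; rewrite inE.
exact: measurableT_comp.
Qed.

HB.instance Definition _ :=
  isKernel.Build _ _ _ _ R pair_kernel measurable_pair_kernel.

Let pair_kernel_prob x : pair_kernel x [set: R * R] = 1%E.
Proof. by rewrite pair_kernelE xsectionE preimage_setT prob_kernel. Qed.

HB.instance Definition _ :=
  Kernel_isProbability.Build _ _ _ _ _ pair_kernel pair_kernel_prob.

Hypothesis hK : forall A B : set R, measurable A -> measurable B ->
  P (X @^-1` A `&` X' @^-1` B) = (\int[P]_(w in X @^-1` A) kap (X w) B)%E.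

Let mXX : measurable_fun [set: Omega] (fun w => (X w, X' w)).
Proof. exact: measurable_fun_pair. Qed.

Let law : {measure set (R * R) -> \bar R} :=
  measure_function_pushforward__canonical__measure_function_Measure P mXX.

(** Measurable rectangles are stable under intersection and generate the product sigma-algebra; on
    them the identity is the kernel hypothesis. *)
Let lawE A : measurable A -> law A = (const_kernel \; pair_kernel)%E tt A.
Proof.
pose C : set (set (R * R)) := [set C | exists A, measurable A /\ exists B, measurable B /\ C = A `*` B].
move=> mA; apply: (measure_unique C (fun=> setT)) => //.
- rewrite measurable_prod_measurableType; congr (<<s _ >>).
  rewrite predeqE; split => [[U mU [B mB <-]]|[U [mU [B [mB ->]]]]].
    by exists U; split => //; exists B.
  by exists U => //; exists B.
- move=> /= _ _ [X1 [mX1 [X2 [mX2 ->]]]] [Y1 [mY1 [Y2 [mY2 ->]]]].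
  rewrite -setXI; exists (X1 `&` Y1); split; first exact: measurableI.
  by exists (X2 `&` Y2); split => //; exact: measurableI.
- by move=> n; exists setT; split => //; exists setT; split => //; rewrite setXTT.
- by rewrite bigcup_const//; exists 0%N.
- move=> _ [U [mU [B [mB ->]]]].
  transitivity (P (X @^-1` U `&` X' @^-1` B)).
    by congr (P _).
  rewrite hK// integral_mkcond; apply: eq_integral => w _ /=.
  rewrite patchE /pushforward -[X in _ = kap _ X]xsectionE; case: ifPn => wU.
    by rewrite in_xsectionX//; move: wU; rewrite !inE.
  by rewrite notin_xsectionX ?measure0//; move: wU; rewrite !notin_setE.
- move=> k; apply: (@le_lt_trans _ _ 1%E); last exact: ltry.
  by rewrite /law /= /pushforward preimage_setT probability_setT.
Qed.

(** Disintegration of the joint law along the kernel: it turns expectations over two consecutive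
    states into kernel integrals at the first. *)
Lemma ge0_integral_pair_law (phi : R * R -> \bar R) :
  (forall z, 0 <= phi z)%E -> measurable_fun [set: R * R] phi ->
  (\int[P]_w phi (X w, X' w) = \int[P]_w \int[kap (X w)]_z phi (X w, z))%E.
Proof.
move=> phi0 mphi.
transitivity (\int[law]_z phi z)%E.
  by rewrite ge0_integral_pushforward.
transitivity (\int[(const_kernel \; pair_kernel)%E tt]_z phi z)%E.
  by apply: eq_measure_integral => A mA _; exact: lawE.
rewrite integral_kcomp//.
apply: eq_integral => w _.
by rewrite ge0_integral_pushforward.
Qed.

End pair_law.

(** * Conditional expectations as kernel integrals *)

Section cond_exp_kernel.
Context {R : realType} {d : measure_display} {Omega : measurableType d}.
Variables (P : probability Omega R) (X : Omega -> R).
Hypothesis mX : measurable_fun [set: Omega] X.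

Definition by_X (F : Omega -> R) := forall A : set R, measurable A ->
  exists2 B : set R, measurable B & F @^-1` A = X @^-1` B.

(* Comparison through the rationals, to stay inside sigma(X). *)
Lemma by_X_lt (F g : Omega -> R) : by_X F -> by_X g ->
  exists2 B : set R, measurable B & [set w | F w < g w] = X @^-1` B.
Proof.
move=> hF hg.
have mI1 (q : rat) : measurable `]-oo, (ratr q : R)[%classic by [].
have mI2 (q : rat) : measurable `](ratr q : R), +oo[%classic by [].
pose B1 q := sval (cid2 (hF _ (mI1 q))).
pose B2 q := sval (cid2 (hg _ (mI2 q))).
have [mB1 eB1] : (forall q, measurable (B1 q)) /\
    forall q, F @^-1` `]-oo, (ratr q : R)[%classic = X @^-1` (B1 q).
  by split=> q; rewrite /B1; case: cid2.
have [mB2 eB2] : (forall q, measurable (B2 q)) /\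
    forall q, g @^-1` `](ratr q : R), +oo[%classic = X @^-1` (B2 q).
  by split=> q; rewrite /B2; case: cid2.
exists (\bigcup_q (B1 q `&` B2 q)).
  by apply: bigcupT_measurable_rat => q; exact: measurableI.
rewrite preimage_bigcup; apply/seteqP; split => w /=.
  move=> /rat_in_itvoo[q]; rewrite in_itv/= => /andP[Fq qg].
  exists q => //; rewrite preimage_setI -eB1 -eB2; split => /=;
    by rewrite in_itv/= ?andbT.
move=> [q _]; rewrite preimage_setI -eB1 -eB2 /= !in_itv/= andbT => -[].
exact: lt_trans.
Qed.

(** The set where g < F belongs to sigma(X), so the integrals of F and g over it agree; since F - g
    is positive there, the set is null. *)
Lemma cond_exp_le (F g : Omega -> R) :
  P.-integrable [set: Omega] (EFin \o F) -> P.-integrable [set: Omega] (EFin \o g) ->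
  by_X F -> by_X g ->
  (forall B, measurable B -> (\int[P]_(w in X @^-1` B) (F w)%:E =
     \int[P]_(w in X @^-1` B) (g w)%:E)%E) ->
  {ae P, forall w, F w <= g w}.
Proof.
move=> iF ig bF bg FgE; have [B mB BE] := by_X_lt bg bF.
set U := X @^-1` B in BE.
have mU : measurable U by rewrite -[U]setTI; exact: mX.
have iFU : P.-integrable U (EFin \o F) by apply: integrableS iF.
have igU : P.-integrable U (EFin \o g) by apply: integrableS ig.
have iFg : P.-integrable U ((EFin \o F) \- (EFin \o g))%E by apply: integrableB.
have h0 : (\int[P]_(w in U) `|((EFin \o F) \- (EFin \o g))%E w| = 0)%E.
  transitivity (\int[P]_(w in U) ((EFin \o F) \- (EFin \o g))%E w)%E.
    apply: eq_integral => w; rewrite inE -BE /= => gF.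
    by rewrite ger0_norm ?EFinB// subr_ge0 ltW.
  rewrite integralB//= FgE// subee//.
  exact: integrable_fin_num.
move/(ae_eq_integral_abs P mU (measurable_int _ iFg)) : h0 => h0.
apply: filterS h0 => w; rewrite -/(U w) -BE /= => h; rewrite leNgt; apply/negP => gF.
have := h gF; rewrite -EFinB => /eqP; rewrite eqe subr_eq0 => /eqP e.
by rewrite e ltxx in gF.
Qed.

Lemma cond_exp_eq (F g : Omega -> R) :
  P.-integrable [set: Omega] (EFin \o F) -> P.-integrable [set: Omega] (EFin \o g) ->
  by_X F -> by_X g ->
  (forall B, measurable B -> (\int[P]_(w in X @^-1` B) (F w)%:E =
     \int[P]_(w in X @^-1` B) (g w)%:E)%E) ->
  {ae P, forall w, F w = g w}.
Proof.
move=> iF ig bF bg FgE; have h1 := cond_exp_le iF ig bF bg FgE.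
have h2 := cond_exp_le ig iF bg bF (fun B mB => esym (FgE B mB)).
by apply: filterS2 h1 h2 => w ? ?; apply/le_anti/andP.
Qed.

Variable X' : Omega -> R.
Hypothesis mX' : measurable_fun [set: Omega] X'.
Variable kap : R.-pker R ~> R.
Hypothesis hK : forall A B : set R, measurable A -> measurable B ->
  P (X @^-1` A `&` X' @^-1` B) = (\int[P]_(w in X @^-1` A) kap (X w) B)%E.

Lemma ge0_integral_pair_lawS (phi : R * R -> \bar R) B :
  (forall z, 0 <= phi z)%E -> measurable_fun [set: R * R] phi -> measurable B ->
  (\int[P]_(w in X @^-1` B) phi (X w, X' w) =
   \int[P]_(w in X @^-1` B) \int[kap (X w)]_z phi (X w, z))%E.
Proof.
move=> phi0 mphi mB.
pose psi : R * R -> \bar R := phi \_ (B `*` setT).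
have mpsi : measurable_fun setT psi.
  apply/(measurable_restrictT _ _).1; first exact: measurableX.
  exact: measurable_funTS.
have psi0 z : (0 <= psi z)%E by rewrite /psi patchE; case: ifP.
have e w : X w \in B = (w \in X @^-1` B) by rewrite /in_mem/=.
rewrite integral_mkcond [RHS]integral_mkcond.
transitivity (\int[P]_w psi (X w, X' w))%E.
  apply: eq_integral => w _; rewrite /psi !patchE -e.
  by congr (if _ then _ else _); apply/idP/idP; rewrite !inE /=; tauto.
rewrite (ge0_integral_pair_law mX mX' hK psi0 mpsi).
apply: eq_integral => w _; rewrite patchE -e; case: ifPn => [|] wB.
  apply: eq_integral => z _; rewrite /psi patchE ifT//.
  by move: wB; rewrite !inE.
apply: integral0_eq => z _; rewrite /psi patchE ifF//.
by apply/negbTE; move: wB; rewrite !notin_setE/= => wB [].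
Qed.

Let kint (phi : R * R -> \bar R) y := (\int[kap y]_z phi (y, z))%E.

Let measurable_kint phi : (forall z, 0 <= phi z)%E ->
  measurable_fun [set: R * R] phi -> measurable_fun [set: R] (kint phi).
Proof. by move=> phi0 mphi; exact: measurable_fun_integral_finite_kernel. Qed.

Let kint_int phi : (forall z, 0 <= phi z)%E ->
  measurable_fun [set: R * R] phi -> P.-integrable setT (fun w => phi (X w, X' w)) ->
  P.-integrable setT (kint phi \o X).
Proof.
move=> phi0 mphi /integrableP[_ iphi]; apply/integrableP; split.
  by apply: measurableT_comp => //; exact: measurable_kint.
under eq_integral.
  move=> w _; rewrite gee0_abs; last exact: integral_ge0.
  over.
rewrite -(ge0_integral_pair_law mX mX' hK)//.
by under eq_integral => w _ do rewrite -(gee0_abs (phi0 (X w, X' w))).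
Qed.

(** The kernel integral of G is another version of the conditional expectation, and versions agree
    almost surely. This converts the moment conditions of H1, stated through conditional
    expectations, into moments of the kernel at almost every state. *)
Lemma cond_exp_kernel (G : R * R -> R) (Z : Omega -> R) :
  measurable_fun [set: R * R] G ->
  is_cond_exp P (fun w => G (X w, X' w)) X Z ->
  {ae P, forall w, (kap (X w)).-integrable setT (EFin \o (fun z => G (X w, z))) /\
     \int[kap (X w)]_z G (X w, z) = Z w}.
Proof.
move=> mG [iG iZ bZ ZE].
pose Gp : R * R -> \bar R := (EFin \o G)^\+%E; pose Gn : R * R -> \bar R := (EFin \o G)^\-%E.
have mEG : measurable_fun setT (EFin \o G) by exact/measurable_EFinP.
have mGp : measurable_fun setT Gp by exact: measurable_funepos.
have mGn : measurable_fun setT Gn by exact: measurable_funeneg.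
have Gp0 z : (0 <= Gp z)%E by exact: funepos_ge0.
have Gn0 z : (0 <= Gn z)%E by exact: funeneg_ge0.
have iGp : P.-integrable setT (fun w => Gp (X w, X' w)).
  rewrite (_ : (fun w => _) = (EFin \o (fun w => G (X w, X' w)))^\+%E); first exact: integrable_funepos.
  by apply/funext => w; rewrite /Gp !funeposE.
have iGn : P.-integrable setT (fun w => Gn (X w, X' w)).
  rewrite (_ : (fun w => _) = (EFin \o (fun w => G (X w, X' w)))^\-%E); first exact: integrable_funeneg.
  by apply/funext => w; rewrite /Gn !funenegE.
have ip := kint_int Gp0 mGp iGp; have iq := kint_int Gn0 mGn iGn.
have aep := integrable_ae measurableT ip; have aeq := integrable_ae measurableT iq.
(* The two parts of a signed G are integrated separately; [fine] removes the infinite values, which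
   occur only on a null set. *)
pose p w := fine (kint Gp (X w)); pose q w := fine (kint Gn (X w)).
have mp : measurable_fun setT (fine \o kint Gp) by apply: measurableT_comp => //; exact: measurable_kint.
have mq : measurable_fun setT (fine \o kint Gn) by apply: measurableT_comp => //; exact: measurable_kint.
have fine_int phi : (forall z, 0 <= phi z)%E -> measurable_fun setT (kint phi) ->
    P.-integrable setT (kint phi \o X) ->
    P.-integrable setT (EFin \o (fun w => fine (kint phi (X w)))).
  move=> phi0 mk i; apply: (le_integrable measurableT _ _ i).
    apply/measurable_EFinP; apply: (measurableT_comp (f := fine)) => //.
    exact: measurableT_comp.
  move=> w _ /=; have : (0 <= kint phi (X w))%E by exact: integral_ge0.
  by case: (kint phi (X w)) => [r||] //= _; rewrite normr0 leey.
have ipf : P.-integrable setT (EFin \o p) by apply: fine_int ip => //; exact: measurable_kint.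
have iqf : P.-integrable setT (EFin \o q) by apply: fine_int iq => //; exact: measurable_kint.
have ig : P.-integrable setT (EFin \o (fun w => p w - q w)).
  by have := integrableB measurableT ipf iqf.
have bg : by_X (fun w => p w - q w).
  move=> A mA; exists ((fun y => fine (kint Gp y) - fine (kint Gn y)) @^-1` A) => //.
  rewrite -[X in measurable X]setTI; apply: measurable_funB => //.
suff eB B : measurable B -> (\int[P]_(w in X @^-1` B) (Z w)%:E =
     \int[P]_(w in X @^-1` B) (p w - q w)%:E)%E.
  have ae := cond_exp_eq iZ ig bZ bg eB.
  apply: filterS3 ae aep aeq => w -> /(_ I) pf /(_ I) qf; split.
    apply/integrableP; split.
      by apply/measurable_EFinP; apply: (measurableT_comp mG); exact: pair1_measurable.
    rewrite (_ : (fun x => _) = (fun z => Gp (X w, z) + Gn (X w, z))%E).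
      rewrite ge0_integralD//; last 2 first.
        by apply: (measurableT_comp mGp); exact: pair1_measurable.
        by apply: (measurableT_comp mGn); exact: pair1_measurable.
      by rewrite -[ltLHS]/(kint Gp (X w) + kint Gn (X w))%E ltey_eq fin_numD pf qf.
    by apply/funext => z; rewrite /Gp /Gn -[RHS]/(((EFin \o G)^\+ \+ (EFin \o G)^\-) (X w, z))%E -fune_abse.
  rewrite /Rintegral integralE.
  rewrite -[in LHS]/(kint Gp (X w)).
  have -> : (\int[kap (X w)]_z (fun z => (G (X w, z))%:E)^\- z = kint Gn (X w))%E.
    by apply: eq_integral => z _; rewrite /Gn !funenegE.
  have -> : (\int[kap (X w)]_z (fun z => (G (X w, z))%:E)^\+ z = kint Gp (X w))%E.
    by apply: eq_integral => z _; rewrite /Gp !funeposE.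
  by rewrite fineB.
move=> mB; rewrite ZE//.
have mU : measurable (X @^-1` B) by rewrite -[_ @^-1` _]setTI; exact: mX.
have aef (phi : R * R -> \bar R) : (forall z, 0 <= phi z)%E -> measurable_fun setT phi ->
   {ae P, forall w, setT w -> (kint phi \o X) w \is a fin_num} ->
   (\int[P]_(w in X @^-1` B) (fine (kint phi (X w)))%:E = \int[P]_(w in X @^-1` B) phi (X w, X' w))%E.
  move=> phi0 mphi ae; rewrite ge0_integral_pair_lawS//.
  apply: ge0_ae_eq_integral => //.
  - apply: measurable_funTS; apply/measurable_EFinP; apply: (measurableT_comp (f := fine)) => //.
    by apply: measurableT_comp => //; exact: measurable_kint.
  - by apply: measurable_funTS; apply: (measurableT_comp (f := kint phi)) => //; exact: measurable_kint.
  - by move=> w _; rewrite lee_fin fine_ge0//; exact: integral_ge0.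
  - by move=> w _; exact: integral_ge0.
  - by apply: filterS ae => w /(_ I) f _; rewrite fineK.
rewrite integralE.
have -> : (\int[P]_(w in X @^-1` B) ((fun w => (G (X w, X' w))%:E)^\+ w) =
    \int[P]_(w in X @^-1` B) Gp (X w, X' w))%E.
  by apply: eq_integral => w _; rewrite /Gp !funeposE.
have -> : (\int[P]_(w in X @^-1` B) ((fun w => (G (X w, X' w))%:E)^\- w) =
    \int[P]_(w in X @^-1` B) Gn (X w, X' w))%E.
  by apply: eq_integral => w _; rewrite /Gn !funenegE.
under [RHS]eq_integral do rewrite EFinB.
rewrite integralB_EFin//; last 2 first.
- exact: integrableS ipf.
- exact: integrableS iqf.
by rewrite !aef.
Qed.

End cond_exp_kernel.

(** * Measurability of the scheme *)

Section measurable_sequences.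
Context {R : realType} {d : measure_display} {T : measurableType d}.
Variables (D : set T) (mD : measurable D).

Lemma measurable_funV (f : T -> R) :
  measurable_fun D f -> measurable_fun D (fun x => (f x)^-1).
Proof. by move=> mf; exact: (measurableT_comp measurable_invr mf). Qed.

Lemma measurable_zbox n (a : T -> int -> R) :
  (forall i, measurable_fun D (a^~ i)) -> measurable_fun D (fun x => zbox n (a x)).
Proof. by move=> ma; apply: measurable_sum => k; exact: measurable_funD. Qed.

Lemma measurable_zsum (a : T -> int -> R) :
  (forall i, measurable_fun D (a^~ i)) -> (forall x, D x -> zabs (a x)) ->
  measurable_fun D (fun x => zsum (a x)).
Proof.
move=> ma za; apply: (measurable_fun_cvg (h := fun n x => zbox n (a x))).
  by move=> n; exact: measurable_zbox.
by move=> x Dx; exact: zsum_cvg (za x Dx).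
Qed.

Lemma measurable_l2norm (dx : R) (v : T -> int -> R) : 0 < dx ->
  (forall i, measurable_fun D (v^~ i)) -> measurable_fun D (fun x => l2norm dx (v x)).
Proof.
move=> dx0 mv; apply: (@measurableT_comp _ _ _ _ _ _ (fun y : \bar R => y `^ 2^-1)%E).
  exact: measurable_poweR.
have e0 x i : 0 <= `|v x i| ^+ 2 * dx by rewrite mulr_ge0 ?sqr_ge0// ltW.
under eq_fun do rewrite esum_zbox//.
apply: (@emeasurable_fun_cvg _ _ _ _
  (fun n x => (zbox n (fun i => `|v x i| ^+ 2 * dx))%:E)).
  move=> n; apply/measurable_EFinP; apply: measurable_zbox => i.
  by apply: measurable_funM => //; apply: measurable_funX; exact: measurableT_comp.
move=> x _; apply: ereal_nondecreasing_is_cvgn => m n mn.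
by rewrite lee_fin; exact: zbox_nd.
Qed.

(** Square summability is finiteness of [l2norm], itself a monotone limit of measurable windows. *)
Lemma measurable_l2s (dx : R) (v : T -> int -> R) : 0 < dx ->
  (forall i, measurable_fun D (v^~ i)) -> measurable (D `&` [set x | l2s (v x)]).
Proof.
move=> dx0 mv.
rewrite (_ : [set x | l2s (v x)] = [set x | l2norm dx (v x) < +oo]%E).
  by apply: emeasurable_fun_infty_o => //; exact: measurable_l2norm.
by apply/seteqP; split => x /=; have := in_l2P (v x) dx0; rewrite /in_l2; tauto.
Qed.

Lemma measurable_tri (a b c : T -> R) (w : T -> int -> R) i :
  measurable_fun D a -> measurable_fun D b -> measurable_fun D c ->
  (forall i, measurable_fun D (w^~ i)) ->
  measurable_fun D (fun x => tri (a x) (b x) (c x) (w x) i).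
Proof.
by move=> ma mb mc mw; do 2?apply: measurable_funD => //; apply: measurable_funM.
Qed.

(** Each iterate of the Richardson scheme depends measurably on the parameters, and the inverse is
    their pointwise convergent series. *)
Lemma measurable_tri_inv (al be : T -> R) (g : T -> int -> R) i :
  measurable_fun D al -> measurable_fun D be ->
  (forall i, measurable_fun D (g^~ i)) -> (forall x, D x -> 0 <= be x) ->
  (forall x, D x -> l2s (g x)) ->
  measurable_fun D (fun x => tri_inv (al x) (be x) (g x) i).
Proof.
move=> ma mb mg be0 lg.
have m1 : measurable_fun D (fun x => al x - be x) by exact: measurable_funB.
have m2 : measurable_fun D (fun x => 1 + 2 * be x).
  by apply: measurable_funD => //; exact: measurable_funM.
have m3 : measurable_fun D (fun x => - al x - be x).
  by apply: measurable_funB => //; exact: measurableT_comp.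
have mt : measurable_fun D (fun x => tri_tau (al x) (be x)).
  apply: measurable_funV; apply: measurable_funM => //.
  by do 2?apply: measurable_funD => //; exact: measurable_funX.
have mi m j : measurable_fun D (fun x => iter m (tri_res (al x) (be x)) (g x) j).
  elim: m j => [|m ih] j //=; apply: measurable_funB => //.
  by apply: measurable_funM => //; exact: measurable_tri.
apply: measurable_funM => //.
apply: (measurable_fun_cvg
  (h := fun n x => series (fun m => iter m (tri_res (al x) (be x)) (g x) i) n)).
  by move=> n; apply: measurable_sum.
by move=> x Dx; apply: cvg_iter_res; [exact: be0|exact: lg].
Qed.

End measurable_sequences.

Lemma measurable_jump_weight {R : realType} {d : measure_display} {T : measurableType d}
    (D : set T) (M : jump_model R) (dx : R) (y : T -> R) l :
  model_hypotheses M -> measurable D -> measurable_fun D y ->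
  (forall x, D x -> dom M (y x)) ->
  measurable_fun D (fun x => jump_weight M dx (y x) l).
Proof.
move=> hM mD my Dy.
have mg : measurable_fun D (gammaX M \o y).
  have [_ _ mg _ _] := coefficients_measurable hM.
  apply: measurable_comp mg my => //; last by move=> _ [x Dx <-]; exact: Dy.
  by apply: is_interval_measurable; exact: domain_is_interval (dom_convex hM).
apply: measurable_funM => //; rewrite /nu_y; case: asboolP => // _.
apply: measurable_funM.
  by apply: measurable_funV; exact: measurableT_comp.
apply: measurable_funM => //.
apply: (measurableT_comp (f := jump_density M)); first exact: jump_density_measurable hM.
apply: measurable_funM => //.
exact: measurable_funV.
Qed.

Lemma measurable_explicit_B {R : realType} {d : measure_display} {T : measurableType d}
    (D : set T) (M : jump_model R) (h dx : R) (y : T -> R) (v : T -> int -> R) i :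
  model_hypotheses M -> measurable D -> measurable_fun D y ->
  (forall x, D x -> dom M (y x)) ->
  (forall x, D x -> zabs (jump_weight M dx (y x))) ->
  (forall i, measurable_fun D (v^~ i)) -> (forall x, D x -> l2s (v x)) ->
  measurable_fun D (fun x => explicit_B M h dx (y x) (v x) i).
Proof.
move=> hM mD my Dy zw mv lv; apply: measurable_funD => //; apply: measurable_funM => //.
apply: measurable_zsum => // [l|x Dx].
  by apply: measurable_funM; [exact: measurable_jump_weight|exact: measurable_funB].
apply: (@zabs_bddr _ _ _ (2 * Num.sqrt (sqsum (v x)))); first exact: zw.
move=> l; apply: le_trans (ler_normB _ _) _.
by rewrite mulr_natl mulr2n lerD//; apply: l2s_bounded; exact: lv.
Qed.

(** The measurable set where v is square summable is separated from its complement: on the first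
    [Pi_op] is the Neumann series, on the second it is the default value 0. *)
Lemma measurable_Pi_op {R : realType} {d : measure_display} {T : measurableType d}
    (D : set T) (M : jump_model R) (h dx : R) (y : T -> R) (v : T -> int -> R) i :
  model_hypotheses M -> measurable D -> 0 < h -> 0 < dx -> measurable_fun D y ->
  (forall x, D x -> dom M (y x)) ->
  (forall x, D x -> zabs (jump_weight M dx (y x))) ->
  (forall i, measurable_fun D (v^~ i)) ->
  measurable_fun D (fun x => Pi_op M h dx (y x) (v x) i).
Proof.
move=> hM mD h0 dx0 my Dy zw mv.
have comp_dom g : measurable_fun (dom M) g -> measurable_fun D (g \o y).
  move=> mg; apply: measurable_comp mg my => //; last by move=> _ [x Dx <-]; exact: Dy.
  by apply: is_interval_measurable; exact: domain_is_interval (dom_convex hM).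
have mE : measurable (D `&` [set x | l2s (v x)]) by exact: measurable_l2s dx0 mv.
have mF : measurable (D `\` [set x | l2s (v x)]).
  rewrite (_ : _ `\` _ = D `\` (D `&` [set x | l2s (v x)])); first exact: measurableD.
  by apply/seteqP; split => x /=; tauto.
have -> : D = (D `&` [set x | l2s (v x)]) `|` (D `\` [set x | l2s (v x)]) by rewrite setUIDK.
apply/measurable_funU => //; split.
  apply: (eq_measurable_fun (fun x => tri_inv (mx_alpha M h dx (y x)) (mx_beta M h dx (y x))
      (explicit_B M h dx (y x) (v x)) i)).
    by move=> x; rewrite inE => -[Dx lx]; rewrite Pi_opE//; exact: zw.
  apply: measurable_tri_inv => //.
  - apply: (measurable_funS mD) => //; apply: measurable_funM => //.
    by apply: comp_dom; have [? _ _ _ _] := coefficients_measurable hM.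
  - apply: (measurable_funS mD) => //; apply: measurable_funM => //.
    apply: measurable_funX; apply: comp_dom.
    by have [_ ? _ _ _] := coefficients_measurable hM.
  - move=> j; apply: measurable_explicit_B => //.
    + exact: measurable_funS my.
    + by move=> x [? _]; exact: Dy.
    + by move=> x [? _]; exact: zw.
    + by move=> k; exact: measurable_funS (mv k).
    + by move=> x [].
  - by move=> x _; rewrite mulr_ge0 ?sqr_ge0// divr_ge0 ?mulr_ge0 ?sqr_ge0// ltW.
  - move=> x [Dx lx].
    by have [] := explicit_B_l2 (ltW h0) (zw x Dx) (lexx _) lx.
apply: (eq_measurable_fun (fun=> 0 : R)); last exact: measurable_cst.
by move=> x; rewrite inE => -[Dx nl]; rewrite Pi_op_outside.
Qed.

Lemma measurable_kernel_Rintegral {R : realType} (kap : R.-pker R ~> R) (S1 S2 : set R)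
    (F : R * R -> R) : measurable S1 -> measurable S2 ->
  measurable_fun (S1 `*` S2) F ->
  measurable_fun S1 (fun y => \int[kap y]_(z in S2) F (y, z)).
Proof.
move=> mS1 mS2 mF; pose G : R * R -> \bar R := (EFin \o F) \_ (S1 `*` S2).
have mG : measurable_fun setT G.
  apply/(measurable_restrictT _ _).1; first exact: measurableX.
  exact/measurable_EFinP.
have m1 := measurable_fun_integral_finite_kernel _ kap
  (fun z => funepos_ge0 G z) (measurable_funepos mG).
have m2 := measurable_fun_integral_finite_kernel _ kap
  (fun z => funeneg_ge0 G z) (measurable_funeneg mG).
apply: (eq_measurable_fun (fun y =>
  fine (\int[kap y]_z (G^\+ (y, z)) - \int[kap y]_z (G^\- (y, z)))%E)); last first.
  apply: measurable_funTS; apply: (measurableT_comp (f := fine)) => //.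
  exact: emeasurable_funB.
move=> y; rewrite inE => S1y; rewrite /Rintegral [in RHS]integral_mkcond [in RHS]integralE.
have e z : ((fun x => (F (y, x))%:E) \_ S2)%E z = G (y, z).
  rewrite /G !patchE; have -> // : (z \in S2) = ((y, z) \in S1 `*` S2).
  by apply/idP/idP; rewrite !inE /=; tauto.
congr (fine (_ - _)%E); apply: eq_integral => z _.
  by rewrite !funeposE e.
by rewrite !funenegE e.
Qed.

Lemma measurable_solution {R : realType} (M : jump_model R) (u : R -> R -> R -> R) V q t x :
  model_hypotheses M -> is_partials M q u V -> 0 <= t < horizon M ->
  measurable_fun (dom M) (u t x).
Proof.
move=> hM [e hV] tT; have [c _ _ _] := hV 0%N 0%N 0%N isT.
have It : `[0, horizon M[%classic t by rewrite /= in_itv.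
apply: (eq_measurable_fun (V 0%N 0%N 0%N t x)).
  by move=> y; rewrite inE => Dy; rewrite e.
apply: subspace_continuous_measurable_fun.
  by apply: is_interval_measurable; exact: domain_is_interval (dom_convex hM).
apply/subspace_continuousP => y Dy.
move/subspace_continuousP : c => /(_ (t, x, y)) /= /(_ (conj It Dy)) c.
apply: (cvg_comp (fun z => (t, x, z)) _ _ c).
move=> B [[B1 B2] /= [n1 n2] BB]; apply: filterS n2 => z B2z Dz.
by apply: (BB (t, x, z)); [split => //=; exact: nbhs_singleton|].
Qed.

(** The payoff is the pointwise limit of the continuous functions u(s_n, x, .) for the times s_n = T
    - T/(n+1) increasing to T. *)
Lemma measurable_payoff {R : realType} (M : jump_model R) (f : R -> R -> R)
    (u : R -> R -> R -> R) V q x :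
  model_hypotheses M -> is_partials M q u V -> solves_pide M f u ->
  measurable_fun (dom M) (f x).
Proof.
move=> hM hV [_ hf]; have T0 := horizon_gt0 hM.
pose s n := horizon M - horizon M / n.+1%:R.
have s0 n : 0 <= s n < horizon M.
  rewrite subr_ge0 ltrBlDr ltrDl divr_gt0// andbT.
  by rewrite ler_pdivrMr// ler_peMr ?ler1n//; exact: ltW.
apply: (measurable_fun_cvg (h := fun n => u (s n) x)).
  by move=> n; exact: measurable_solution hM hV (s0 n).
move=> y Dy; have [_ c] := hf x y Dy.
apply: (cvg_comp s _ _ c).
have cs : s n @[n --> \oo] --> horizon M.
  rewrite -[X in _ --> X]subr0; apply: cvgB; first exact: cvg_cst.
  rewrite -(mulr0 (horizon M)); apply: cvgM; first exact: cvg_cst.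
  exact: cvg_harmonic.
move=> B; rewrite /at_left /within /= => nB; have := cs _ nB => nB'.
have : \forall n \near \oo, s n < horizon M -> B (s n) by exact: nB'.
by apply: filterS => n /= h; apply: h; have /andP[] := s0 n.
Qed.

Lemma measurable_backward {R : realType} (M : jump_model R) (X0 : R) (f : R -> R -> R)
    N (dx : R) (St : nat -> set R) (K : nat -> R.-pker R ~> R) k (i : int) :
  model_hypotheses M -> (forall x, measurable_fun (dom M) (f x)) ->
  (0 < N)%N -> 0 < dx ->
  (forall y, dom M y -> zabs (jump_weight M dx y)) ->
  (forall n, (n <= N)%N -> measurable (St n) /\ St n `<=` dom M) ->
  (k <= N)%N -> measurable_fun (St (N - k)%N) (backward M X0 f N dx St K k i).
Proof.
move=> hM mf N0 dx0 zw hSt; elim: k i => [|k ih] i kN.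
  have [m1 s1] := hSt (N - 0)%N (leq_subr _ _).
  apply: (measurable_funS _ s1); last exact: mf.
  by apply: is_interval_measurable; exact: domain_is_interval (dom_convex hM).
have [m1 s1] := hSt _ (leq_subr k.+1 N); have [m2 s2] := hSt _ (leq_subr k N).
have h0 : 0 < step M N by rewrite divr_gt0 ?ltr0n// (horizon_gt0 hM).
have mX := measurableX m1 m2.
apply: (@measurable_kernel_Rintegral _ (K (N - k.+1)%N) _ _
  (fun z => Pi_op M (step M N) dx z.1 (fun j => backward M X0 f N dx St K k j z.2) i)) => //.
apply: (@measurable_Pi_op _ _ _ _ _ _ _ fst) => //.
- exact: measurable_funTS.
- by move=> z [/= + _]; exact: s1.
- by move=> z [/= z1 _]; apply: zw; exact: s1.
- move=> j; apply: (measurable_comp m2 _ (ih j (ltnW kN))) => //.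
    by move=> _ [z [_ z2] <-].
  exact: measurable_funTS.
Qed.

Lemma measurable_fun_sqrtr {R : realType} {d : measure_display} {T : measurableType d}
    (D : set T) (g : T -> R) :
  measurable_fun D g -> measurable_fun D (fun x => Num.sqrt (g x)).
Proof.
move=> mg; apply: (@measurableT_comp _ _ _ _ _ _ (@Num.sqrt R)) => //.
by apply: continuous_measurable_fun => x; exact: sqrt_continuous.
Qed.

(** * One step of the scheme *)

Section integral_sequences.
Context {R : realType} {d : measure_display} {T : measurableType d}.
Variables (m : {measure set T -> \bar R}) (D : set T) (mD : measurable D).
Variables (F : T -> int -> R).
Hypothesis iF : forall i, m.-integrable D (EFin \o (F^~ i)).

Lemma integrableZl_EFin (k : R) (g : T -> R) : m.-integrable D (EFin \o g) ->
  m.-integrable D (EFin \o (fun x => k * g x)).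
Proof.
move=> ig; have := integrableZl mD k ig.
by apply: eq_integrable => // x _; rewrite /= EFinM.
Qed.

Lemma integrableD_EFin (f g : T -> R) : m.-integrable D (EFin \o f) ->
  m.-integrable D (EFin \o g) -> m.-integrable D (EFin \o (fun x => f x + g x)).
Proof.
move=> i_f ig; have := integrableD mD i_f ig.
by apply: eq_integrable => // x _; rewrite /= EFinD.
Qed.

Lemma integrable_dominated (f g : T -> R) : measurable_fun D f ->
  (forall x, D x -> `|f x| <= g x) -> m.-integrable D (EFin \o g) ->
  m.-integrable D (EFin \o f).
Proof.
move=> mf fg; apply: (le_integrable mD); first exact/measurable_EFinP.
move=> x Dx /=; rewrite lee_fin (le_trans (fg x Dx))//.
exact: ler_norm.
Qed.

Lemma integrable_zbox n (c : int -> R) :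
  m.-integrable D (EFin \o (fun x => zbox n (fun i => c i * F x i))).
Proof.
elim: n => [|n ih].
  rewrite (_ : _ \o _ = cst 0%E); first exact: integrable0.
  by apply/funext => x /=; rewrite zbox0.
rewrite (_ : _ \o _ = EFin \o (fun x => zbox n (fun i => c i * F x i) +
  (c (Posz n) * F x (Posz n) + c (Negz n) * F x (Negz n)))).
  by apply: integrableD_EFin => //; apply: integrableD_EFin; exact: integrableZl_EFin.
by apply/funext => x /=; rewrite zboxS.
Qed.

Lemma Rintegral_zbox n (c : int -> R) :
  \int[m]_(x in D) zbox n (fun i => c i * F x i) =
  zbox n (fun i => c i * \int[m]_(x in D) F x i).
Proof.
elim: n => [|n ih].
  rewrite zbox0; under eq_Rintegral do rewrite zbox0.
  by rewrite Rintegral_cst// mul0r.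
rewrite zboxS -ih -!RintegralZl// -RintegralD//; last 2 first.
- exact: integrableZl_EFin.
- exact: integrableZl_EFin.
rewrite -RintegralD//.
- by apply: eq_Rintegral => x _; rewrite zboxS.
- exact: integrable_zbox.
- by apply: integrableD_EFin; exact: integrableZl_EFin.
Qed.

Lemma Rintegral_tri (a b c : R) i :
  \int[m]_(x in D) tri a b c (F x) i = tri a b c (fun j => \int[m]_(x in D) F x j) i.
Proof.
rewrite /tri -!RintegralZl// RintegralD//; last 2 first.
- by apply: integrableD_EFin; exact: integrableZl_EFin.
- exact: integrableZl_EFin.
by rewrite RintegralD//; exact: integrableZl_EFin.
Qed.

End integral_sequences.

(** A point between y and z has absolute value at most |y| or at most |z|. This bounds derivatives
    at intermediate Taylor points by their bounds at the ends. *)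
Lemma growth_between {R : realType} (C a y z s : R) : 0 <= C -> 0 <= a ->
  between y z s -> growth C a s <= growth C a y + growth C a z.
Proof.
move=> C0 a0 b; rewrite /growth -mulrDr; apply: ler_wpM2l => //.
have [sy|sz] : `|s| <= `|y| \/ `|s| <= `|z|.
  case: b => /andP[h1 h2]; have [s0|s0] := leP 0 s.
  - by right; rewrite ger0_norm// (le_trans h2)// ler_norm.
  - by left; rewrite ltr0_norm// -normrN (le_trans _ (ler_norm _))// lerN2.
  - by left; rewrite ger0_norm// (le_trans h2)// ler_norm.
  - by right; rewrite ltr0_norm// -normrN (le_trans _ (ler_norm _))// lerN2.
- have := ge0_ler_powR a0 (normr_ge0 s) (normr_ge0 y) sy.
  by have := powR_ge0 `|z| a; lra.
- have := ge0_ler_powR a0 (normr_ge0 s) (normr_ge0 z) sz.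
  by have := powR_ge0 `|y| a; lra.
Qed.

(** Moves the pairing with c inside the jump sum, where it becomes the jump part at 0 of the
    sequence of shifted pairings; this reduces the grid statement to the scalar one. *)
Lemma zbox_explicit_B {R : realType} (M : jump_model R) (h dx y : R) (v : int -> R) n c :
  zabs (jump_weight M dx y) -> l2s v ->
  zbox n (fun i => c i * explicit_B M h dx y v i) =
  zbox n (fun i => c i * v i) +
    h * jump_part (jump_weight M dx y) (fun l => zbox n (fun i => c i * v (i + l))) 0.
Proof.
move=> zk lv; set k := jump_weight M dx y.
have zkv i : zabs (fun l => k l * (v (i + l) - v i)).
  apply: (@zabs_bddr _ _ _ (2 * Num.sqrt (sqsum v))) => // l.
  apply: le_trans (ler_normB _ _) _.
  by rewrite mulr_natl mulr2n lerD//; exact: l2s_bounded.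
transitivity (zbox n (fun i => c i * v i) +
    h * zbox n (fun i => zsum (fun l => c i * (k l * (v (i + l) - v i))))).
  rewrite -zboxZ -zboxD; apply: eq_zbox => i.
  by rewrite zsumZ// /explicit_B /jump_part -/k; ring.
rewrite zsum_zbox; last by move=> i; exact: zabsZ.
congr (_ + h * _); apply: eq_zsum => l.
rewrite add0r -zboxN -zboxD -zboxZ; apply: eq_zbox => i.
by rewrite addr0; ring.
Qed.

(** * From the scalar estimate to the l2 norm *)

Section one_step.
Context {R : realType}.
Variables (M : jump_model R) (f : R -> R -> R) (u : R -> R -> R -> R).
Variables (V : nat -> nat -> nat -> R -> R -> R -> R) (C a L CJ X0 : R).
Hypotheses (hM : model_hypotheses M) (hV : is_partials M 6 u V)
  (hp : solves_pide M f u) (C0 : 0 < C) (a0 : 0 < a).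
Hypothesis hL : forall k m l, (2 * k + m + l <= 6)%N -> forall t y,
      0 <= t -> t < horizon M -> dom M y ->
      ('N[lebesgue_measure]_(2%:E)[EFin \o (V k m l t ^~ y)] <= (C * (1 + `|y| `^ a))%:E)%E.
Hypotheses (L0 : 0 <= L) (CJ0 : 0 <= CJ).
Hypothesis hJ : forall dx y, 0 < dx -> dx <= 1 -> dom M y ->
  [/\ zabs (jump_weight M dx y), zsum (fun l => `|jump_weight M dx y l|) <= L &
    forall (g g1 g2 : R -> R) (q : R),
      (forall x : R, is_derive x 1 g (g1 x)) ->
      (forall x : R, is_derive x 1 g1 (g2 x)) ->
      (forall x, `|g x| <= q) -> (forall x, `|g1 x| <= q) ->
      (forall x, `|g2 x| <= q) ->
      `|nonlocal M g 0 y -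
        zsum (fun l => jump_weight M dx y l * (g (l%:~R * dx) - g 0))|
        <= CJ * q * dx ^+ 2].

(** Before T this is the sampling bound for order 0; at T each window is the left limit of windows
    at earlier times, and the bound is closed. *)
Lemma sampled_solution_le t y dx n : 0 <= t <= horizon M -> dom M y ->
  0 < dx -> dx <= 1 ->
  zbox n (fun i => u t (grid X0 dx i) y ^+ 2 * dx) <= (2 * growth C a y) ^+ 2.
Proof.
move=> /andP[t0]; rewrite le_eqVlt => /predU1P[->|tT] Dy dx0 dx1.
  have c : zbox n (fun i => u s (grid X0 dx i) y ^+ 2 * dx) @[s --> (horizon M)^'-] -->
      zbox n (fun i => u (horizon M) (grid X0 dx i) y ^+ 2 * dx).
    elim: n => [|n ih].
      by rewrite zbox0; under eq_fun do rewrite zbox0; exact: cvg_cst.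
    rewrite zboxS; under eq_fun do rewrite zboxS.
    have cu i : u s (grid X0 dx i) y ^+ 2 * dx @[s --> (horizon M)^'-] -->
        u (horizon M) (grid X0 dx i) y ^+ 2 * dx.
      have [e cf] := hp.2 (grid X0 dx i) y Dy.
      by rewrite e; apply: cvgM; [apply: cvgM|exact: cvg_cst].
    by apply: cvgD => //; exact: cvgD.
  apply: (@closed_cvg _ _ _ _ _ (fun x : R => x <= (2 * growth C a y) ^+ 2) _ _ _ c) => //.
  have T0 := horizon_gt0 hM.
  near=> s.
  have s0 : 0 <= s by near: s; apply: nbhs_left_ge.
  have sT : s < horizon M by near: s; exact: nbhs_left_lt.
  rewrite (eq_zbox _ (_ : _ =1 (fun i => V 0%N 0%N 0%N s (X0 + i%:~R * dx) y ^+ 2 * dx))).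
    by apply: (@sampled_partials_le _ _ _ _ _ _ hV C0 hL 0%N 0%N 0%N s y X0 dx n) => //; rewrite s0.
  by move=> i; rewrite hV.1//= in_itv/= s0.
rewrite (eq_zbox _ (_ : _ =1 (fun i => V 0%N 0%N 0%N t (X0 + i%:~R * dx) y ^+ 2 * dx))).
  by apply: (@sampled_partials_le _ _ _ _ _ _ hV C0 hL 0%N 0%N 0%N t y X0 dx n) => //; rewrite t0.
by move=> i; rewrite hV.1//= in_itv/= t0.
Unshelve. all: by end_near. Qed.

Lemma sampled_solution_l2 t y dx : 0 <= t <= horizon M -> dom M y ->
  0 < dx -> dx <= 1 -> l2s (fun i => u t (grid X0 dx i) y) /\
  Num.sqrt (sqsum (fun i => u t (grid X0 dx i) y) * dx) <= 2 * growth C a y.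
Proof.
move=> tT Dy dx0 dx1.
have h n : zbox n (fun i => u t (grid X0 dx i) y ^+ 2) <= (2 * growth C a y) ^+ 2 / dx.
  rewrite ler_pdivlMr//; apply: le_trans (sampled_solution_le n tT Dy dx0 dx1).
  by rewrite mulrC -zboxZ; apply: ler_zbox => i; rewrite mulrC.
split; first exact: l2s_bound h.
have g0 : 0 <= 2 * growth C a y by rewrite mulr_ge0// growth_ge0// ltW.
rewrite -(ger0_norm g0) -sqrtr_sqr ler_wsqrtr// -ler_pdivlMr//.
exact: sqsum_le.
Qed.

(** [r] stands for the kernel integral of [remainder_bound]. Both factors 2 come from the bound 2 *
    growth on sampled partials. *)
Definition step_error (h dx y fh gh jh r : R) : R :=
  consistency_const M L CJ *
    (2 * growth C a y * (h * dx ^+ 2 * (1 + `|muX M y| + sigmaX M y ^+ 2)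
       + `|fh| + `|gh| + `|jh| + h ^+ 2 * `|muY M y|) + 2 * r).

Section at_point.
Variables (t h dx y : R) (kap : {measure set R -> \bar R}) (S : set R) (fh gh jh : R).
Hypotheses (t0 : 0 <= t) (h0 : 0 < h) (thT : t + h <= horizon M).
Hypotheses (dx0 : 0 < dx) (dx1 : dx <= 1) (Dy : dom M y).
Hypotheses (mS : measurable S) (SD : S `<=` dom M) (kS : kap S = 1%E).
Hypotheses (i1 : kap.-integrable S (EFin \o (fun z => z - y)))
  (i2 : kap.-integrable S (EFin \o (fun z => (z - y) ^+ 2)))
  (i3 : kap.-integrable S (EFin \o (fun z => (z - y) ^+ 3)))
  (ir : kap.-integrable S (EFin \o remainder_bound (growth C a) h y)).
Hypotheses (e1 : \int[kap]_(z in S) (z - y) = muY M y * h + fh)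
  (e2 : \int[kap]_(z in S) ((z - y) ^+ 2) = sigmaY M y ^+ 2 * h + gh)
  (e3 : \int[kap]_(z in S) ((z - y) ^+ 3) = jh).

Let growth0 z : 0 <= growth C a z. Proof. by apply: growth_ge0; have := C0 => /ltW. Qed.
Let r := \int[kap]_(z in S) remainder_bound (growth C a) h y z.
Let tau := step_error h dx y fh gh jh r.
Let U z i := u (t + h) (grid X0 dx i) z.

Let thT' : 0 <= t + h <= horizon M.
Proof. by rewrite thT andbT; have := t0; have := h0; lra. Qed.

Let lU z : S z -> l2s (U z) /\ Num.sqrt (sqsum (U z) * dx) <= 2 * growth C a z.
Proof. by move=> Sz; apply: sampled_solution_l2 => //; exact: SD. Qed.

Let zk : zabs (jump_weight M dx y). Proof. by have [] := hJ dx0 dx1 Dy. Qed.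
Let kL : zsum (fun l => `|jump_weight M dx y l|) <= L.
Proof. by have [] := hJ dx0 dx1 Dy. Qed.

Let mU i : measurable_fun S (U^~ i).
Proof.
have mdom : measurable (dom M).
  by apply: is_interval_measurable; exact: domain_is_interval (dom_convex hM).
apply: (measurable_funS mdom SD).
have := thT; rewrite le_eqVlt => /predU1P[tT|tT].
  apply: (eq_measurable_fun (f (grid X0 dx i))).
    by move=> z; rewrite inE => Dz; rewrite /U tT; have [->] := hp.2 (grid X0 dx i) z Dz.
  exact: measurable_payoff hM hV hp.
by apply: measurable_solution hM hV _; have /andP[-> _] := thT'.
Qed.

(** The remainder at z is at least h^2 times the growth at z, so integrability of the remainder is
    enough. *)
Lemma integrable_growth : kap.-integrable S (EFin \o growth C a).
Proof.
have ir' := integrableZl_EFin mS (h ^- 2) ir.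
apply: (integrable_dominated mS _ _ ir').
  apply: measurable_funM => //; apply: measurable_funD => //.
  apply: measurable_funTS; apply: (measurableT_comp (f := fun s : R => s `^ a)).
    exact: measurable_powR.
  exact: normr_measurable.
move=> z Sz; rewrite ger0_norm// mulrC ler_pdivlMr ?exprn_gt0// /remainder_bound.
have h4 : 0 <= (z - y) ^+ 4 by rewrite (exprM _ 2 2) sqr_ge0.
apply: ler_pM => //; [exact/sqr_ge0|by rewrite lerDr|by rewrite lerDl].
Qed.

(** The scalar estimate for the combination with weights c, read at x = 0. Its bounds are
    proportional to the norm of c, which is the form that the duality lemma expects. *)
Lemma consistency_pairing n c :
  dx * zbox n (fun i => c i * tri_A M h dx y (fun i => u t (grid X0 dx i) y) i)
    - \int[kap]_(z in S) (dx * zbox n (fun i => c i * explicit_B M h dx y (U z) i))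
  <= Num.sqrt (dx * zbox n (fun i => c i ^+ 2)) * tau.
Proof.
set s := Num.sqrt _.
pose Q z := s * (2 * growth C a z).
pose nxt x z := dx * zbox n (fun i => c i * u (t + h) (grid X0 dx i + x) z).
have s0 : 0 <= s by exact: sqrtr_ge0.
have Q0 z : 0 <= Q z by rewrite mulr_ge0// mulr_ge0.
have Qb z1 z2 z3 : between z1 z2 z3 -> Q z3 <= Q z1 + Q z2.
  move=> b; rewrite /Q -mulrDr ler_wpM2l// -mulrDr ler_wpM2l//.
  by apply: growth_between b; apply: ltW.
have tT : 0 <= t < horizon M by have := thT; have := t0; have := h0; lra.
have hW := combine_scalar_sol hM hV hp C0 hL X0 n c dx0 dx1.
have hnxt x z : dom M z -> nxt x z = if t + h < horizon M
    then combine V X0 dx n c 0 0 0 (t + h) x z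
    else dx * zbox n (fun i => c i * f (grid X0 dx i + x) z).
  move=> Dz; case: ltP => hT.
    congr (dx * _); apply: eq_zbox => i; rewrite hV.1//= in_itv/= hT andbT.
    by have /andP[] := thT'.
  have e : t + h = horizon M by apply/le_anti/andP.
  rewrite /nxt e; congr (dx * _); apply: eq_zbox => i.
  by have [->] := hp.2 (grid X0 dx i + x) z Dz.
have gridD (i l : int) : grid X0 dx i + l%:~R * dx = grid X0 dx (i + l).
  by rewrite /grid intrD; ring.
have nxtE z : S z -> next_mean M h dx y nxt z =
    dx * zbox n (fun i => c i * explicit_B M h dx y (U z) i).
  move=> Sz; have [lUz _] := lU Sz.
  rewrite zbox_explicit_B// mulrDr /next_mean; cbv zeta; congr (_ + _).
    by congr (dx * _); apply: eq_zbox => i; rewrite addr0.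
  rewrite mulrCA; congr (h * _).
  have zkv : zabs (fun l => jump_weight M dx y l *
     (zbox n (fun i => c i * U z (i + (0 + l))) - zbox n (fun i => c i * U z (i + 0)))).
    have hz i : zabs (fun l => c i * (jump_weight M dx y l * (U z (i + l) - U z i))).
      apply: zabsZ; apply: (@zabs_bddr _ _ _ (2 * Num.sqrt (sqsum (U z)))) => // l.
      apply: le_trans (ler_normB _ _) _.
      by rewrite mulr_natl mulr2n lerD//; exact: l2s_bounded.
    apply: (eq_zabs _ (zabs_zbox n hz)) => l.
    rewrite -zboxN -zboxD -zboxZ; apply: eq_zbox => i.
    by rewrite addr0 add0r; ring.
  rewrite /jump_part -zsumZ//; apply: eq_zsum => l.
  rewrite add0r mul0r /nxt; under eq_zbox do rewrite gridD.
  under [X in _ * (_ - dx * X)]eq_zbox do rewrite addr0.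
  under [X in _ = dx * (_ * (_ - X))]eq_zbox do rewrite addr0.
  by rewrite /U; ring.
have remE z : remainder_bound Q h y z = 2 * s * remainder_bound (growth C a) h y z.
  by rewrite /remainder_bound /Q; ring.
have irQ : kap.-integrable S (EFin \o remainder_bound Q h y).
  have := integrableZl_EFin mS (2 * s) ir.
  by apply: eq_integrable => // z _; rewrite /= remE.
have mnxt : measurable_fun S (next_mean M h dx y nxt).
  apply: (eq_measurable_fun (fun z => dx * zbox n (fun i => c i * explicit_B M h dx y (U z) i))).
    by move=> z; rewrite inE => /nxtE ->.
  apply: measurable_funM => //; apply: measurable_zbox => // i.
  apply: measurable_funM => //.
  apply: (@measurable_explicit_B _ _ _ _ _ _ _ (fun=> y)) => // z Sz.
  exact: (lU Sz).1.
have [_ _ hJ3] := hJ dx0 dx1 Dy.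
have := scalar_consistency hM hW Q0 Qb t0 h0 thT dx0 dx1 Dy hnxt zk kL hJ3
  CJ0 mS SD kS i1 i2 i3 irQ mnxt e1 e2 e3.
move=> hc; apply: le_trans (le_trans (ler_norm _) _); last first.
  have -> : s * tau = consistency_const M L CJ *
    (Q y * (h * dx ^+ 2 * (1 + `|muX M y| + sigmaX M y ^+ 2)
        + `|fh| + `|gh| + `|jh| + h ^+ 2 * `|muY M y|)
     + \int[kap]_(z in S) remainder_bound Q h y z); last exact: hc.
  under eq_Rintegral do rewrite remE.
  by rewrite RintegralZl// /tau /step_error -/r /Q; ring.
rewrite le_eqVlt; apply/orP; left; apply/eqP; congr (_ - _).
  rewrite -zboxZ /tri_A /tri /combine.
  rewrite -!zboxZ -!zboxD; apply: eq_zbox => i.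
  have e x : V 0%N 0%N 0%N t x y = u t x y by rewrite hV.1//= in_itv/=.
  by rewrite !e !gridD !add0r addr0; ring.
by apply: eq_Rintegral => z; rewrite inE => /nxtE ->.
Qed.

(** With A and B the two operators and A Pi v = B v, linearity gives A E = (A u - int B U) + int B
    e. Pairing with c bounds the first term by consistency and the second by the norm 1 + 2hL of B;
    then |E| <= |A E|. *)
Lemma one_step_l2 (v : R -> int -> R) :
  (forall i, measurable_fun S (v^~ i)) -> (forall z, S z -> l2s (v z)) ->
  let e z i := U z i - v z i in
  kap.-integrable S (EFin \o (fun z => Num.sqrt (sqsum (e z) * dx))) ->
  let E i := u t (grid X0 dx i) y - \int[kap]_(z in S) Pi_op M h dx y (v z) i in
  l2s E /\ Num.sqrt (sqsum E * dx) <=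
    tau + (1 + 2 * h * L) * \int[kap]_(z in S) Num.sqrt (sqsum (e z) * dx).
Proof.
move=> mv lv e ie E.
have sd0 : 0 < Num.sqrt dx by rewrite sqrtr_gt0.
have hL0 : 0 <= 1 + 2 * h * L by rewrite addr_ge0// !mulr_ge0// ltW.
have le z : S z -> l2s (e z).
  by move=> Sz; apply: l2sD; [exact: (lU Sz).1|apply: l2sN; exact: lv].
have me i : measurable_fun S (e^~ i) by exact: measurable_funB.
have msq (w : R -> int -> R) : (forall i, measurable_fun S (w^~ i)) ->
    (forall z, S z -> l2s (w z)) -> measurable_fun S (fun z => Num.sqrt (sqsum (w z) * dx)).
  move=> mw lw; apply: measurable_fun_sqrtr.
  apply: measurable_funM => //; apply: measurable_zsum => // i.
  exact: measurable_funX.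
(* The sampled solution and the error have integrable l2 norms, hence so has v; this dominates [g]
   and allows [Pi_op] to be integrated coordinatewise. *)
pose b z := Num.sqrt (sqsum (v z) * dx).
have ib : kap.-integrable S (EFin \o b).
  have := integrableZl_EFin mS 2 (integrableD_EFin mS
    (integrableZl_EFin mS 2 integrable_growth) ie).
  apply: (integrable_dominated mS); first exact: msq.
  move=> z Sz; rewrite ger0_norm; last exact: sqrtr_ge0.
  have [lUz Uz] := lU Sz.
  set n1 := Num.sqrt (sqsum (e z) * dx); set g1 := 2 * growth C a z.
  have n10 : 0 <= n1 by exact: sqrtr_ge0.
  have g10 : 0 <= g1 by rewrite mulr_ge0.
  rewrite -[leRHS]ger0_norm; last by rewrite mulr_ge0// addr_ge0.
  rewrite -sqrtr_sqr ler_wsqrtr//.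
  have eU : 0 <= sqsum (U z) * dx by rewrite mulr_ge0 ?sqsum_ge0// ltW.
  have ee : 0 <= sqsum (e z) * dx by rewrite mulr_ge0 ?sqsum_ge0//; [exact: le|exact: ltW].
  have hU : sqsum (U z) * dx <= g1 ^+ 2.
    by rewrite -[leLHS]sqr_sqrtr// ler_sqr ?nnegrE ?sqrtr_ge0.
  have he : sqsum (e z) * dx = n1 ^+ 2 by rewrite sqr_sqrtr.
  have hv : sqsum (v z) <= 2 * sqsum (U z) + 2 * sqsum (e z).
    apply: sqsum_le => n; apply: (@le_trans _ _ (2 * zbox n (fun i => U z i ^+ 2) +
      2 * zbox n (fun i => e z i ^+ 2))).
      rewrite -!zboxZ -zboxD; apply: ler_zbox => i; rewrite /e.
      by have := sqr_ge0 (2 * U z i - v z i); rewrite !expr2; lra.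
    have := zbox_le_sqsum n lUz; have := zbox_le_sqsum n (le z Sz); lra.
  apply: (@le_trans _ _ (2 * g1 ^+ 2 + 2 * n1 ^+ 2)).
    rewrite -he; have := ler_wpM2r (ltW dx0) hv.
    have -> : (2 * sqsum (U z) + 2 * sqsum (e z)) * dx =
        2 * (sqsum (U z) * dx) + 2 * (sqsum (e z) * dx) by ring.
    by move=> /le_trans; apply; rewrite lerD2r ler_wpM2l.
  by have := mulr_ge0 g10 n10; rewrite !expr2; lra.
pose g z := Pi_op M h dx y (v z).
have hg z : S z -> [/\ l2s (g z), tri_A M h dx y (g z) =1 explicit_B M h dx y (v z) &
    Num.sqrt (sqsum (g z)) <= (1 + 2 * h * L) / Num.sqrt dx * b z].
  move=> Sz; have [l1 l2 l3] := Pi_opP h0 dx0 zk kL (lv z Sz); split => //.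
  apply: le_trans l3 _; rewrite /b sqrtrM ?sqsum_ge0//; last exact: lv.
  by rewrite le_eqVlt; apply/orP; left; apply/eqP; field; rewrite gt_eqF.
have igb (w : R -> int -> R) (B : R) : (forall i, measurable_fun S (w^~ i)) ->
    (forall z, S z -> l2s (w z)) -> (forall z, S z -> Num.sqrt (sqsum (w z)) <= B * b z) ->
    forall i, kap.-integrable S (EFin \o (w^~ i)).
  move=> mw lw wb i; have := integrableZl_EFin mS B ib.
  apply: (integrable_dominated mS) => // z Sz.
  apply: le_trans (wb z Sz); apply: l2s_bounded; exact: lw.
have mg i : measurable_fun S (g^~ i).
  by apply: (@measurable_Pi_op _ _ _ _ _ _ _ (fun=> y)).
have ig : forall i, kap.-integrable S (EFin \o (g^~ i)).
  by apply: (igb g ((1 + 2 * h * L) / Num.sqrt dx) mg) => z /hg[].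
pose c2 n c := Num.sqrt (zbox n (fun i : int => c i ^+ 2)) : R.
have CS n c (w : int -> R) : l2s w -> zbox n (fun i => c i * w i) <=
    c2 n c * Num.sqrt (sqsum w).
  move=> lw; apply: le_trans (CauchySchwarz_zbox n c w) _.
  by rewrite ler_wpM2l ?sqrtr_ge0// ler_wsqrtr// zbox_le_sqsum.
(* Minkowski's integral inequality through duality: a finite pairing passes under the integral. *)
have lG : l2s (fun i => \int[kap]_(z in S) g z i).
  have [] // := @l2s_dual _ (fun i => \int[kap]_(z in S) g z i)
    ((1 + 2 * h * L) / Num.sqrt dx * \int[kap]_(z in S) b z).
    by rewrite mulr_ge0 ?divr_ge0 ?sqrtr_ge0// Rintegral_ge0// => z _; exact: sqrtr_ge0.
  move=> n c; rewrite -Rintegral_zbox//.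
  rewrite -RintegralZl// mulrC -RintegralZl//; last exact: integrableZl_EFin.
  apply: le_Rintegral => //.
  - exact: integrable_zbox.
  - by do 2!apply: integrableZl_EFin => //.
  - move=> z Sz; have [l1 _ l3] := hg z Sz.
    by apply: le_trans (CS n c _ l1) _; rewrite ler_wpM2l ?sqrtr_ge0.
have tT : 0 <= t <= horizon M by rewrite t0; have := thT; have := h0; lra.
have [lu _] := sampled_solution_l2 tT Dy dx0 dx1.
have lE : l2s E by apply: l2sD => //; exact: l2sN.
split => //.
have BB z i : S z -> explicit_B M h dx y (v z) i =
    explicit_B M h dx y (U z) i - explicit_B M h dx y (e z) i.
  move=> Sz; rewrite /explicit_B !jump_partE//; try exact: lv; try exact: le;
    try exact: (lU Sz).1.
  have zc (w : int -> R) : l2s w -> zabs (fun l => jump_weight M dx y l * w (i + l)).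
    by move=> lw; apply: (zabs_bddr zk) => l; exact: l2s_bounded.
  have -> : zconv (jump_weight M dx y) (v z) i = zconv (jump_weight M dx y) (U z) i
     + - 1 * zconv (jump_weight M dx y) (e z) i.
    rewrite /zconv -zsumZ; last by apply: zc; exact: le.
    rewrite -zsumD; last 2 first.
    - by apply: zc; exact: (lU Sz).1.
    - by apply: zabsZ; apply: zc; exact: le.
    by apply: eq_zsum => l; rewrite /e; ring.
  by rewrite /e; ring.
have lB (w : R -> int -> R) z : S z -> l2s (w z) -> l2s (explicit_B M h dx y (w z)) /\
    Num.sqrt (sqsum (explicit_B M h dx y (w z))) <= (1 + 2 * h * L) * Num.sqrt (sqsum (w z)).
  by move=> Sz lw; exact: explicit_B_l2 (ltW h0) zk kL lw.
have mB (w : R -> int -> R) i : (forall i, measurable_fun S (w^~ i)) ->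
    (forall z, S z -> l2s (w z)) -> measurable_fun S (fun z => explicit_B M h dx y (w z) i).
  by move=> mw lw; apply: (@measurable_explicit_B _ _ _ _ _ _ _ (fun=> y)).
have iB (w : R -> int -> R) (q : R -> R) : (forall i, measurable_fun S (w^~ i)) ->
    (forall z, S z -> l2s (w z)) -> (forall z, S z -> Num.sqrt (sqsum (w z) * dx) <= q z) ->
    kap.-integrable S (EFin \o q) ->
    forall i, kap.-integrable S (EFin \o (fun z => explicit_B M h dx y (w z) i)).
  move=> mw lw wq iq i.
  have := integrableZl_EFin mS ((1 + 2 * h * L) / Num.sqrt dx) iq.
  apply: (integrable_dominated mS); first exact: mB.
  move=> z Sz; have [l1 l2] := lB w z Sz (lw z Sz).
  apply: le_trans (l2s_bounded l1 i) (le_trans l2 _).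
  have -> : (1 + 2 * h * L) / Num.sqrt dx * q z = (1 + 2 * h * L) * (q z / Num.sqrt dx) by ring.
  apply: ler_wpM2l => //; rewrite ler_pdivlMr// -sqrtrM ?sqsum_ge0//; last exact: lw.
  exact: wq.
have iBU := iB U _ mU (fun z Sz => (lU Sz).1) (fun z Sz => (lU Sz).2)
  (integrableZl_EFin mS 2 integrable_growth).
have iBe := iB e _ me le (fun z _ => lexx _) ie.
have AE i : tri_A M h dx y E i = tri_A M h dx y (fun i => u t (grid X0 dx i) y) i
   - \int[kap]_(z in S) explicit_B M h dx y (U z) i
   + \int[kap]_(z in S) explicit_B M h dx y (e z) i.
  have -> : tri_A M h dx y E i = tri_A M h dx y (fun i => u t (grid X0 dx i) y) i
     - tri_A M h dx y (fun i => \int[kap]_(z in S) g z i) i.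
    by rewrite /tri_A /tri /E; ring.
  have -> : tri_A M h dx y (fun i => \int[kap]_(z in S) g z i) i =
      \int[kap]_(z in S) tri_A M h dx y (g z) i.
    by rewrite /tri_A (Rintegral_tri mS ig).
  rewrite -[RHS]addrA; congr (_ + _); rewrite addrC -[RHS]opprB.
  congr (- _); rewrite -RintegralB//; apply: eq_Rintegral => z; rewrite inE => Sz.
  by have [_ h2 _] := hg z Sz; rewrite -BB// -h2.
set I := \int[kap]_(z in S) _.
have I0 : 0 <= I by apply: Rintegral_ge0 => z _; exact: sqrtr_ge0.
have pair n c : zbox n (fun i => c i * tri_A M h dx y E i) <=
    (tau + (1 + 2 * h * L) * I) / Num.sqrt dx * c2 n c.
  have -> : zbox n (fun i => c i * tri_A M h dx y E i) =
      (zbox n (fun i => c i * tri_A M h dx y (fun i => u t (grid X0 dx i) y) i)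
      - \int[kap]_(z in S) zbox n (fun i => c i * explicit_B M h dx y (U z) i))
      + \int[kap]_(z in S) zbox n (fun i => c i * explicit_B M h dx y (e z) i).
    rewrite !(Rintegral_zbox mS)// -zboxN -!zboxD; apply: eq_zbox => i.
    by rewrite AE; ring.
  have sc : Num.sqrt (dx * zbox n (fun i => c i ^+ 2)) = Num.sqrt dx * c2 n c.
    by rewrite sqrtrM// ltW.
  rewrite mulrDl mulrDl; apply: lerD.
    have := consistency_pairing n c.
    rewrite RintegralZl//; last exact: integrable_zbox.
    rewrite -mulrBr sc mulrC -ler_pdivlMr// => /le_trans; apply.
    rewrite -[X in _ / X](sqr_sqrtr (ltW dx0)) le_eqVlt; apply/orP; left; apply/eqP.
    by field; rewrite gt_eqF.
  have -> : (1 + 2 * h * L) * I / Num.sqrt dx * c2 n c =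
      \int[kap]_(z in S) (((1 + 2 * h * L) / Num.sqrt dx * c2 n c) * Num.sqrt (sqsum (e z) * dx)).
    by rewrite RintegralZl// -/I; ring.
  apply: le_Rintegral => //; first exact: integrable_zbox.
    exact: integrableZl_EFin.
  move=> z Sz; have [l1 l2] := lB e z Sz (le z Sz).
  apply: le_trans (CS n c _ l1) _.
  rewrite sqrtrM ?sqsum_ge0//; last exact: le.
  apply: le_trans (ler_wpM2l (sqrtr_ge0 _) l2) _.
  by rewrite /c2 le_eqVlt; apply/orP; left; apply/eqP; field; rewrite gt_eqF.
have r0 : 0 <= r.
  apply: Rintegral_ge0 => z _; rewrite mulr_ge0 ?addr_ge0 ?sqr_ge0//.
  by rewrite (exprM _ 2 2) sqr_ge0.
have tau0 : 0 <= tau.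
  have T0 := horizon_gt0 hM; have L0' := L0; have CJ0' := CJ0.
  have k0 : 0 <= consistency_const M L CJ.
    by rewrite /consistency_const; have := mulr_ge0 L0' (ltW T0); lra.
  have h0' := ltW h0.
  apply: mulr_ge0 k0 _; apply: addr_ge0; last by rewrite mulr_ge0.
  apply: mulr_ge0; first by rewrite mulr_ge0.
  apply: addr_ge0; last by rewrite mulr_ge0 ?sqr_ge0.
  do 3!apply: addr_ge0 => //.
  apply: mulr_ge0; first exact: mulr_ge0 h0' (sqr_ge0 _).
  by rewrite !addr_ge0 ?sqr_ge0.
have tI0 : 0 <= tau + (1 + 2 * h * L) * I by rewrite addr_ge0// mulr_ge0.
have [lA sA] := l2s_dual (divr_ge0 tI0 (sqrtr_ge0 dx)) pair.
rewrite -[leRHS]ger0_norm// -sqrtr_sqr ler_wsqrtr// -ler_pdivlMr//.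
apply: le_trans (le_trans (sqsum_tri_ge (mx_alpha M h dx y) _ lE) sA) _.
  by rewrite mulr_ge0 ?sqr_ge0// divr_ge0 ?mulr_ge0 ?sqr_ge0// ltW.
by rewrite exprMn exprVn sqr_sqrtr// ltW.
Qed.

(* Where v z leaves l2, [Pi_op] is 0 by convention but the error norm on the
   right-hand side is +oo, so v z may be replaced there by 0. *)
Lemma one_step (v : R -> int -> R) :
  (forall i, measurable_fun S (v^~ i)) ->
  (l2norm dx (fun i => (u t (grid X0 dx i) y - \int[kap]_(z in S) Pi_op M h dx y (v z) i)%R)
   <= tau%:E + (1 + 2 * h * L)%R%:E *
      \int[kap]_(z in S) l2norm dx (fun i => (U z i - v z i)%R))%E.
Proof.
move=> mv; have hL0 : 0 < 1 + 2 * h * L.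
  by have := mulr_ge0 (ltW h0) L0; rewrite -mulrA; lra.
pose v' z := if `[< l2s (v z) >] then v z else fun=> 0.
have lv' z : l2s (v' z) by rewrite /v'; case: asboolP => // _; exact: l2s0.
have mv' i : measurable_fun S (v'^~ i).
  have mE : measurable (S `&` [set z | l2s (v z)]) by exact: measurable_l2s dx0 mv.
  have -> : S = (S `&` [set z | l2s (v z)]) `|` (S `\` [set z | l2s (v z)]) by rewrite setUIDK.
  apply/measurable_funU => //.
    rewrite (_ : _ `\` _ = S `\` (S `&` [set z | l2s (v z)])); first exact: measurableD.
    by apply/seteqP; split => z /=; tauto.
  split.
    apply: (eq_measurable_fun (v^~ i)); last exact: measurable_funS (mv i).
    by move=> z; rewrite inE => -[_ lz]; rewrite /v' asboolT.
  apply: (eq_measurable_fun (fun=> 0 : R)); last exact: measurable_cst.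
  by move=> z; rewrite inE => -[_ lz]; rewrite /v' asboolF.
have Pi0 i : Pi_op M h dx y (fun=> 0) i = 0.
  have [l1 _ l2] := Pi_opP h0 dx0 zk kL (@l2s0 R).
  have s0 : sqsum (fun=> 0 : R) <= 0.
    apply: sqsum_le => n; rewrite /zbox big1// => k _; rewrite expr2 mul0r; exact: addr0.
  have := l2s_bounded l1 i; rewrite (ler0_sqrtr s0) mulr0 in l2.
  by move=> /le_trans/(_ l2); rewrite normr_le0 => /eqP.
have PiE z i : Pi_op M h dx y (v z) i = Pi_op M h dx y (v' z) i.
  rewrite /v'; case: asboolP => // nl; rewrite Pi0.
  by rewrite (Pi_op_outside M h y dx0 nl).
under eq_fun do under eq_Rintegral do rewrite PiE.
pose e z i := U z i - v' z i.
have le z : S z -> l2s (e z) by move=> Sz; apply: l2sD; [exact: (lU Sz).1|exact: l2sN].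
have me i : measurable_fun S (e^~ i) by exact: measurable_funB.
have ele z : S z -> (l2norm dx (e z) <= l2norm dx (fun i => (U z i - v z i)%R))%E.
  move=> Sz; rewrite /e /v'; case: asboolP => // nl.
  suff -> : l2norm dx (fun i => (U z i - v z i)%R) = +oo%E by rewrite leey.
  apply/eqP; rewrite -leye_eq leNgt; apply/negP => /(in_l2P _ dx0) lz; apply: nl.
  have := l2sD (lU Sz).1 (l2sN lz).
  by congr (l2s _); apply/funext => i; ring.
have mU' i : measurable_fun S (fun z => U z i - v z i) by exact: measurable_funB.
have mn := measurable_l2norm dx0 mU'.
have mne := measurable_l2norm dx0 me.
have n0 (w : int -> R) : (0 <= l2norm dx w)%E by exact: poweR_ge0.
set I := (\int[kap]_(z in S) l2norm dx (fun i => (U z i - v z i)%R))%E.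
have I0 : (0 <= I)%E by exact: integral_ge0.
have [->|Ioo] := eqVneq I +oo%E.
  by rewrite gt0_muley ?lte_fin// addey ?leey.
have Ie : (\int[kap]_(z in S) l2norm dx (e z) <= I)%E by apply: ge0_le_integral.
have eE z : S z -> l2norm dx (e z) = (Num.sqrt (sqsum (e z) * dx))%:E.
  by move=> Sz; apply: l2normE => //; exact: le.
have ie : kap.-integrable S (EFin \o (fun z => Num.sqrt (sqsum (e z) * dx))).
  apply: (eq_integrable mS (fun z => l2norm dx (e z))).
    by move=> z; rewrite inE => Sz; rewrite eE.
  apply/integrableP; split => //.
  under eq_integral do rewrite gee0_abs//.
  by apply: le_lt_trans Ie _; rewrite ltey.
have [lE hE] := one_step_l2 mv' (fun z _ => lv' z) ie.
rewrite l2normE//.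
apply: (@le_trans _ _ (tau + (1 + 2 * h * L) *
    \int[kap]_(z in S) Num.sqrt (sqsum (e z) * dx))%:E); first by rewrite lee_fin.
set J := \int[kap]_(z in S) Num.sqrt (sqsum (e z) * dx).
set k := 1 + 2 * h * L; rewrite (EFinD tau) (EFinM k) leeD2l//.
apply: lee_wpmul2l; first by rewrite lee_fin ltW.
apply: le_trans Ie; rewrite /J /Rintegral fineK; last exact: integrable_fin_num.
by rewrite le_eqVlt; apply/orP; left; apply/eqP; apply: eq_integral => z /[!inE] Sz; rewrite eE.
Qed.

End at_point.

End one_step.

(** * Moments and error propagation *)

Section full_set.
Context {R : realType} {d : measure_display} {T : measurableType d}.
Variables (m : {measure set T -> \bar R}) (S : set T) (mS : measurable S).
Hypotheses (m1 : m [set: T] = 1%E) (mS1 : m S = 1%E).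

Lemma full_set_setC : m (~` S) = 0%E.
Proof.
have mC : measurable (~` S) by exact: measurableC.
have : m [set: T] = (m S + m (~` S))%E by rewrite -measureU ?setICr// setUv.
rewrite m1 mS1.
case: (m (~` S)) => [x||]//.
by rewrite -EFinD => /eqP; rewrite eqe -subr_eq0 opprD addrA subrr sub0r oppr_eq0 => /eqP ->.
Qed.

Let setCE : [set: T] `\` ~` S = S. Proof. by rewrite setDE setTI setCK. Qed.

(** The scheme integrates over the state space while conditional moments are integrals over the
    whole line; since the state space has full mass the two agree. *)
Lemma full_set_Rintegral f : m.-integrable [set: T] (EFin \o f) ->
  \int[m]_(x in S) f x = \int[m]_x f x.
Proof.
move=> i; rewrite /Rintegral [in RHS](@negligible_integral _ _ _ _ _ (~` S))//.
- by rewrite setCE.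
- exact: measurableC.
- exact: full_set_setC.
Qed.

End full_set.

Lemma Lnorm_moment {R : realType} {d : measure_display} {T : measurableType d}
    (P : {measure set T -> \bar R}) (g : T -> R) (p C : R) : 0 < p ->
  ('N[P]_(p%:E)[EFin \o g] <= C%:E)%E ->
  (\int[P]_x (`|g x| `^ p)%:E <= (C `^ p)%:E)%E.
Proof.
move=> p0 h; have C0 : 0 <= C by rewrite -lee_fin; apply: le_trans h; exact: Lnorm_ge0.
have := @gt0_ler_poweR R p (ltW p0) _ _ _ _ h.
rewrite poweR_Lnorm ?gt_eqF// poweR_EFin.
have -> : (\int[P]_x (`|g x| `^ p)%:E = \int[P]_x `|(EFin \o g) x| `^ p)%E by [].
by apply; rewrite in_itv/= leey andbT ?lee_fin// Lnorm_ge0.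
Qed.

Lemma Lnorm_natmoment {R : realType} {d : measure_display} {T : measurableType d}
    (P : {measure set T -> \bar R}) (g : T -> R) (p : nat) (C : R) : (0 < p)%N ->
  ('N[P]_(p%:R%:E)[EFin \o g] <= C%:E)%E ->
  (\int[P]_x (`|g x| ^+ p)%:E <= (C ^+ p)%:E)%E.
Proof.
move=> p0 h; have C0 : 0 <= C by rewrite -lee_fin; apply: le_trans h; exact: Lnorm_ge0.
have p0' : (0 : R) < p%:R by rewrite ltr0n.
have := Lnorm_moment p0' h; rewrite powR_mulrn//.
by under eq_integral do rewrite powR_mulrn//.
Qed.

Lemma exprn_le1D {R : realDomainType} (x : R) (m n : nat) : 0 <= x -> (m <= n)%N ->
  x ^+ m <= 1 + x ^+ n.
Proof.
move=> x0 mn; have [x1|x1] := leP x 1.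
  by rewrite (le_trans (exprn_ile1 m x0 x1))// lerDl exprn_ge0.
by rewrite (le_trans (ler_weXn2l (ltW x1) mn))// lerDr.
Qed.

(** * Polynomial weights and pointwise bounds on the one-step error *)

Section weight.
Context {R : realType}.

Definition weight (A : nat) (y : R) : R := 1 + `|y| ^+ A.

Lemma weight_ge1 A y : 1 <= weight A y.
Proof. by rewrite lerDl exprn_ge0. Qed.

(** The + 2 keeps the exponent above 1 even when A r = 0, as H2 provides moments for exponents above
    1 only. *)
Lemma weight_exp_le A r y : weight A y ^+ r <= 2 ^+ r * (2 + `|y| ^+ (A * r + 2)).
Proof.
have h : weight A y ^+ r <= 2 ^+ r * (1 + `|y| ^+ (A * r)).
  rewrite /weight exprM; set s := `|y| ^+ A; have s0 : 0 <= s by exact: exprn_ge0.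
  have [s1|s1] := leP s 1.
    apply: (@le_trans _ _ (2 ^+ r)).
      by apply: lerXn2r; rewrite ?nnegrE ?addr_ge0//; lra.
    by rewrite ler_peMr ?exprn_ge0// lerDl exprn_ge0.
  apply: (@le_trans _ _ ((2 * s) ^+ r)).
    by apply: lerXn2r; rewrite ?nnegrE ?addr_ge0 ?mulr_ge0//; lra.
  by rewrite exprMn ler_wpM2l ?exprn_ge0// lerDr.
apply: le_trans h _; rewrite ler_wpM2l ?exprn_ge0//.
have := @exprn_le1D R `|y| (A * r) (A * r + 2) (normr_ge0 y) (leq_addr _ _); lra.
Qed.

(** The constant is the same for all large A, so that one exponent can later serve several functions
    at once. *)
Lemma polynomial_growth_weight (D : set R) (g : R -> R) : polynomial_growth D g ->
  exists K A0, 0 < K /\ forall A, (A0 <= A)%N -> forall y, D y -> `|g y| <= K * weight A y.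
Proof.
move=> [C [a [C0 a0 h]]]; exists (2 * C), (Num.truncn a).+1; split; first by rewrite mulr_gt0.
move=> A hA y Dy; apply: le_trans (h y Dy) _; rewrite /weight.
suff : `|y| `^ a <= 1 + `|y| ^+ A.
  move=> hy; have h0 : 0 <= `|y| ^+ A by exact: exprn_ge0.
  by rewrite [2 * C]mulrC -mulrA ler_wpM2l ?(ltW C0)//; lra.
have aA : a <= A%:R.
  have /andP[_ /ltW h1] := truncn_itv (ltW a0).
  by apply: le_trans h1 _; rewrite ler_nat.
have [y1|y1] := leP `|y| 1.
  apply: (@le_trans _ _ 1); last by rewrite lerDl exprn_ge0.
  by have := ge0_ler_powR (ltW a0) (normr_ge0 y) (ler01 : 0 <= (1 : R)) y1; rewrite powR1.
rewrite -powR_mulrn//; apply: (@le_trans _ _ (`|y| `^ A%:R)); last by rewrite lerDr.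
by apply: ler_powR => //; exact: ltW.
Qed.

End weight.

(** Young's inequality for the conjugate exponents p/(p-1) and p, with the factors 1/q, 1/p <= 1
    dropped. *)
Lemma young_le {R : realType} (g x p : R) : 1 < p -> 0 <= g -> 0 <= x ->
  g * x <= g `^ (p / (p - 1)) + x `^ p.
Proof.
move=> p1 g0 x0; set q := p / (p - 1).
have p10 : 0 < p - 1 by rewrite subr_gt0.
have p0 : 0 < p by apply: lt_trans p1.
have q1 : 1 <= q by rewrite ler_pdivlMr// mul1r; lra.
have q0 : 0 < q by apply: lt_le_trans q1.
have e : q^-1 + p^-1 = 1 by rewrite /q invf_div; field; rewrite gt_eqF.
apply: le_trans (conjugate_powR g0 x0 q0 p0 e) _.
apply: lerD; rewrite ler_pdivrMr// ler_peMr ?powR_ge0//; exact: ltW.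
Qed.

(** K0 (1 + K0 + K0^2) comes from the x-discretization, 3 K0^r from the three moment defects, K0^2
    from the drift of the chain; the 1 covers the p-th powers of the defects. *)
Definition error_scale {R : realType} (M : jump_model R) (L CJ K0 : R) (r : nat) : R :=
  consistency_const M L CJ * (2 * (K0 * (1 + K0 + K0 ^+ 2) + 3 * K0 ^+ r + K0 ^+ 2 + 1)).

Section pointwise.
Context {R : realType}.
Variables (M : jump_model R) (C a L CJ K0 h dx p : R) (A r : nat) (y : R).
Hypotheses (T0 : 0 < horizon M) (C0 : 0 <= C) (L0 : 0 <= L) (CJ0 : 0 <= CJ) (h0 : 0 < h)
  (dx0 : 0 < dx).
Hypotheses (K1 : 1 <= K0) (p1 : 1 < p) (r3 : (3 <= r)%N) (rp : p / (p - 1) <= r%:R).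
Hypothesis gK : forall z, growth C a z <= K0 * weight A z.

Lemma consistency_const_ge0 : 0 <= consistency_const M L CJ.
Proof.
have T0' := T0; have L0' := L0; have CJ0' := CJ0.
by rewrite /consistency_const; have := mulr_ge0 L0' (ltW T0'); lra.
Qed.

Let K00 : 0 <= K0. Proof. by apply: le_trans K1. Qed.

(* The exponent p of H1 enters through Young's inequality instead of Hoelder's,
   which keeps the bound pointwise. *)
Lemma step_error_le (fh gh jh rem : R) :
  `|muX M y| <= K0 * weight A y -> `|muY M y| <= K0 * weight A y ->
  `|sigmaX M y| <= K0 * weight A y ->
  step_error M C a L CJ h dx y fh gh jh rem <=
    error_scale M L CJ K0 r * (h * (h + dx ^+ 2)) * (weight A y ^+ r +
      ((`|fh| / h ^+ 2) `^ p + (`|gh| / h ^+ 2) `^ p + (`|jh| / h ^+ 2) `^ p))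
    + 2 * consistency_const M L CJ * rem.
Proof.
move=> mX mY sX; have k0 := consistency_const_ge0; have hh := h0.
set w := weight A y; have w1 : 1 <= w by exact: weight_ge1.
have w0 : 0 <= w by apply: le_trans w1.
have wr k : (k <= r)%N -> w ^+ k <= w ^+ r by exact: ler_weXn2l.
set g := growth C a y; have g0 : 0 <= g by exact: growth_ge0.
have gw : g <= K0 * w by exact: gK.
have h20 : 0 < h ^+ 2 by exact: exprn_gt0.
set F := fun x : R => (`|x| / h ^+ 2) `^ p.
have F0 x : 0 <= F x by exact: powR_ge0.
(* h^2 is the size that H1 gives to the defects, so the quotient by h^2 has a bounded p-th
   moment. *)
have gF x : g * `|x| <= h ^+ 2 * (K0 ^+ r * w ^+ r + F x).
  have -> : g * `|x| = h ^+ 2 * (g * (`|x| / h ^+ 2)) by field; rewrite gt_eqF.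
  apply: ler_wpM2l; first exact: ltW.
  apply: le_trans (young_le p1 g0 _) _; first by rewrite divr_ge0// ltW.
  rewrite lerD2r; have Kw1 : 1 <= K0 * w by rewrite -[1]mulr1 ler_pM.
  have q0 : 0 <= p / (p - 1) by rewrite divr_ge0//; have := p1; lra.
  apply: (@le_trans _ _ ((K0 * w) `^ (p / (p - 1)))).
    exact: (ge0_ler_powR q0 g0 (mulr_ge0 K00 w0) gw).
  apply: (@le_trans _ _ ((K0 * w) `^ r%:R)); first exact: ler_powR.
  by rewrite powR_mulrn ?mulr_ge0// exprMn.
set H := h * (h + dx ^+ 2).
have h0' : 0 <= h by exact: ltW.
have dx2 : 0 <= dx ^+ 2 by exact: sqr_ge0.
have H1 : h ^+ 2 <= H by rewrite /H (expr2 h); apply: ler_wpM2l => //; rewrite lerDl.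
have H2 : h * dx ^+ 2 <= H by rewrite /H; apply: ler_wpM2l => //; rewrite lerDr.
have H0 : 0 <= H by apply: le_trans H1; exact: ltW.
have s2 : sigmaX M y ^+ 2 <= K0 ^+ 2 * w ^+ 2.
  rewrite -exprMn -[leLHS](real_normK (num_real _)).
  by apply: lerXn2r; rewrite ?nnegrE ?mulr_ge0.
have t1 : g * (h * dx ^+ 2 * (1 + `|muX M y| + sigmaX M y ^+ 2)) <=
    H * (K0 * (1 + K0 + K0 ^+ 2) * w ^+ r).
  rewrite mulrCA; apply: ler_pM => //.
  - by rewrite mulr_ge0// ltW.
  - by rewrite mulr_ge0// !addr_ge0// sqr_ge0.
  - apply: (@le_trans _ _ ((K0 * w) * ((1 + K0 + K0 ^+ 2) * w ^+ 2))).
      apply: ler_pM => //; first by rewrite !addr_ge0// sqr_ge0.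
      have : 1 <= w ^+ 2 by rewrite exprn_ege1.
      have : w <= w ^+ 2 by rewrite ler_eXnr.
      rewrite !mulrDl mul1r => ww w2; apply: lerD => //; apply: lerD => //.
      by apply: le_trans mX _; rewrite ler_wpM2l.
    have -> : K0 * w * ((1 + K0 + K0 ^+ 2) * w ^+ 2) = K0 * (1 + K0 + K0 ^+ 2) * w ^+ 3 by ring.
    by rewrite ler_wpM2l ?wr// mulr_ge0// !addr_ge0// sqr_ge0.
have t2 : g * (h ^+ 2 * `|muY M y|) <= H * (K0 ^+ 2 * w ^+ r).
  rewrite mulrCA; apply: ler_pM => //; [exact: ltW|exact: mulr_ge0|].
  apply: (@le_trans _ _ ((K0 * w) * (K0 * w))); first exact: ler_pM.
  have -> : K0 * w * (K0 * w) = K0 ^+ 2 * w ^+ 2 by ring.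
  by rewrite ler_wpM2l ?sqr_ge0// wr// ltnW.
have t3 x : g * `|x| <= H * (K0 ^+ r * w ^+ r + F x).
  apply: le_trans (gF x) _; rewrite ler_wpM2r// addr_ge0// mulr_ge0//; exact: exprn_ge0.
have t3f := t3 fh; have t3g := t3 gh; have t3j := t3 jh.
rewrite /step_error /error_scale -/g -/w -/H -/(F fh) -/(F gh) -/(F jh).
set k := consistency_const M L CJ in k0 *.
rewrite mulrDr; apply: lerD; last by rewrite mulrCA mulrA.
have wr0 : 0 <= w ^+ r by exact: exprn_ge0.
have Kr0 : 0 <= K0 ^+ r by exact: exprn_ge0.
set c := K0 * (1 + K0 + K0 ^+ 2) in t1 *.
have c0 : 0 <= c by rewrite mulr_ge0// !addr_ge0// sqr_ge0.
clearbody g w H F c k.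
set X := h * dx ^+ 2 * _ + _ + _ + _ + _; set Z := w ^+ r + _.
have -> : k * (2 * g * X) = k * 2 * (g * X) by ring.
have -> : k * (2 * (c + 3 * K0 ^+ r + K0 ^+ 2 + 1)) * H * Z =
  k * 2 * (H * ((c + 3 * K0 ^+ r + K0 ^+ 2 + 1) * Z)) by ring.
apply: ler_wpM2l; first exact: mulr_ge0.
rewrite /X /Z {X Z}; apply: (@le_trans _ _ (H * (c * w ^+ r) + (H * (K0 ^+ r * w ^+ r + F fh)
   + H * (K0 ^+ r * w ^+ r + F gh) + H * (K0 ^+ r * w ^+ r + F jh)) + H * (K0 ^+ 2 * w ^+ r))).
  rewrite 4!(mulrDr g); apply: lerD t2.
  rewrite [leRHS]addrA [in leRHS]addrA; apply: lerD t3j; apply: lerD t3g.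
  exact: lerD t1 t3f.
have -> : H * (c * w ^+ r) + (H * (K0 ^+ r * w ^+ r + F fh)
   + H * (K0 ^+ r * w ^+ r + F gh) + H * (K0 ^+ r * w ^+ r + F jh)) + H * (K0 ^+ 2 * w ^+ r) =
   H * ((c + 3 * K0 ^+ r + K0 ^+ 2) * w ^+ r + (F fh + F gh + F jh)) by ring.
apply: ler_wpM2l => //.
set s := F fh + F gh + F jh; have s0 : 0 <= s by rewrite !addr_ge0.
set k1 := c + 3 * K0 ^+ r + K0 ^+ 2.
have k10 : 0 <= k1 by rewrite !addr_ge0 ?mulr_ge0 ?sqr_ge0.
rewrite mulrDr; apply: lerD; first by rewrite ler_wpM2r// lerDl.
by rewrite ler_peMl// lerDr.
Qed.

(** With s = (z - y)^4 / h^2 the remainder is h^2 (1 + s) times a weight, and squares separate the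
    product of weight and s. This is where the eighth moment comes from: s^2 has bounded expectation
    when increments are of order sqrt h in L^8. *)
Lemma remainder_bound_le z : remainder_bound (growth C a) h y z <=
  K0 * h ^+ 2 * (2 * weight A y ^+ r + 2 * weight A z ^+ r + `|z - y| ^+ 8 / h ^+ 4).
Proof.
set w := weight A y; set w' := weight A z.
have w1 : 1 <= w by exact: weight_ge1. have w'1 : 1 <= w' by exact: weight_ge1.
have wr : w ^+ 2 <= w ^+ r by apply: ler_weXn2l => //; exact: ltnW.
have w'r : w' ^+ 2 <= w' ^+ r by apply: ler_weXn2l => //; exact: ltnW.
have h2 : 0 < h ^+ 2 by exact: exprn_gt0.
set s := (z - y) ^+ 4 / h ^+ 2.
have d0 : 0 <= (z - y) ^+ 4 by rewrite (exprM _ 2 2) sqr_ge0.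
have s0 : 0 <= s by rewrite divr_ge0// ltW.
have -> : `|z - y| ^+ 8 / h ^+ 4 = s ^+ 2.
  rewrite /s exprMn exprVn -!exprM; congr (_ / _).
  by rewrite -normrX ger0_norm// (exprM _ 4 2) sqr_ge0.
have e : h ^+ 2 + (z - y) ^+ 4 = h ^+ 2 * (1 + s) by rewrite /s; field; rewrite gt_eqF.
rewrite /remainder_bound e mulrCA [K0 * h ^+ 2]mulrC -[leRHS]mulrA.
apply: ler_wpM2l; first exact: ltW.
apply: (@le_trans _ _ (K0 * (w + w') * (1 + s))).
  by apply: ler_wpM2r; [rewrite addr_ge0|rewrite mulrDr lerD].
rewrite -mulrA; apply: ler_wpM2l; first exact: le_trans K1.
have := sqr_ge0 (w + w' - s); have := sqr_ge0 (w - w'); have := sqr_ge0 s.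
have ww : w <= w ^+ 2 by rewrite ler_eXnr.
have ww' : w' <= w' ^+ 2 by rewrite ler_eXnr.
move: wr w'r ww ww' => /=; move: (w ^+ r) (w' ^+ r) => x x'; clearbody w w' s.
by rewrite !expr2 => *; lra.
Qed.

End pointwise.

Lemma measurable_growth {R : realType} (C a : R) : measurable_fun [set: R] (growth C a).
Proof.
apply: measurable_funM => //; apply: measurable_funD => //.
apply: (measurableT_comp (f := fun s : R => s `^ a)); first exact: measurable_powR.
exact: normr_measurable.
Qed.

Lemma measurable_remainder_bound {R : realType} (C a h : R) :
  measurable_fun [set: R * R] (fun z => remainder_bound (growth C a) h z.1 z.2).
Proof.
have m1 := measurable_growth C a.
apply: measurable_funM.
  by apply: measurable_funD; exact: measurableT_comp.
apply: measurable_funD => //; apply: measurable_funX; exact: measurable_funB.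
Qed.

Section integral_bounds.
Context {R : realType} {d : measure_display} {T : measurableType d}.
Variable m : {measure set T -> \bar R}.

Lemma integral_le_add (g1 g2 : T -> R) (b1 b2 : R) :
  measurable_fun [set: T] g1 -> measurable_fun [set: T] g2 ->
  (forall x, 0 <= g1 x) -> (forall x, 0 <= g2 x) ->
  (\int[m]_x (g1 x)%:E <= b1%:E)%E -> (\int[m]_x (g2 x)%:E <= b2%:E)%E ->
  (\int[m]_x (g1 x + g2 x)%:E <= (b1 + b2)%:E)%E.
Proof.
move=> m1 m2 g10 g20 h1 h2; under eq_integral do rewrite EFinD.
rewrite ge0_integralD//; last 4 first.
- by move=> x _; rewrite lee_fin.
- exact/measurable_EFinP.
- by move=> x _; rewrite lee_fin.
- exact/measurable_EFinP.
by rewrite EFinD leeD.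
Qed.

Lemma integral_le_scale (k : R) (g : T -> R) (b : R) : 0 <= k ->
  measurable_fun [set: T] g -> (forall x, 0 <= g x) ->
  (\int[m]_x (g x)%:E <= b%:E)%E -> (\int[m]_x (k * g x)%:E <= (k * b)%:E)%E.
Proof.
move=> k0 mg g0 h; under eq_integral do rewrite EFinM.
rewrite ge0_integralZl_EFin//; last 2 first.
- by move=> x _; rewrite lee_fin.
- exact/measurable_EFinP.
by rewrite EFinM lee_wpmul2l// lee_fin.
Qed.

Lemma integral_le_mono (g1 g2 : T -> R) (b : R) :
  measurable_fun [set: T] g1 -> measurable_fun [set: T] g2 ->
  (forall x, 0 <= g1 x) -> (forall x, g1 x <= g2 x) ->
  (\int[m]_x (g2 x)%:E <= b%:E)%E -> (\int[m]_x (g1 x)%:E <= b%:E)%E.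
Proof.
move=> m1 m2 g10 g12; apply: le_trans; apply: ge0_le_integral => //.
- by move=> x _; rewrite lee_fin.
- exact/measurable_EFinP.
- exact/measurable_EFinP.
- by move=> x _; rewrite lee_fin.
Qed.

End integral_bounds.

(** [B] bounds the moments of the weight, [Cf] is the constant of H1 and [C8] that of H2 for
    increments in L^8. *)
Definition step_const {R : realType} (M : jump_model R) (L CJ K0 : R) (r : nat)
    (B C8 Cf p : R) : R :=
  error_scale M L CJ K0 r * (B + (Cf `^ p + Cf `^ p + Cf `^ p))
  + 2 * consistency_const M L CJ * (K0 * (2 * B + 2 * B + C8 ^+ 8)).

(** * The error recursion along the chain, in expectation *)

Section chain_step.
Context {R : realType} {d : measure_display} {Omega : measurableType d}.
Variables (P : probability Omega R).
Variables (M : jump_model R) (f : R -> R -> R) (u : R -> R -> R -> R).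
Variables (V : nat -> nat -> nat -> R -> R -> R -> R) (C a L CJ X0 Y0 : R).
Hypotheses (hM : model_hypotheses M) (hV : is_partials M 6 u V)
  (hp : solves_pide M f u) (C0 : 0 < C) (a0 : 0 < a).
Hypothesis hL : forall k m l, (2 * k + m + l <= 6)%N -> forall t y,
      0 <= t -> t < horizon M -> dom M y ->
      ('N[lebesgue_measure]_(2%:E)[EFin \o (V k m l t ^~ y)] <= (C * (1 + `|y| `^ a))%:E)%E.
Hypotheses (L0 : 0 <= L) (CJ0 : 0 <= CJ).
Hypothesis hJ : forall dx y, 0 < dx -> dx <= 1 -> dom M y ->
  [/\ zabs (jump_weight M dx y), zsum (fun l => `|jump_weight M dx y l|) <= L &
    forall (g g1 g2 : R -> R) (q : R),
      (forall x : R, is_derive x 1 g (g1 x)) ->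
      (forall x : R, is_derive x 1 g1 (g2 x)) ->
      (forall x, `|g x| <= q) -> (forall x, `|g1 x| <= q) ->
      (forall x, `|g2 x| <= q) ->
      `|nonlocal M g 0 y -
        zsum (fun l => jump_weight M dx y l * (g (l%:~R * dx) - g 0))|
        <= CJ * q * dx ^+ 2].
Variables (N : nat) (dx : R) (St : nat -> set R) (K : nat -> R.-pker R ~> R)
  (Y : nat -> Omega -> R).
Hypotheses (N0 : (0 < N)%N) (dx0 : 0 < dx) (dx1 : dx <= 1).
Hypothesis hc : markov_chain P M Y0 N St K Y.
Let h := step M N.

Lemma step_gt0 : 0 < h.
Proof. by rewrite divr_gt0 ?ltr0n// (horizon_gt0 hM). Qed.

Lemma step_horizon : N%:R * h = horizon M.
Proof. by rewrite mulrC divfK// pnatr_eq0 -lt0n. Qed.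

Lemma chain_kernel_law n A B : (n < N)%N -> measurable A -> measurable B ->
  P (Y n @^-1` A `&` Y n.+1 @^-1` B) = (\int[P]_(w in Y n @^-1` A) K n (Y n w) B)%E.
Proof.
move=> nN mA mB; have [_ _ _ _ h5] := hc; apply: h5 => //.
by apply: sub_sigma_algebra; exists n, A; split => //=.
Qed.

Lemma chain_measurable n : (n <= N)%N -> measurable_fun [set: Omega] (Y n).
Proof. by have [_ h2 _ _ _] := hc => nN; have [] := h2 n nN. Qed.

Lemma chain_St n w : (n <= N)%N -> St n (Y n w).
Proof. by have [_ h2 _ _ _] := hc => nN; have [_ +] := h2 n nN; exact. Qed.

Lemma St_measurable n : (n <= N)%N -> measurable (St n).
Proof. by have [h1 _ _ _ _] := hc => nN; have [] := h1 n nN. Qed.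

Lemma St_dom n : (n <= N)%N -> St n `<=` dom M.
Proof. by have [h1 _ _ _ _] := hc => nN; have [] := h1 n nN. Qed.

Lemma chain_kernel_full n w : (n < N)%N -> K n (Y n w) (St n.+1) = 1%E.
Proof.
by have [_ _ _ h4 _] := hc => nN; apply: h4 => //; apply: chain_St; exact: ltnW.
Qed.

Definition error n y i :=
  u (n%:R * h) (grid X0 dx i) y - backward M X0 f N dx St K (N - n)%N i y.

Definition error_norm n y := l2norm dx (error n y).

Lemma error_norm_ge0 n y : (0 <= error_norm n y)%E.
Proof. exact: poweR_ge0. Qed.

Lemma measurable_numerical n i : (n <= N)%N ->
  measurable_fun (St n) (backward M X0 f N dx St K (N - n)%N i).
Proof.
move=> nN; have := @measurable_backward _ M X0 f N dx St K (N - n)%N i.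
rewrite subKn//; apply => //.
- by move=> x; exact: measurable_payoff hM hV hp.
- by move=> y Dy; have [] := hJ dx0 dx1 Dy.
- by move=> k kN; split; [exact: St_measurable|exact: St_dom].
- exact: leq_subr.
Qed.

Lemma measurable_error_norm n : (n <= N)%N -> measurable_fun (St n) (error_norm n).
Proof.
move=> nN; apply: measurable_l2norm => // i.
apply: measurable_funB; last exact: measurable_numerical.
have mdom : measurable (dom M).
  by apply: is_interval_measurable; exact: domain_is_interval (dom_convex hM).
apply: (measurable_funS mdom (St_dom nN)).
have := nN; rewrite leq_eqVlt => /predU1P[->|nN'].
  apply: (eq_measurable_fun (f (grid X0 dx i))).
    move=> z; rewrite inE => Dz; rewrite step_horizon.
    by have [->] := hp.2 (grid X0 dx i) z Dz.
  exact: measurable_payoff hM hV hp.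
apply: measurable_solution hM hV _.
by rewrite mulr_ge0 ?(ltW step_gt0)//= -step_horizon ltr_pM2r ?step_gt0// ltr_nat.
Qed.

(** The deterministic one-step estimate, applied at almost every w to the kernel [K n (Y n w)]. The
    exceptional null set is where conditional expectations fail to be kernel moments or the
    remainder is not integrable. *)
Lemma chain_step_ae n (fh gh jh : R -> R) : (n < N)%N ->
  is_cond_exp P (fun w => Y n.+1 w - Y n w) (Y n) (fun w => muY M (Y n w) * h + fh (Y n w)) ->
  is_cond_exp P (fun w => (Y n.+1 w - Y n w) ^+ 2) (Y n)
    (fun w => sigmaY M (Y n w) ^+ 2 * h + gh (Y n w)) ->
  is_cond_exp P (fun w => (Y n.+1 w - Y n w) ^+ 3) (Y n) (fun w => jh (Y n w)) ->
  P.-integrable [set: Omega]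
    (fun w => (remainder_bound (growth C a) h (Y n w) (Y n.+1 w))%:E) ->
  {ae P, forall w, exists2 r,
    (r%:E = \int[K n (Y n w)]_z (remainder_bound (growth C a) h (Y n w) z)%:E)%E &
    (error_norm n (Y n w) <=
      (step_error M C a L CJ h dx (Y n w) (fh (Y n w)) (gh (Y n w)) (jh (Y n w)) r)%:E +
      (1 + 2 * h * L)%R%:E * \int[K n (Y n w)]_(z in St n.+1) error_norm n.+1 z)%E}.
Proof.
move=> nN c1 c2 c3 ir.
have mYn := chain_measurable (ltnW nN); have mYn1 := chain_measurable nN.
have hK A B : measurable A -> measurable B -> P (Y n @^-1` A `&` Y n.+1 @^-1` B) =
    (\int[P]_(w in Y n @^-1` A) K n (Y n w) B)%E by exact: chain_kernel_law.
have md : measurable_fun setT (fun z : R * R => z.2 - z.1) by exact: measurable_funB.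
have k1 := cond_exp_kernel mYn mYn1 hK md c1.
have k2 := cond_exp_kernel mYn mYn1 hK (measurable_funX 2 md) c2.
have k3 := cond_exp_kernel mYn mYn1 hK (measurable_funX 3 md) c3.
have mr := measurable_remainder_bound C a h.
have mer : measurable_fun setT
  (fun z : R * R => (remainder_bound (growth C a) h z.1 z.2)%:E) by exact/measurable_EFinP.
have growth0 z : 0 <= growth C a z by apply: growth_ge0; exact: ltW.
have r0 y z : 0 <= remainder_bound (growth C a) h y z.
  rewrite mulr_ge0 ?addr_ge0 ?sqr_ge0//.
  by rewrite (exprM _ 2 2) sqr_ge0.
have er0 (z : R * R) : (0 <= (remainder_bound (growth C a) h z.1 z.2)%:E)%E by rewrite lee_fin.
have mkr := measurable_fun_integral_finite_kernel _ (K n) er0 mer.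
have k4 : {ae P, forall w, setT w ->
    (\int[K n (Y n w)]_z (remainder_bound (growth C a) h (Y n w) z)%:E)%E \is a fin_num}.
  apply: integrable_ae => //; apply/integrableP; split.
    exact: (measurableT_comp mkr mYn).
  under eq_integral.
    move=> w _; rewrite gee0_abs; last by apply: integral_ge0 => z _; rewrite lee_fin.
    over.
  rewrite -(ge0_integral_pair_law mYn mYn1 hK er0 mer) /=.
  move/integrableP : ir => [_]; congr (_ < _)%E; apply: eq_integral => w _.
  by rewrite gee0_abs// lee_fin.
apply: filterS2 (filterI k1 k2) (filterI k3 k4) => w [[j1 e1] [j2 e2]] [[j3 e3] /(_ I) fr].
have mS := St_measurable nN; have SD := St_dom nN.
have kS := chain_kernel_full w nN.
have kT : K n (Y n w) setT = 1%E by exact: prob_kernel.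
have jr : (K n (Y n w)).-integrable setT
    (EFin \o remainder_bound (growth C a) h (Y n w)).
  apply/integrableP; split.
    exact: (measurableT_comp mer (pair1_measurable (Y n w))).
  under eq_integral => z _ do rewrite gee0_abs ?lee_fin//.
  by rewrite ltey_eq fr.
have sub g : (K n (Y n w)).-integrable setT g -> (K n (Y n w)).-integrable (St n.+1) g.
  by apply: integrableS => //; exact: measurableT.
exists (\int[K n (Y n w)]_(z in St n.+1) remainder_bound (growth C a) h (Y n w) z).
  by rewrite (full_set_Rintegral mS kT kS jr) /Rintegral fineK.
have Dy : dom M (Y n w) by apply: St_dom (chain_St w (ltnW nN)); exact: ltnW.
have tn : 0 <= n%:R * h by rewrite mulr_ge0// ltW// step_gt0.
have tS : n%:R * h + h = n.+1%:R * h by rewrite -natr1 mulrDl mul1r.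
have tT : n%:R * h + h <= horizon M.
  by rewrite tS -step_horizon ler_pM2r ?step_gt0// ler_nat.
have := @one_step _ M f u V C a L CJ X0 hM hV hp C0 a0 hL L0 CJ0 hJ (n%:R * h) h dx (Y n w)
  (K n (Y n w)) (St n.+1) (fh (Y n w)) (gh (Y n w)) (jh (Y n w))
  tn step_gt0 tT dx0 dx1 Dy mS SD kS (sub _ j1) (sub _ j2) (sub _ j3) (sub _ jr).
rewrite (full_set_Rintegral mS kT kS j1) (full_set_Rintegral mS kT kS j2)
  (full_set_Rintegral mS kT kS j3).
move=> /(_ e1 e2 e3 (fun z i => backward M X0 f N dx St K (N - n.+1)%N i z)) H.
have := H (fun i => measurable_numerical i nN).
rewrite tS; apply: le_trans; rewrite le_eqVlt; apply/orP; left; apply/eqP.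
congr (l2norm dx _); apply/funext => i; rewrite /error.
(* Layer n is [backward] at the successor depth of layer n.+1, so one unfolding exposes the integral
   over [St n.+1]. *)
have -> : (N - n = (N - n.+1).+1)%N by rewrite subnSK.
rewrite /= subnSK// subKn; last exact: ltnW.
by rewrite subKn.
Qed.

(** Taking expectations makes up for the growth in y: the weights, the defects of H1 and the
    remainder all have moments bounded uniformly in n, and disintegration turns the kernel integral
    of the next error into its expectation. *)
Lemma expectation_step n (fh gh jh : R -> R) (K0 p B C8 Cf : R) (A r : nat) : (n < N)%N ->
  is_cond_exp P (fun w => Y n.+1 w - Y n w) (Y n) (fun w => muY M (Y n w) * h + fh (Y n w)) ->
  is_cond_exp P (fun w => (Y n.+1 w - Y n w) ^+ 2) (Y n)
    (fun w => sigmaY M (Y n w) ^+ 2 * h + gh (Y n w)) ->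
  is_cond_exp P (fun w => (Y n.+1 w - Y n w) ^+ 3) (Y n) (fun w => jh (Y n w)) ->
  1 <= K0 -> 1 < p -> (3 <= r)%N -> p / (p - 1) <= r%:R ->
  (forall z, growth C a z <= K0 * weight A z) ->
  (forall z, dom M z -> [/\ `|muX M z| <= K0 * weight A z,
     `|muY M z| <= K0 * weight A z & `|sigmaX M z| <= K0 * weight A z]) ->
  (forall k, (k <= N)%N -> (\int[P]_w (weight A (Y k w) ^+ r)%:E <= B%:E)%E) ->
  (\int[P]_w (`|Y n.+1 w - Y n w| ^+ 8)%:E <= ((C8 * Num.sqrt h) ^+ 8)%:E)%E ->
  0 <= Cf ->
  (\int[P]_w (`|fh (Y n w)| `^ p)%:E <= ((Cf * h ^+ 2) `^ p)%:E)%E ->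
  (\int[P]_w (`|gh (Y n w)| `^ p)%:E <= ((Cf * h ^+ 2) `^ p)%:E)%E ->
  (\int[P]_w (`|jh (Y n w)| `^ p)%:E <= ((Cf * h ^+ 2) `^ p)%:E)%E ->
  (\int[P]_w error_norm n (Y n w) <=
   (step_const M L CJ K0 r B C8 Cf p * (h * (h + dx ^+ 2)))%:E +
   (1 + 2 * h * L)%R%:E * \int[P]_w error_norm n.+1 (Y n.+1 w))%E.
Proof.
move=> nN c1 c2 c3 K1 p1 r3 rp gK dK mB m8 Cf0 hf hg hj.
have K00 : 0 <= K0 by exact: le_trans K1.
have h0 : 0 < h := step_gt0; have T0 := horizon_gt0 hM.
have h20 : 0 < h ^+ 2 by exact: exprn_gt0.
have nN' := ltnW nN.
have mYn := chain_measurable nN'; have mYn1 := chain_measurable nN.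
have hK A' B' : measurable A' -> measurable B' -> P (Y n @^-1` A' `&` Y n.+1 @^-1` B') =
    (\int[P]_(w in Y n @^-1` A') K n (Y n w) B')%E by exact: chain_kernel_law.
have mweight : measurable_fun setT (fun y : R => weight A y ^+ r).
  apply: measurable_funX; apply: measurable_funD => //; apply: measurable_funX.
  exact: normr_measurable.
have mw k : (k <= N)%N -> measurable_fun setT (fun w => weight A (Y k w) ^+ r).
  by move=> kN; exact: (measurableT_comp mweight (chain_measurable kN)).
have weight0 (y : R) : 0 <= weight A y ^+ r.
  by rewrite exprn_ge0//; apply: le_trans (weight_ge1 A y).
have mdY : measurable_fun setT (fun w => `|Y n.+1 w - Y n w| ^+ 8).
  by apply: measurable_funX; apply: measurableT_comp => //; exact: measurable_funB.
have mr := measurable_remainder_bound C a h.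
have mer : measurable_fun setT
  (fun z : R * R => (remainder_bound (growth C a) h z.1 z.2)%:E) by exact/measurable_EFinP.
have r0 y z : 0 <= remainder_bound (growth C a) h y z.
  have growth0 t : 0 <= growth C a t by apply: growth_ge0; exact: ltW.
  rewrite mulr_ge0 ?addr_ge0 ?sqr_ge0//.
  by rewrite (exprM _ 2 2) sqr_ge0.
have er0 (z : R * R) : (0 <= (remainder_bound (growth C a) h z.1 z.2)%:E)%E by rewrite lee_fin.
(* The eighth moment (C8 sqrt h)^8 = C8^8 h^4 compensates the factor h^-4, leaving an expected
   remainder of order h^2. *)
have Er : (\int[P]_w (remainder_bound (growth C a) h (Y n w) (Y n.+1 w))%:E <=
    (h ^+ 2 * (K0 * (2 * B + 2 * B + C8 ^+ 8)))%:E)%E.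
  rewrite mulrCA mulrA.
  apply: (@integral_le_mono _ _ _ _ _ (fun w => K0 * h ^+ 2 * (2 * weight A (Y n w) ^+ r +
      2 * weight A (Y n.+1 w) ^+ r + h ^- 4 * `|Y n.+1 w - Y n w| ^+ 8))) => //.
  - exact: (measurableT_comp mr (measurable_fun_pair mYn mYn1)).
  - apply: measurable_funM => //; apply: measurable_funD; last exact: measurable_funM.
    by apply: measurable_funD; apply: measurable_funM => //; exact: mw.
  - move=> w; rewrite [h ^- 4 * _]mulrC.
    exact: (@remainder_bound_le _ C a K0 h A r (Y n w) h0 K1 r3 gK).
  have mw2 k : (k <= N)%N -> measurable_fun setT (fun w => 2 * weight A (Y k w) ^+ r).
    by move=> kN; apply: measurable_funM => //; exact: mw.
  have w20 (y : R) : 0 <= 2 * weight A y ^+ r by rewrite mulr_ge0.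
  have d0 w : 0 <= h ^- 4 * `|Y n.+1 w - Y n w| ^+ 8.
    by rewrite mulr_ge0 ?exprn_ge0// invr_ge0 exprn_ge0// ltW.
  have md : measurable_fun setT (fun w => h ^- 4 * `|Y n.+1 w - Y n w| ^+ 8).
    exact: measurable_funM.
  have E2 k : (k <= N)%N -> (\int[P]_w (2 * weight A (Y k w) ^+ r)%:E <= (2 * B)%:E)%E.
    by move=> kN; apply: integral_le_scale => //; [exact: mw|exact: mB].
  apply: integral_le_scale => //.
  - by rewrite mulr_ge0// ltW.
  - by apply: measurable_funD => //; apply: measurable_funD; exact: mw2.
  - by move=> w; rewrite !addr_ge0.
  apply: integral_le_add => //.
  - by apply: measurable_funD; exact: mw2.
  - by move=> w; rewrite addr_ge0.
  - by apply: integral_le_add => //; [exact: mw2|exact: mw2|exact: E2|exact: E2].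
  have -> : C8 ^+ 8 = h ^- 4 * (C8 * Num.sqrt h) ^+ 8.
    have s8 : Num.sqrt h ^+ 8 = h ^+ 4 by rewrite -[in RHS](sqr_sqrtr (ltW h0)) -exprM.
    by rewrite (exprMn 8 C8 (Num.sqrt h)) s8; field; rewrite gt_eqF.
  apply: integral_le_scale => //.
  by rewrite invr_ge0 exprn_ge0// ltW.
have ir : P.-integrable setT
    (fun w => (remainder_bound (growth C a) h (Y n w) (Y n.+1 w))%:E).
  apply/integrableP; split.
    exact: (measurableT_comp mer (measurable_fun_pair mYn mYn1)).
  under eq_integral => w _ do rewrite gee0_abs ?lee_fin//.
  by apply: le_lt_trans Er _; rewrite ltry.
have k0 := consistency_const_ge0 T0 L0 CJ0.
have s0 : 0 <= error_scale M L CJ K0 r.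
  rewrite mulr_ge0// mulr_ge0// !addr_ge0 ?mulr_ge0 ?addr_ge0 ?sqr_ge0 ?exprn_ge0//.
have hL0 : 0 <= 1 + 2 * h * L.
  by have := mulr_ge0 (ltW h0) L0; rewrite -[2 * h * L]mulrA; lra.
set H := h * (h + dx ^+ 2).
have H0 : 0 <= H by rewrite mulr_ge0 ?addr_ge0 ?sqr_ge0// ltW.
have hH : h ^+ 2 <= H by rewrite /H (expr2 h); apply: ler_wpM2l; [exact: ltW|rewrite lerDl sqr_ge0].
pose F (g : R -> R) w := (`|g (Y n w)| / h ^+ 2) `^ p.
have F0 g w : 0 <= F g w by exact: powR_ge0.
have mF (g : R -> R) : measurable_fun setT (fun w => g (Y n w)) -> measurable_fun setT (F g).
  move=> mg; apply: (measurableT_comp (f := fun s : R => s `^ p)).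
    exact: measurable_powR.
  by apply: measurable_funM => //; exact: measurableT_comp.
have EF (g : R -> R) : measurable_fun setT (fun w => g (Y n w)) ->
    (\int[P]_w (`|g (Y n w)| `^ p)%:E <= ((Cf * h ^+ 2) `^ p)%:E)%E ->
    (\int[P]_w (F g w)%:E <= (Cf `^ p)%:E)%E.
  move=> mg Eg; have h2' := ltW h20.
  have hi : 0 <= h ^- 2 by rewrite invr_ge0.
  have -> : Cf `^ p = (h ^- 2) `^ p * (Cf * h ^+ 2) `^ p.
    rewrite -powRM//; last exact: mulr_ge0.
    by congr (_ `^ p); field; rewrite gt_eqF.
  rewrite (_ : (fun w => (F g w)%:E) = (fun w => ((h ^- 2) `^ p * `|g (Y n w)| `^ p)%:E)).
    apply: integral_le_scale => //; first exact: powR_ge0.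
    - apply: (measurableT_comp (f := fun s : R => s `^ p)); first exact: measurable_powR.
      exact: measurableT_comp.
  apply/funext => w; by rewrite /F mulrC powRM.
have mcoef (q : R -> R) : measurable_fun (dom M) q -> measurable_fun setT (fun w => q (Y n w)).
  move=> mq; apply: (measurable_comp _ _ mq mYn).
    by apply: is_interval_measurable; exact: domain_is_interval (dom_convex hM).
  by move=> _ [w _ <-]; exact: (St_dom nN' (chain_St w nN')).
have [_ _ _ mmuY msY] := coefficients_measurable hM.
have mZ (Z Z' : Omega -> R) : is_cond_exp P Z' (Y n) Z -> measurable_fun setT Z.
  by move=> [_ /integrableP[/measurable_EFinP]].
(* [fh] itself carries no measurability; along the chain it is a version of the conditional mean
   minus the drift, both measurable. *)
have mfh : measurable_fun setT (fun w => fh (Y n w)).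
  have := measurable_funB (mZ _ _ c1) (measurable_funM (mcoef _ mmuY) (measurable_cst h)).
  by congr (measurable_fun _ _); apply/funext => w /=; ring.
have mgh : measurable_fun setT (fun w => gh (Y n w)).
  have := measurable_funB (mZ _ _ c2)
    (measurable_funM (measurable_funX 2 (mcoef _ msY)) (measurable_cst h)).
  by congr (measurable_fun _ _); apply/funext => w /=; ring.
have mjh := mZ _ _ c3.
pose G w := weight A (Y n w) ^+ r + (F fh w + F gh w + F jh w).
have mG : measurable_fun setT G.
  apply: measurable_funD; first exact: mw.
  by do 2?apply: measurable_funD; exact: mF.
have G0 w : 0 <= G w by rewrite !addr_ge0.
have EG : (\int[P]_w (error_scale M L CJ K0 r * H * G w)%:E <=
    (error_scale M L CJ K0 r * H * (B + (Cf `^ p + Cf `^ p + Cf `^ p)))%:E)%E.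
  apply: integral_le_scale => //; first exact: mulr_ge0.
  have m2 : measurable_fun setT (fun w => F fh w + F gh w) by apply: measurable_funD; exact: mF.
  apply: integral_le_add => //; [exact: mw|by apply: measurable_funD => //; exact: mF| | |].
  - by move=> w; rewrite !addr_ge0.
  - exact: mB.
  apply: integral_le_add => //; [exact: mF|by move=> w; rewrite addr_ge0| |exact: EF].
  by apply: integral_le_add => //; [exact: mF|exact: mF|exact: EF|exact: EF].
pose rw w := (\int[K n (Y n w)]_z (remainder_bound (growth C a) h (Y n w) z)%:E)%E.
have mrw : measurable_fun setT rw.
  exact: (measurableT_comp (measurable_fun_integral_finite_kernel _ (K n) er0 mer) mYn).
have rw0 w : (0 <= rw w)%E by apply: integral_ge0 => z _; rewrite lee_fin.
have Erw : (\int[P]_w rw w <= (h ^+ 2 * (K0 * (2 * B + 2 * B + C8 ^+ 8)))%:E)%E.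
  by rewrite /rw -(ge0_integral_pair_law mYn mYn1 hK er0 mer).
(* The error norm is measurable on [St n.+1] only; extended by 0 it becomes a measurable function on
   the line, unchanged along the chain. *)
pose phi : R -> \bar R := error_norm n.+1 \_ (St n.+1).
have mphi : measurable_fun setT phi.
  apply/(measurable_restrictT _ _).1; first exact: St_measurable.
  exact: measurable_error_norm.
have phi0 z : (0 <= phi z)%E.
  by rewrite /phi patchE; case: ifP => // _; exact: error_norm_ge0.
pose psi w := (\int[K n (Y n w)]_z phi z)%E.
have mphi2 : measurable_fun setT (fun z : R * R => phi z.2) by exact: measurableT_comp.
have mpsi : measurable_fun setT psi.
  exact: (measurableT_comp
    (measurable_fun_integral_finite_kernel _ (K n) (fun z => phi0 z.2) mphi2) mYn).
have psi0 w : (0 <= psi w)%E by exact: integral_ge0.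
have Epsi : (\int[P]_w psi w = \int[P]_w error_norm n.+1 (Y n.+1 w))%E.
  rewrite /psi -(ge0_integral_pair_law mYn mYn1 hK (fun z => phi0 z.2) mphi2).
  apply: eq_integral => w _; rewrite /phi patchE ifT// inE.
  exact: chain_St.
pose Phi w := ((error_scale M L CJ K0 r * H * G w)%:E +
  ((2 * consistency_const M L CJ)%R%:E * rw w + (1 + 2 * h * L)%R%:E * psi w))%E.
have sG0 w : (0 <= (error_scale M L CJ K0 r * H * G w)%:E)%E.
  by rewrite lee_fin mulr_ge0// mulr_ge0.
have krw0 w : (0 <= (2 * consistency_const M L CJ)%R%:E * rw w)%E.
  by rewrite mule_ge0// lee_fin mulr_ge0.
have lpsi0 w : (0 <= (1 + 2 * h * L)%R%:E * psi w)%E by rewrite mule_ge0// lee_fin.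
have msG : measurable_fun setT (fun w => (error_scale M L CJ K0 r * H * G w)%:E).
  by apply/measurable_EFinP; exact: measurable_funM.
have mkrw : measurable_fun setT (fun w => (2 * consistency_const M L CJ)%R%:E * rw w)%E.
  exact: measurable_funeM.
have mlpsi : measurable_fun setT (fun w => (1 + 2 * h * L)%R%:E * psi w)%E.
  exact: measurable_funeM.
apply: (@le_trans _ _ (\int[P]_w Phi w)%E).
  apply: ae_ge0_le_integral => //.
  - by move=> w _; exact: error_norm_ge0.
  - apply: (measurable_comp (St_measurable nN') _ (measurable_error_norm nN') mYn).
    by move=> _ [w _ <-]; exact: chain_St.
  - by move=> w _; rewrite !adde_ge0.
  - by apply: emeasurable_funD => //; exact: emeasurable_funD.
  apply: filterS (chain_step_ae nN c1 c2 c3 ir) => w [rem er le] _.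
  apply: le_trans le _; rewrite /Phi addeA; apply: leeD; last first.
    by rewrite /psi /phi -integral_mkcond.
  rewrite /rw -er -EFinM -EFinD lee_fin.
  have [h1 h2 h3] := dK _ (St_dom nN' (chain_St w nN')).
  exact: (@step_error_le _ M C a L CJ K0 h dx p A r (Y n w) T0 (ltW C0) L0 CJ0 h0 K1 p1 r3 rp gK _ _ _ _ h1 h2 h3).
rewrite /Phi ge0_integralD//; last 2 first.
- by move=> w _; rewrite adde_ge0.
- exact: emeasurable_funD.
rewrite ge0_integralD// [X in (_ + (X + _) <= _)%E]ge0_integralZl_EFin//; last first.
  by rewrite mulr_ge0.
rewrite [X in (_ + (_ + X) <= _)%E]ge0_integralZl_EFin// Epsi addeA; apply: leeD => //.
have -> : step_const M L CJ K0 r B C8 Cf p * H =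
    error_scale M L CJ K0 r * H * (B + (Cf `^ p + Cf `^ p + Cf `^ p)) +
    2 * consistency_const M L CJ * (H * (K0 * (2 * B + 2 * B + C8 ^+ 8))).
  by rewrite /step_const; ring.
rewrite [leRHS]EFinD; apply: leeD => //.
apply: (@le_trans _ _ ((2 * consistency_const M L CJ)%R%:E *
    (h ^+ 2 * (K0 * (2 * B + 2 * B + C8 ^+ 8)))%:E)%E).
  by apply: lee_wpmul2l => //; rewrite lee_fin mulr_ge0.
rewrite -EFinM lee_fin; apply: ler_wpM2l; first exact: mulr_ge0.
apply: ler_wpM2r => //.
rewrite mulr_ge0// addr_ge0 ?exprn_even_ge0//.
have B0 : 0 <= B.
  rewrite -lee_fin; apply: le_trans (mB n nN').
  by apply: integral_ge0 => w _; rewrite lee_fin.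
by rewrite addr_ge0// mulr_ge0.
Qed.

End chain_step.

Lemma l2norm0 {R : realType} (dx : R) : 0 < dx -> l2norm dx (fun=> 0) = 0%E.
Proof.
move=> dx0; rewrite l2normE//; last exact: l2s0.
have h : sqsum (fun=> 0 : R) <= 0.
  by apply: sqsum_le => n; rewrite /zbox big1// => k _; rewrite expr2 mul0r; exact: addr0.
by rewrite ler0_sqrtr// mulr_le0_ge0// ltW.
Qed.

(** Backward induction from the vanishing terminal error. All the powers of c are bounded by the
    largest, which gives N X c^N in place of a geometric sum; values are extended reals, so
    finiteness is part of the conclusion. *)
Lemma discrete_gronwall {R : realType} (N : nat) (a : nat -> \bar R) (X c : R) :
  0 <= X -> 1 <= c -> a N = 0%E ->
  (forall n, (n < N)%N -> a n <= X%:E + c%:E * a n.+1)%E ->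
  (a 0%N <= (N%:R * X * c ^+ N)%:E)%E.
Proof.
move=> X0 c1 aN step; have c0 : 0 <= c by exact: le_trans c1.
suff h k : (k <= N)%N -> (a (N - k)%N <= (k%:R * X * c ^+ k)%:E)%E.
  by have := h N (leqnn N); rewrite subnn.
elim: k => [_|k ih kN]; first by rewrite subn0 aN mul0r mul0r.
have e : (N - k.+1).+1 = (N - k)%N by rewrite subnSK.
have lt : (N - k.+1 < N)%N by rewrite -subn_gt0 subKn.
apply: le_trans (step _ lt) _; rewrite e.
apply: (@le_trans _ _ (X%:E + c%:E * (k%:R * X * c ^+ k)%:E)%E).
  by rewrite leeD2l// lee_wpmul2l// ih// ltnW.
rewrite -EFinM -EFinD lee_fin -natr1 exprS.
have ck : 1 <= c * c ^+ k by rewrite -exprS exprn_ege1.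
have : X <= X * (c * c ^+ k) by rewrite ler_peMr.
by move: (c ^+ k) => ck'; lra.
Qed.

Lemma common_weight_bound {R : realType} (M : jump_model R) (C a : R) :
  model_hypotheses M -> 0 < C -> 0 < a ->
  exists (A : nat) (K0 : R), [/\ 1 <= K0,
    forall z, growth C a z <= K0 * weight A z &
    forall z, dom M z -> [/\ `|muX M z| <= K0 * weight A z,
      `|muY M z| <= K0 * weight A z & `|sigmaX M z| <= K0 * weight A z]].
Proof.
move=> hM C0 a0; have [g1 g2 g3] := coefficients_growth hM.
have g4 : polynomial_growth setT (growth C a).
  exists C, a; split => // y _; rewrite ger0_norm//; apply: growth_ge0; exact: ltW.
have [K1 [A1 [K10 h1]]] := polynomial_growth_weight g1.
have [K2 [A2 [K20 h2]]] := polynomial_growth_weight g2.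
have [K3 [A3 [K30 h3]]] := polynomial_growth_weight g3.
have [K4 [A4 [K40 h4]]] := polynomial_growth_weight g4.
pose A := (A1 + A2 + A3 + A4)%N.
have w0 (z : R) : 0 <= weight A z by apply: le_trans (weight_ge1 A z).
exists A, (1 + K1 + K2 + K3 + K4); split; first lra.
- move=> z; have hz := h4 A (leq_addl _ _) z I.
  apply: le_trans (le_trans (ler_norm _) hz) _.
  by rewrite ler_wpM2r//; lra.
- move=> z Dz; split.
  + have lA : (A1 <= A)%N by rewrite /A; lia.
    by apply: le_trans (h1 A lA z Dz) _; rewrite ler_wpM2r//; lra.
  + have lA : (A2 <= A)%N by rewrite /A; lia.
    by apply: le_trans (h2 A lA z Dz) _; rewrite ler_wpM2r//; lra.
  + have lA : (A3 <= A)%N by rewrite /A; lia.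
    by apply: le_trans (h3 A lA z Dz) _; rewrite ler_wpM2r//; lra.
Qed.

Lemma weight_moment {R : realType} {d : measure_display} {T : measurableType d}
    (P : probability T R) (g : T -> R) (A r : nat) (c : R) :
  measurable_fun [set: T] g ->
  ('N[P]_((A * r + 2)%:R%:E)[EFin \o g] <= c%:E)%E ->
  (\int[P]_w (weight A (g w) ^+ r)%:E <= (2 ^+ r * (2 + c ^+ (A * r + 2)))%:E)%E.
Proof.
move=> mg hc; have mn k : measurable_fun setT (fun w => `|g w| ^+ k).
  by apply: measurable_funX; exact: measurableT_comp.
apply: (@integral_le_mono _ _ _ _ _ (fun w => 2 ^+ r * (2 + `|g w| ^+ (A * r + 2)))).
- by apply: measurable_funX; apply: measurable_funD.
- by apply: measurable_funM => //; exact: measurable_funD.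
- by move=> w; rewrite exprn_ge0//; apply: le_trans (weight_ge1 A _).
- by move=> w; exact: weight_exp_le.
apply: integral_le_scale => //.
- exact: measurable_funD.
apply: integral_le_add => //.
- rewrite integral_cst// -[X in (_ <= X)%E]mule1 lee_wpmul2l ?lee_fin//.
  exact: (probability_le1 P measurableT).
- by apply: Lnorm_natmoment => //; rewrite addn2.
Qed.

Theorem theorem4p6 (R : realType) (M : jump_model R) (X0 Y0 : R)
    (f : R -> R -> R) (u : R -> R -> R -> R)
    (S : sde_system R)
    (St : nat -> nat -> set R) (K : nat -> nat -> R.-pker R ~> R)
    (Yhat : nat -> nat -> sde_space S -> R)
    (hM : model_hypotheses M)
    (hY0 : dom M Y0)
    (hwp : weakly_well_posed M)
    (hS : weak_solution M 0 X0 Y0 S)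
    (hu : is_expected_payoff M f u)
    (hpide : solves_pide M f u)
    (hchain : forall N : nat, (0 < N)%N ->
       markov_chain (sde_prob S) M Y0 N (St N) (K N) (Yhat N))
    (hindep : forall N : nat, (0 < N)%N ->
       independent2 (sde_prob S)
         (sigma_of [set n | (n <= N)%N] (Yhat N))
         (sigma_join (sigma_of [set t : R | 0 <= t] (sde_B S))
                     (sigma_of [set t : R | 0 <= t] (sde_H S))))
    (hnu : levy_density_regular (levy_density M))
    (hH1 : assumption_H1 (sde_prob S) M Yhat)
    (hH2 : assumption_H2 (sde_prob S) M Yhat)
    (hreg : Cpol_Lp M 2%:E 6 u) :
  exists hbar C : R, [/\ 0 < hbar, 0 < C &
    forall (N : nat) (dx : R), (0 < N)%N -> step M N < hbar ->
      0 < dx -> dx < 1 ->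
      (l2norm dx (fun i => (u 0 (grid X0 dx i) Y0
                     - hybrid_scheme M X0 f N dx (St N) (K N) 0%N i Y0)%R)
        <= (C * horizon M * (step M N + dx ^+ 2))%:E)%E].
Proof.
have [_ [V [hV [C [a [C0 a0 hL]]]]]] := hreg.
have [L [CJ [L0 CJ0 hJ]]] := jump_constants hM hnu.
have [A [K0 [K1 gK dK]]] := common_weight_bound hM C0 a0.
have [hb1 [hb10 [fh [gh [jh [hce [p [Cf [p1 Cf0 hf]]]]]]]]] := hH1.
have [hb2 [hb20 hmom]] := hH2.
(* At least 3, since the pointwise bounds contain cubes of the weight, and at least the exponent
   conjugate to p, for Young's inequality. *)
pose r := (3 + (Num.truncn (p / (p - 1))).+1)%N.
have r3 : (3 <= r)%N by rewrite /r leq_addr.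
have rp : p / (p - 1) <= r%:R.
  have q0 : 0 <= p / (p - 1) by rewrite divr_ge0//; lra.
  have /andP[_ /ltW h1] := truncn_itv q0.
  by apply: le_trans h1 _; rewrite ler_nat leq_addl.
have lt1 : (1 : R) < (A * r + 2)%:R by rewrite ltr1n addn2.
have [Cm [Cm0 hm]] := hmom _ lt1.
have lt8 : (1 : R) < 8%:R by rewrite ltr1n.
have [C8 [C80 h8]] := hmom _ lt8.
pose B := 2 ^+ r * (2 + Cm ^+ (A * r + 2)).
(* The absolute value gives nonnegativity without a discussion of the signs inside. *)
pose Cs := `|step_const M L CJ K0 r B C8 Cf p|.
have T0 := horizon_gt0 hM.
(* The exponential bounds (1 + 2hL)^N uniformly in N because N h is the horizon; the + 1 makes the
   constant strictly positive. *)
exists (Num.min hb1 hb2), (Cs * expR (2 * L * horizon M) + 1); split.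
- by rewrite lt_min hb10.
- by rewrite ltr_wpDl// mulr_ge0//; exact: normr_ge0.
move=> N dx N0; rewrite lt_min => /andP[hh1 hh2] dx0 /ltW dx1.
set P := sde_prob S; set Y := Yhat N; set h := step M N.
have hc := hchain N N0.
have h0 : 0 < h by exact: step_gt0.
have [hmN _] := hm N N0 hh2; have [_ h8N] := h8 N N0 hh2.
have p0 : 0 < p by lra.
pose X := Cs * (h * (h + dx ^+ 2)).
have hd : 0 <= h + dx ^+ 2 by rewrite addr_ge0 ?sqr_ge0 // ltW.
have hhd : 0 <= h * (h + dx ^+ 2) by rewrite mulr_ge0 // ltW.
have X0' : 0 <= X by apply: mulr_ge0 => //; exact: normr_ge0.
pose c := 1 + 2 * h * L.
have hL0 : 0 <= 2 * h * L by rewrite !mulr_ge0// ltW.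
have c1 : 1 <= c by rewrite lerDl.
pose err n y := error_norm M f u X0 N dx (St N) (K N) n y.
pose av n := (\int[P]_w err n (Y n w))%E.
have aN : av N = 0%E.
  rewrite /av; apply: integral0_eq => w _.
  rewrite /err /error_norm -[RHS](l2norm0 dx0); congr (l2norm dx _).
  apply/funext => i; rewrite /error subnn /= (step_horizon M N0).
  have DY : dom M (Y N w) by exact: (St_dom hc (leqnn N) (chain_St hc w (leqnn N))).
  by have [-> _] := hpide.2 (grid X0 dx i) (Y N w) DY; rewrite subrr.
have stepE n : (n < N)%N -> (av n <= X%:E + c%:E * av n.+1)%E.
  move=> nN; have [ce1 ce2 ce3] := hce N n N0 hh1 nN.
  have [f1 f2 f3] := hf N n N0 hh1 (ltnW nN).
  have EB k : (k <= N)%N -> (\int[P]_w (weight A (Y k w) ^+ r)%:E <= B%:E)%E.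
    move=> kN; apply: weight_moment; first exact: (chain_measurable hc kN).
    exact: hmN.
  have E8 := Lnorm_natmoment (isT : (0 < 8)%N) (h8N n nN).
  have := expectation_step X0 hM hV hpide C0 a0 hL L0 CJ0 hJ N0 dx0 dx1 hc nN ce1 ce2 ce3
    K1 p1 r3 rp gK dK EB E8 (ltW Cf0) (Lnorm_moment p0 f1) (Lnorm_moment p0 f2)
    (Lnorm_moment p0 f3).
  move=> /le_trans; apply; apply: leeD => //.
  by rewrite lee_fin /X; apply: ler_wpM2r => //; exact: ler_norm.
have := discrete_gronwall X0' c1 aN stepE.
(* The chain starts at the constant [Y0], so the expectation at n = 0 is the error itself. *)
have -> : av 0%N = l2norm dx (fun i => (u 0 (grid X0 dx i) Y0
     - hybrid_scheme M X0 f N dx (St N) (K N) 0%N i Y0)%R).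
  rewrite /av; have [_ _ Y00 _ _] := hc.
  under eq_integral do rewrite /Y Y00.
  have PT : P [set: sde_space S] = 1%E by exact: probability_setT.
  rewrite integral_cst// [X in (_ * X)%E]PT mule1 /err /error_norm.
  by congr (l2norm dx _); apply/funext => i; rewrite /error mul0r.
move=> /le_trans; apply; rewrite lee_fin.
have cN : c ^+ N <= expR (2 * L * horizon M).
  have -> : 2 * L * horizon M = (2 * h * L) *+ N.
    by rewrite -(step_horizon M N0) -/h -mulr_natl; ring.
  rewrite -[_ *+ N]mulr_natr expRM_natr; apply: lerXn2r.
  - by rewrite nnegrE (le_trans _ c1).
  - by rewrite nnegrE expR_ge0.
  - exact: expR_ge1Dx.
(* N local errors of size h (h + dx^2) add up to the factor N h, which is the horizon in the
   conclusion. *)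
have -> : N%:R * X * c ^+ N = Cs * c ^+ N * horizon M * (h + dx ^+ 2).
  by rewrite /X -(step_horizon M N0) -/h; ring.
apply: ler_wpM2r => //; apply: ler_wpM2r; first exact: ltW.
apply: le_trans (ler_wpM2l _ cN) _; first exact: normr_ge0.
by rewrite lerDl.
Qed.
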